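(* If $G$ is a planar graph with maximum degree $\Delta(G)=4$ such that $G$ has no cycles of length from $4$ to $14$ (i.e. no cycle of length $i$ for any $4\leq i\leq 14$), then $\chi'_{gl}(G)=\Delta(G)$.
   Context: All graphs are finite and simple; $\Delta(G)$ is the maximum degree of $G$. $\ell(G)$ denotes the line graph of $G$ (its vertices are the edges of $G$, two being adjacent iff they share an endpoint in $G$). Let $H$ be a graph with a fixed orientation of its edges, $A$ an Abelian group, $L:V(H)\to 2^A$ a list assignment and $f:E(H)\to A$. An $(A,L,f)$-coloring of $H$ is a map $c:V(H)\to A$ with $c(v)\in L(v)$ for every vertex $v$ and $c(x)-c(y)\neq f(xy)$ for every edge $xy$ directed from $x$ to $y$. $H$ is $(A,L)$-colorable if it has an $(A,L,f)$-coloring for every $f:E(H)\to A$ (this does not depend on the orientation). $H$ is $k$-group choosable if it is $(A,L)$-colorable for every Abelian group $A$ of order at least $k$ and every $L$ with $|L(v)|=k$ for all $v\in V(H)$. $\chi_{gl}(H)$ is the smallest $k$ such that $H$ is $k$-group choosable. $\chi'_{gl}(G)=\chi_{gl}(\ell(G))$. *)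

(* Defs.v *)
From HB Require Import structures.
From mathcomp Require Import all_boot all_order all_algebra.
From mathcomp Require Import boolp classical_sets functions cardinality reals.

Set Implicit Arguments.
Unset Strict Implicit.
Unset Printing Implicit Defensive.

Import Order.TTheory GRing.Theory Num.Theory.
Local Open Scope ring_scope.

Record sgraph := SGraph {
  vertex :> finType;
  adj : rel vertex;
  adj_sym : symmetric adj;
  adj_irrefl : irreflexive adj }.

Definition degree (G : sgraph) (x : G) : nat := #|[set y | adj x y]|.

Definition max_degree (G : sgraph) : nat := (\max_(x : G) degree x)%N.

Definition edges (G : sgraph) : {set {set G}} :=
  [set [set p.1; p.2] | p : G * G & adj p.1 p.2].

Definition edge (G : sgraph) := {e : {set G} | e \in edges G}.

(* For sequences of length at least 3, [ucycle adj] says exactly that the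
   sequence lists the vertices of a graph cycle in cyclic order. *)
Definition has_cycle_of_length (G : sgraph) (n : nat) : Prop :=
  exists s : seq G, size s = n /\ ucycle (@adj G) s.

Section LineGraph.
Variable G : sgraph.

Definition line_adj : rel (edge G) :=
  fun e f => (e != f) && (val e :&: val f != finset.set0).

Lemma line_adj_sym : symmetric line_adj.
Proof. by move=> e f; rewrite /line_adj eq_sym finset.setIC. Qed.

Lemma line_adj_irrefl : irreflexive line_adj.
Proof. by move=> e; rewrite /line_adj eqxx. Qed.

Definition line_graph : sgraph := SGraph line_adj_sym line_adj_irrefl.

End LineGraph.

(* Planarity is the existence of a drawing in the plane whose edges are
   polygonal arcs, i.e. unions of finitely many straight line segments that are
   homeomorphic to [0, 1]; this is the definition of a plane graph in Diestel's
   textbook "Graph Theory". *)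
Section Planarity.
Variable R : realType.

Definition segment (a b : R * R) : set (R * R) :=
  [set p | exists2 t : R, 0 <= t <= 1 &
    p = ((1 - t) * a.1 + t * b.1, (1 - t) * a.2 + t * b.2)]%classic.

Fixpoint polyline (a : R * R) (s : seq (R * R)) : set (R * R) :=
  if s is b :: s' then (segment a b `|` polyline b s')%classic
  else [set a]%classic.

(* Each segment is nondegenerate and meets the rest of the line only in their
   common endpoint, so the line does not cross or touch itself. *)
Fixpoint simple_polyline (a : R * R) (s : seq (R * R)) : Prop :=
  if s is b :: s' then
    [/\ a <> b, (segment a b `&` polyline b s' = [set b])%classic
      & simple_polyline b s']
  else True.

Definition polygonal_arc (a b : R * R) (C : set (R * R)) : Prop :=
  exists s : seq (R * R),
    [/\ simple_polyline a s, last a s = b & C = polyline a s].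

Definition plane_drawing (G : sgraph) (pos : G -> R * R)
    (arc : edge G -> set (R * R)) : Prop :=
  [/\ injective pos,
      (forall (e : edge G) (x y : G), val e = [set x; y] ->
         polygonal_arc (pos x) (pos y) (arc e)),
      (forall (e : edge G) (z : G), arc e (pos z) -> z \in val e)
    & (forall (e f : edge G) (p : R * R), e <> f -> arc e p -> arc f p ->
         exists2 z : G, z \in val e & p = pos z)].

Definition planar (G : sgraph) : Prop :=
  exists (pos : G -> R * R) (arc : edge G -> set (R * R)),
    plane_drawing pos arc.

End Planarity.

Section GroupColoring.
Variable H : sgraph.

Definition is_orientation (D : rel H) : Prop :=
  forall x y : H, adj x y = D x y (+) D y x /\ (D x y -> adj x y).

Definition is_group_coloring (D : rel H) (A : zmodType) (L : H -> set A)
    (f : edge H -> A) (c : H -> A) : Prop :=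
  (forall v : H, L v (c v)) /\
  (forall (e : edge H) (x y : H), val e = [set x; y] -> D x y ->
     c x - c y <> f e).

Definition group_colorable (D : rel H) (A : zmodType) (L : H -> set A) : Prop :=
  forall f : edge H -> A, exists c : H -> A, is_group_coloring D L f c.

Definition std_orientation : rel H :=
  fun x y => adj x y && (enum_rank x < enum_rank y)%N.

Lemma std_orientationP : is_orientation std_orientation.
Proof.
move=> x y; rewrite /std_orientation; split; last by case/andP.
rewrite [adj y x]adj_sym; case xy: (adj x y) => //=.
case: ltngtP => // /ord_inj/enum_rank_inj exy.
by rewrite exy adj_irrefl in xy.
Qed.

Lemma group_colorable_orientation (D D' : rel H) (A : zmodType)
    (L : H -> set A) :
  is_orientation D -> is_orientation D' ->
  group_colorable D L -> group_colorable D' L.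
Proof.
move=> oD oD' DL f.
have D2 B x y : is_orientation B -> B x y -> ~~ B y x.
  by move=> oB Bxy; case: (oB x y); rewrite Bxy => -> // /(_ isT).
pose same (e : edge H) := [exists x, exists y,
  [&& val e == [set x; y], D x y & D' x y]].
have [c [cL cf]] := DL (fun e => if same e then f e else - f e).
exists c; split=> // e x y exy D'xy.
have axy : adj x y by case: (oD' x y) => _; exact.
have [Dxy|nDxy] := boolP (D x y).
  have := cf e x y exy Dxy; suff -> : same e by [].
  by apply/existsP; exists x; apply/existsP; exists y; rewrite exy eqxx Dxy.
have Dyx : D y x by case: (oD x y); rewrite axy (negbTE nDxy) /= => <-.
have := cf e y x; rewrite exy finset.setUC => /(_ erefl Dyx).
case: ifPn => [/existsP[u /existsP[v /and3P[/eqP euv Duv D'uv]]]|_].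
  have nuv : u != v by apply: contraTneq Duv => ->; apply/negP => Dvv;
    have := D2 _ _ _ oD Dvv; rewrite Dvv.
  have : u \in [set x; y] by rewrite -exy euv !inE eqxx.
  have : v \in [set x; y] by rewrite -exy euv !inE eqxx orbT.
  rewrite !inE => /orP[]/eqP ev /orP[]/eqP eu; subst u v.
  - by rewrite eqxx in nuv.
  - by have := D2 _ _ _ oD' D'xy; rewrite D'uv.
  - by rewrite Duv in nDxy.
  - by rewrite eqxx in nuv.
by move=> cyx cxy; apply: cyx; rewrite -cxy opprB.
Qed.

(* The choice of the orientation is immaterial, see
   [group_colorable_orientation].  The group [A] may be infinite. *)
Definition group_choosable (k : nat) : Prop :=
  forall (A : zmodType) (L : H -> set A),
    (`I_k #<= [set: A])%card -> (forall v : H, (L v #= `I_k)%card) ->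
    group_colorable std_orientation L.

Definition is_min_group_choosable (k : nat) : Prop :=
  group_choosable k /\ forall j : nat, group_choosable j -> (k <= j)%N.

End GroupColoring.

(* [xget 0] picks the unique number with this property; the default 0 would
   only be used if there were none, which does not happen as [H] is finite. *)
Definition chi_gl (H : sgraph) : nat :=
  xget 0%N [set k | is_min_group_choosable H k]%classic.

Definition chi'_gl (G : sgraph) : nat := chi_gl (line_graph G).

(* Main.v *)
From mathcomp Require Import boolp classical_sets functions cardinality.
Require Import Defs.
From mathcomp Require Import all_boot all_order all_algebra.
From mathcomp Require Import reals.
From mathcomp Require Import zify ring lra.

(** Lower bound: the four edges at a vertex of degree four are pairwise adjacent
in the line graph, so if all lists are the same [j] integers and all shifts
are 0, a colouring uses four different colours and [4 <= j].

Upper bound: the only thing that matters about the group is that the colour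
of an edge excludes at most one colour at an adjacent edge. After numbering
every list by ['I_4], one has to colour the edges so that a conflict relation
[R], functional in each direction, is avoided between adjacent edges; this is
correspondence colouring, and [edges_colourable] proves it for every such [R].
Suppose that it fails and let [S] be a minimal set of edges that cannot be
coloured. The contradiction comes from two sides.

Reducible configurations. Greedy colouring gives degree sum at least 6 on
every edge of [S] ([deg_sum]). Call a vertex of degree two lying in a triangle
an ear, and a vertex of degree four next to two ears a centre: its four edges
lie in two triangles, a bow tie. A bow tie alone need not be reducible, but it
nearly is: fix the colours beyond its far end; then at most two pairs of
colours on the other two edges at the near end, no two of them agreeing in a
coordinate, cannot be extended across it ([bad_uniq], [card_bad]). This rests
on [reach_two]: some colour of the edge from the centre to the near end leaves
two colours for the edge from the centre to the near ear. Consequently two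
centres are never adjacent ([bowties_not_adjacent]), and a triangle cannot
have bow ties at two corners when its third corner has degree three or is
next to an ear ([small_third_reducible], [ear_third_reducible]).

Sparsity. Let [T] be the number of triangles. A planar graph with [m > 0] edges,
[n] non-isolated vertices and no cycle of length 4 to 14 satisfies
[13 m < 15 n + 12 T] ([planar_sparse]). Indeed, sweeping a drawing from left
to right produces at least [m - n + 1] regions ([drawing_regions]); every
boundary is a set of edges with even degrees, hence has at least fifteen edges
or is a union of triangles ([small_even_set]), and since the adjacency graph
of the regions is connected, at most [T] regions, unless all of them, are of
the second kind ([glued_regions]). Each edge bounds at most two regions, so
adding up the boundaries gives the inequality.

Discharging. Delete the ears from [S]. For the remaining kernel, with degree
[d v] and [t v] triangles at [v], the inequality says that the sum of
[13 d v - 8 t v - 30] is negative. Only centres and vertices of degree two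
outside triangles are negative, with value -4; each receives 2 from either
neighbour. Afterwards [vertex_charge] leaves only the corners that serve a
centre in debt, by one per triangle, and by reducibility the other corners of
their triangle pay for them ([triangle_balance]). So the sum is nonnegative. *)

Set Implicit Arguments.
Unset Strict Implicit.
Unset Printing Implicit Defensive.

Import Order.TTheory GRing.Theory Num.Theory.

(** * Sweeping a drawing from left to right *)

Lemma identify_points (I : finType) (f g : I) :
  exists (J : finType) (h : I -> J),
    [/\ forall j, exists i, h i = j, h f = h g & #|I| <= #|J|.+1].
Proof.
have [->|nfg] := eqVneq f g.
  by exists I, id; split=> // j; exists j.
have ngf : g != f by rewrite eq_sym.
exists {i : I | i != f}, (fun i => insubd (exist _ g ngf) i); split.
- by move=> j; exists (val j); rewrite valKd.
- apply: val_inj; rewrite !val_insubd ngf eqxx //.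
- by rewrite card_sig cardC1 leqSpred.
Qed.

(** A graph with vertex set [I] and edge list [W] has at least [#|I| - size W]
    components; [J] is the set of components or a coarser quotient. *)
Lemma identify_pairs (I : finType) (W : seq (I * I)) :
  exists (J : finType) (h : I -> J),
    [/\ forall j, exists i, h i = j, forall p, p \in W -> h p.1 = h p.2
      & #|I| <= #|J| + size W].
Proof.
elim: W => [|[f g] W [J [h [hs hW cIJ]]]].
  by exists I, id; split=> //; [move=> j; exists j | rewrite addn0].
have [K [k [ks kfg cJK]]] := identify_points (h f) (h g).
exists K, (k \o h); split=> /=.
- by move=> j; have [i <-] := ks j; have [l <-] := hs i; exists l.
- by move=> p; rewrite inE => /predU1P[-> //|/hW->].
- by rewrite addnS -addSn; apply: leq_trans cIJ _; rewrite leq_add2r.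
Qed.

Section Sweep.
Variable T : eqType.
Implicit Types (s : T) (l : seq T).

(** Reading a vertical line upwards, [sd s] being the labels of the regions
    below and above the segment [s]: the line starts in region [x], crosses
    the segments of [l] in order, and ends in region [y]. *)
Fixpoint walk (I : Type) (sd : T -> I * I) (x : I) l (y : I) : Prop :=
  if l is s :: l' then (sd s).1 = x /\ walk sd (sd s).2 l' y else x = y.

Definition separates (I : Type) (sd : T -> I * I) (phi : I -> bool) s : bool :=
  phi (sd s).1 (+) phi (sd s).2.

Lemma walk_cat (I : Type) (sd : T -> I * I) x l1 l2 y :
  walk sd x (l1 ++ l2) y <-> exists2 z, walk sd x l1 z & walk sd z l2 y.
Proof.
elim: l1 x => [|s l1 IH] x /=; first by split=> [w|[z -> //]]; exists x.
split=> [[<- /IH[z w1 w2]]|[z [<- w1] w2]]; first by exists z.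
by split=> //; apply/IH; exists z.
Qed.

Lemma odd_separates (I : Type) (sd : T -> I * I) phi x l y :
  walk sd x l y -> odd (count (separates sd phi) l) = phi x (+) phi y.
Proof.
elim: l x => [|s l IH] x /=; first by move=> ->; rewrite addbb.
by case=> <- /IH; rewrite oddD => ->; rewrite oddb /separates addbA addbK.
Qed.

Lemma walk_map (I J : Type) (h : I -> J) (sd : T -> I * I) (sd' : T -> J * J) x l y :
  (forall s, s \in l -> sd' s = (h (sd s).1, h (sd s).2)) ->
  walk sd x l y -> walk sd' (h x) l (h y).
Proof.
elim: l x => [|s l IH] x /= hl; first by move=> ->.
case=> <- w; rewrite hl ?mem_head //=; split=> //.
by apply: IH w => t tl; apply: hl; rewrite inE tl orbT.
Qed.

Lemma separates_map (I J : Type) (h : I -> J) (sd : T -> I * I)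
    (sd' : T -> J * J) phi s :
  sd' s = (h (sd s).1, h (sd s).2) ->
  separates sd' phi s = separates sd (phi \o h) s.
Proof. by rewrite /separates => ->. Qed.

(** Segments that start at a common point, in the region [f], open one new
    region above each of them. The region [g] above the topmost one is new
    as well: it is identified afterwards with the region that was above the
    point, which also covers the case of an empty fan. *)
Lemma add_fan (I : finType) (sd : T -> I * I) (f : I) l : uniq l ->
  exists (J : finType) (h : I -> J) (sd' : T -> J * J) (g : J),
    [/\ forall s, s \notin l -> sd' s = (h (sd s).1, h (sd s).2),
        walk sd' (h f) l g, #|J| = #|I| + size l
      & forall phi : J -> bool, (forall s, s \in l -> ~~ separates sd' phi s) ->
          forall j, phi j = phi (h f) \/ exists i, j = h i].
Proof.
elim: l I sd f => [|s l IH] I sd f /=.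
  move=> _; exists I, id, sd, f; split=> //.
  - by move=> s _; case: (sd s).
  - by rewrite addn0.
  - by move=> phi _ j; right; exists j.
case/andP=> sl ul.
pose sd1 t := if t == s then (Some f, None)
  else (Some (sd t).1, Some (sd t).2).
have [J [h [sd' [g [hsd w cJ hphi]]]]] := IH (option I) sd1 None ul.
have sds : sd' s = (h (Some f), h None) by rewrite hsd // /sd1 eqxx.
exists J, (h \o Some), sd', g; split.
- move=> t; rewrite inE negb_or => /andP[ts tl].
  by rewrite hsd // /sd1 (negbTE ts).
- by rewrite /= sds.
- by rewrite cJ card_option addSnnS.
move=> phi sep j /=.
have e0 : phi (h None) = phi (h (Some f)).
  have := sep s (mem_head _ _); rewrite /separates sds /=.
  by case: (phi _) (phi _) => [] [].
case: (hphi phi _ j) => [t tl|->|[[i|] ->]].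
- by apply: sep; rewrite inE tl orbT.
- by left.
- by right; exists i.
- by left.
Qed.

(** The list is the state of a vertical line moving to the right: the segments
    that it crosses, from bottom to top. At a point of the drawing the block
    [L] of segments ending there is replaced by the block [R] of those
    starting there; the pairs [(L, R)] are recorded. *)
Inductive sweep : seq (seq T * seq T) -> seq T -> Prop :=
| SweepStart : sweep [::] [::]
| SweepEvent ev lo L R hi :
    sweep ev (lo ++ L ++ hi) -> uniq R ->
    (forall s, s \in R -> s \notin flatten (map snd ev)) ->
    sweep ((L, R) :: ev) (lo ++ R ++ hi).

Lemma sweep_started ev l : sweep ev l ->
  {subset l <= flatten (map snd ev)} /\
  forall x, x \in ev -> {subset x.1 ++ x.2 <= flatten (map snd ev)}.
Proof.
elim=> {ev l} [|ev lo L R hi _ [IH1 IH2] uR fR]; first by split.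
split=> [s|x] /=.
  have := IH1 s; rewrite !mem_cat.
  by case: (s \in lo) (s \in L) (s \in R) (s \in hi) => [] [] [] [] //= H _;
     apply: H.
rewrite inE => /predU1P[->|xev] s /=; last first.
  by move=> /(IH2 _ xev) so; rewrite mem_cat so orbT.
have := IH1 s; rewrite !mem_cat.
by case: (s \in lo) (s \in L) (s \in R) (s \in hi) => [] [] [] [] //= H _;
   apply: H.
Qed.

(** Every event adds [size R] regions and then identifies two, so that in the
    end there are at least [1 + #segments - #events] of them. The number of
    segments around a point that separate a given set of regions from the rest
    is even because the labels telescope along [L] and along [R], between the
    same two regions. *)
Theorem sweep_regions ev l : sweep ev l ->
  exists (I : finType) (sd : T -> I * I) (o : I),
    [/\ walk sd o l o,
        size (flatten (map snd ev)) < #|I| + size ev,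
        forall x phi, x \in ev ->
          ~~ odd (count (separates sd phi) (x.1 ++ x.2))
      & forall phi : I -> bool,
          (forall s, s \in flatten (map snd ev) -> ~~ separates sd phi s) ->
          forall i, phi i = phi o].
Proof.
elim=> {ev l} [|ev lo L R hi sw [I [sd [o [w cI par con]]]] uR fR].
  exists unit, (fun=> (tt, tt)), tt; split=> //; first by rewrite card_unit.
  by move=> phi _ [].
have [st1 st2] := sweep_started sw.
move/walk_cat: w => [f wlo /walk_cat[g wL whi]].
have [J [h [sd1 [g1 [hsd wR cJ conJ]]]]] := add_fan sd f uR.
have [K [k [ks kg cK]]] := identify_points g1 (h g).
pose sd' s := (k (sd1 s).1, k (sd1 s).2).
have old s : s \in flatten (map snd ev) ->
    sd' s = ((k \o h) (sd s).1, (k \o h) (sd s).2).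
  by move=> so; rewrite /sd' hsd //; apply: contraL so => /fR.
have oldl l1 : {subset l1 <= flatten (map snd ev)} -> forall s, s \in l1 ->
    sd' s = ((k \o h) (sd s).1, (k \o h) (sd s).2).
  by move=> l1o s /l1o/old.
have slo : {subset lo <= lo ++ L ++ hi} by move=> s; rewrite !mem_cat => ->.
have sL : {subset L <= lo ++ L ++ hi}.
  by move=> s; rewrite !mem_cat => ->; rewrite orbT.
have shi : {subset hi <= lo ++ L ++ hi}.
  by move=> s; rewrite !mem_cat => ->; rewrite !orbT.
have wlo' := walk_map (oldl lo (fun s sl => st1 s (slo s sl))) wlo.
have wL' := walk_map (oldl L (fun s sl => st1 s (sL s sl))) wL.
have whi' := walk_map (oldl hi (fun s sl => st1 s (shi s sl))) whi.
have wR' : walk sd' ((k \o h) f) R ((k \o h) g).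
  by rewrite /= -kg; apply: (walk_map (h := k) _ wR).
exists K, sd', (k (h o)); split.
- by apply/walk_cat; exists (k (h f)) => //; apply/walk_cat; exists (k (h g)).
- rewrite /= size_cat addnS ltnS.
  move: cI; rewrite -(leq_add2r (size R)) addSn addnAC -cJ => cI.
  have := leq_trans cI (leq_add cK (leqnn (size ev))).
  by rewrite addSn ltnS addnC.
- move=> x phi; rewrite inE => /predU1P[->|xev] /=.
    by rewrite count_cat oddD !(odd_separates _ wL', odd_separates _ wR') addbb.
  rewrite (@eq_in_count _ _ (separates sd (phi \o (k \o h)))); first exact: par.
  by move=> s sx; apply/separates_map/old/(st2 x).
move=> phi sep i.
have [j <-] := ks i.
have base m : phi (k (h m)) = phi (k (h o)).
  apply: (con (phi \o (k \o h))) => s so.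
  rewrite -(separates_map _ (old s so)).
  by apply: sep; rewrite /= mem_cat so orbT.
case: (conJ (phi \o k) _ j) => /= [s sR|->|[m ->]]; [|exact: base|exact: base].
by apply: (sep s); rewrite /= mem_cat sR.
Qed.

End Sweep.

(** * Straight segments in general position *)

Lemma filter3_of_sorted_key d (K : orderType d) (T : eqType) (key : T -> K) c (l : seq T) :
  pairwise (fun s t => (key s <= key t)%O) l ->
  l = [seq s <- l | (key s < c)%O] ++ [seq s <- l | key s == c]
        ++ [seq s <- l | (c < key s)%O].
Proof.
elim: l => //= s l IH /andP[/allP sl /IH lE].
case: (ltgtP (key s) c) => sc.
- by rewrite {1}lE.
- have lt0 : [seq t <- l | (key t < c)%O] = [::].
    apply/eqP; rewrite -[_ == _]negbK -has_filter; apply/hasPn => t tl.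
    by rewrite -leNgt (le_trans (ltW sc)) // sl.
  have eq0 : [seq t <- l | key t == c] = [::].
    apply/eqP; rewrite -[_ == _]negbK -has_filter; apply/hasPn => t tl.
    by rewrite gt_eqF // (lt_le_trans sc) // sl.
  by rewrite {1}lE lt0 eq0.
- have lt0 : [seq t <- l | (key t < c)%O] = [::].
    apply/eqP; rewrite -[_ == _]negbK -has_filter; apply/hasPn => t tl.
    by rewrite -leNgt -sc sl.
  by rewrite {1}lE lt0.
Qed.

Section StraightDrawing.
Local Open Scope ring_scope.
Variables (R : realFieldType) (T : eqType) (a b : T -> R * R) (segs : seq T).
Implicit Types (s t : T) (z v : R * R).

Definition slope s : R := ((b s).2 - (a s).2) / ((b s).1 - (a s).1).
Definition ht s (x : R) : R := (a s).2 + (x - (a s).1) * slope s.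
Definition on_graph s z : Prop :=
  (a s).1 <= z.1 <= (b s).1 /\ z.2 = ht s z.1.

Hypothesis uniq_segs : uniq segs.
Hypothesis left_right : forall s, s \in segs -> (a s).1 < (b s).1.
Hypothesis meet_at_ends : forall s t z, s \in segs -> t \in segs -> s != t ->
  on_graph s z -> on_graph t z -> (z == a s) || (z == b s).
Variable pts : seq (R * R).
Hypothesis uniq_pts : uniq pts.
Hypothesis mem_pts :
  forall z, z \in pts <-> exists2 s, s \in segs & (z == a s) || (z == b s).
Hypothesis generic : {in pts &, forall z v, z.1 = v.1 -> z = v}.

Lemma ht_left s : ht s (a s).1 = (a s).2.
Proof. by rewrite /ht subrr mul0r addr0. Qed.

Lemma ht_right s : s \in segs -> ht s (b s).1 = (b s).2.
Proof.
move=> /left_right ab; rewrite /ht /slope mulrC divfK ?subrKC //.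
by rewrite subr_eq0 gt_eqF.
Qed.

Lemma on_left s : s \in segs -> on_graph s (a s).
Proof. by move=> /left_right/ltW ab; split; rewrite ?ht_left ?lexx. Qed.

Lemma on_right s : s \in segs -> on_graph s (b s).
Proof.
by move=> sS; have /ltW ab := left_right sS; split; rewrite ?ht_right ?lexx ?ab.
Qed.

Definition spans s x := (a s).1 <= x <= (b s).1.

(** The difference of the two heights is affine. If it changed sign it would
    vanish strictly between [x0] and [x], giving a common point that is an
    end of neither segment. *)
Lemma no_crossing s t x0 x : s \in segs -> t \in segs -> s != t ->
  spans s x0 -> spans t x0 -> spans s x -> spans t x ->
  ht s x0 < ht t x0 -> ht s x <= ht t x.
Proof.
move=> sS tS st s0 t0 sx tx lt0; rewrite leNgt; apply/negP => lt1.
pose D0 := ht t x0 - ht s x0; pose D1 := ht s x - ht t x.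
have D00 : 0 < D0 by rewrite subr_gt0.
have D10 : 0 < D1 by rewrite subr_gt0.
have DD : D0 + D1 != 0 by rewrite gt_eqF // addr_gt0.
(* The heights agree at the fraction [m] of the way from [x0] to [x]. *)
pose m := D0 / (D0 + D1).
have m0 : 0 < m by rewrite divr_gt0 // addr_gt0.
have m1 : m < 1.
  rewrite /m ltr_pdivrMr; last exact: addr_gt0.
  by rewrite mul1r ltrDl.
pose z := x0 + (x - x0) * m.
have hz : ht t z = ht s z.
  apply/eqP; rewrite -subr_eq0; apply/eqP.
  suff -> : ht t z - ht s z = D0 - (D0 + D1) * m.
    by rewrite /m mulrC divfK // subrr.
  by rewrite /z /D0 /D1 /ht; ring.
have mx : 0 < 1 - m by rewrite subr_gt0.
have xx : x0 != x.
  by apply: contraTneq lt1 => <-; rewrite -leNgt ltW.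
have [z0 z1] : Num.min x0 x < z /\ z < Num.max x0 x.
  rewrite /z; case: (ltgtP x0 x) xx => // xx _.
    have : 0 < (x - x0) * m by rewrite mulr_gt0 // subr_gt0.
    have : 0 < (x - x0) * (1 - m) by rewrite mulr_gt0 // subr_gt0.
    by move=> *; split; lra.
  have : 0 < (x0 - x) * m by rewrite mulr_gt0 // subr_gt0.
  have : 0 < (x0 - x) * (1 - m) by rewrite mulr_gt0 // subr_gt0.
  by move=> *; split; lra.
have inside u : spans u x0 -> spans u x -> (a u).1 < z < (b u).1.
  move=> /andP[u0 u1] /andP[u2 u3]; apply/andP; split.
    by apply: le_lt_trans z0; rewrite le_min u0.
  by apply: lt_le_trans z1 _; rewrite ge_max u1.
have /andP[zs1 zs2] := inside s s0 sx; have /andP[zt1 zt2] := inside t t0 tx.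
have /= := @meet_at_ends s t (z, ht s z) sS tS st _ _.
rewrite -!pair_eqE /= ?(gt_eqF zs1) ?(lt_eqF zs2) /= => H.
suff : false by []; apply: H; split=> //=; by rewrite !ltW.
Qed.

(** This order does not mention the position of the sweep line, so that it
    persists from one event to the next. *)
Definition below s t := (s != t) &&
  `[< forall x, spans s x -> spans t x -> ht s x <= ht t x >].

Lemma below_of_lt s t x0 : s \in segs -> t \in segs ->
  spans s x0 -> spans t x0 -> ht s x0 < ht t x0 -> below s t.
Proof.
move=> sS tS s0 t0 lt0.
have st : s != t by apply: contraTneq lt0 => ->; rewrite ltxx.
rewrite /below st; apply/asboolP => x sx tx.
exact: (no_crossing (x0 := x0)).
Qed.

Lemma below_fan v : pairwise below
  (sort (fun s t => slope s <= slope t) [seq s <- segs | a s == v]).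
Proof.
set l := sort _ _.
have ul : uniq l by rewrite sort_uniq filter_uniq.
have : pairwise (fun s t => slope s <= slope t) l.
  rewrite -sorted_pairwise; last by move=> s t u; apply: le_trans.
  by apply: sort_sorted => s t; apply: le_total.
rewrite uniq_pairwise in ul; move=> pl.
have : pairwise [rel s t | (s != t) && (slope s <= slope t)] l.
  by rewrite pairwise_relI ul.
apply: (sub_in_pairwise (P := [pred s | a s == v])); last first.
  by apply/allP => s; rewrite mem_sort mem_filter => /andP[].
move=> s t /eqP sv /eqP tv /andP[st sl]; rewrite /below st; apply/asboolP.
move=> x /andP[sx _] _; rewrite /ht sv tv lerD2l ler_wpM2l // subr_ge0.
by rewrite -sv.
Qed.

Definition incident v : pred T := [pred s | (a s == v) || (b s == v)].

(** The sweep has passed the points of [d]. The segments crossing the line are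
    ordered by [below], hence their heights at the next point [v] increase and
    those ending at [v] form a contiguous block. *)
Lemma sweep_prefix d r :
  pairwise (fun z v : R * R => z.1 < v.1) (d ++ r) -> perm_eq (d ++ r) pts ->
  exists ev l,
  [/\ sweep ev l /\ size ev = size d, pairwise below l,
      forall s, (s \in l) = [&& s \in segs, a s \in d & b s \notin d],
      perm_eq (flatten (map snd ev)) [seq s <- segs | a s \in d]
    & forall v, v \in d ->
        exists2 x, x \in ev & perm_eq (x.1 ++ x.2) (filter (incident v) segs)].
Proof.
elim/last_ind: d r => [|d v IH] r srt prm.
  exists [::], [::]; split=> //.
  - by split; first exact: SweepStart.
  - by move=> s; rewrite andbF.
  - by rewrite /= (eq_filter (a2 := pred0)) ?filter_pred0.
rewrite cat_rcons in srt prm.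
have [ev [l [[sw sz] pl ml pev iev]]] := IH _ srt prm.
move: (srt); rewrite pairwise_cat /= => /and3P[/allrelP dlt pd /andP[vr pr]].
have dv z : z \in d -> z.1 < v.1 by move=> zd; apply: dlt; rewrite ?mem_head.
have rv z : z \in r -> v.1 < z.1 by move=> zr; apply: (allP vr).
have vd : v \notin d by apply/negP => /dv; rewrite ltxx.
have vp : v \in pts by rewrite -(perm_mem prm) mem_cat mem_head orbT.
have mp z : z \in pts -> [\/ z \in d, z = v | z \in r].
  rewrite -(perm_mem prm) mem_cat inE.
  by case/or3P=> [?|/eqP ?|?]; [apply: Or31|apply: Or32|apply: Or33].
have ap s : s \in segs -> a s \in pts.
  by move=> sS; apply/mem_pts; exists s; rewrite // eqxx.
have bp s : s \in segs -> b s \in pts.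
  by move=> sS; apply/mem_pts; exists s; rewrite // eqxx orbT.
pose key s := ht s v.1.
have spn s : s \in l -> spans s v.1.
  rewrite ml => /and3P[sS sd bd]; apply/andP; split; first exact/ltW/dv.
  have [bd'|->|/rv/ltW//] := mp _ (bp _ sS); last exact: lexx.
  by rewrite bd' in bd.
have keyl : pairwise (fun s t => key s <= key t) l.
  apply: (sub_in_pairwise (P := [in l])) pl; last by apply/allP.
  by move=> s t /spn sv /spn tv /andP[_ /asboolP]; apply.
have lE := filter3_of_sorted_key v.2 keyl.
move: lE; set lo := filter _ l; set L := filter _ l; set hi := filter _ l => lE.
pose F := sort (fun s t => slope s <= slope t) [seq s <- segs | a s == v].
have mL s : (s \in L) = (s \in segs) && (b s == v).
  rewrite mem_filter; apply/andP/andP => [[/eqP ks sl]|[sS /eqP bv]].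
    have := sl; rewrite ml => /and3P[sS sd bd]; split=> //.
    have vs : on_graph s v by split; [exact: spn | rewrite -ks].
    have nva : (v == a s) = false.
      by apply/eqP => va; rewrite va in vd; rewrite sd in vd.
    have [t tS vt] := (mem_pts v).1 vp.
    have [st|st] := eqVneq s t; first by move: vt; rewrite -st nva eq_sym.
    have vt' : on_graph t v.
      by case/orP: vt => /eqP->; [apply: on_left|apply: on_right].
    by have := meet_at_ends sS tS st vs vt'; rewrite nva eq_sym.
  rewrite -bv ml sS /key -{1}bv ht_right //= bv eqxx; split=> //.
  rewrite vd andbT; have := left_right sS; rewrite bv.
  by have [//|->|/rv] := mp _ (ap _ sS); [rewrite ltxx | move=> /lt_trans/[apply]; rewrite ltxx].
have mF s : (s \in F) = (s \in segs) && (a s == v).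
  by rewrite mem_sort mem_filter andbC.
have bF s : s \in F -> b s \notin rcons d v.
  rewrite mF => /andP[sS /eqP av]; have := left_right sS; rewrite av => lt.
  rewrite mem_rcons inE negb_or; apply/andP; split.
    by apply: contraTneq lt => ->; rewrite ltxx.
  by apply: contraL lt => /dv/ltW; rewrite -leNgt.
have ul : uniq l.
  by rewrite uniq_pairwise; apply: sub_pairwise pl => s t /andP[].
have uF : uniq F by rewrite sort_uniq filter_uniq.
have spF s : s \in F -> spans s v.1.
  rewrite mF => /andP[sS /eqP <-]; rewrite /spans lexx /=.
  exact/ltW/left_right.
have kF s : s \in F -> key s = v.2.
  by rewrite mF => /andP[sS /eqP av]; rewrite /key -av ht_left.
have lS s : s \in l -> s \in segs by rewrite ml => /and3P[].
have FS s : s \in F -> s \in segs by rewrite mF => /andP[].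
exists ((L, F) :: ev), (lo ++ F ++ hi); split.
- split; last by rewrite /= sz size_rcons.
  apply: SweepEvent => //; first by rewrite -lE.
  move=> s; rewrite mF (perm_mem pev) mem_filter => /andP[_ /eqP->].
  by rewrite (negbTE vd).
- rewrite !pairwise_cat below_fan !(subseq_pairwise (filter_subseq _ _) pl).
  rewrite allrel_catr !andbT /= -andbA; apply/and3P; split.
  + apply/allrelP => s t; rewrite mem_filter => /andP[ks sl] tF.
    apply: (below_of_lt (x0 := v.1)).
    * exact: lS. * exact: FS. * exact: spn. * exact: spF.
    * by rewrite -/(key t) kF.
  + apply/allrelP => s t; rewrite !mem_filter => /andP[ks sl] /andP[kt tl].
    by apply: (below_of_lt (x0 := v.1)); rewrite ?lS ?spn // (lt_trans ks).
  + apply/allrelP => s t sF; rewrite mem_filter => /andP[kt tl].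
    apply: (below_of_lt (x0 := v.1)).
    * exact: FS. * exact: lS. * exact: spF. * exact: spn.
    * by rewrite -/(key s) kF.
- move=> s; rewrite !mem_cat mF !mem_filter /= -/(key s).
  have -> : (key s < v.2) && (s \in l) || ((s \in segs) && (a s == v) ||
      (v.2 < key s) && (s \in l)) =
      (s \in l) && (s \notin L) || (s \in segs) && (a s == v).
    rewrite mem_filter.
    by case: (ltgtP (key s) v.2); case: (s \in l); case: (_ && (a s == v)).
  rewrite mL ml !mem_rcons !inE !negb_or.
  case sS : (s \in segs) => //=.
  have := @bF s; rewrite mF sS /= mem_rcons inE negb_or.
  by case: (a s == v); case: (a s \in d); case: (b s \in d); case: (b s == v) => //= /(_ isT).
- rewrite /=; apply: uniq_perm; rewrite ?filter_uniq //.
    rewrite cat_uniq uF (perm_uniq pev) filter_uniq // andbT /=.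
    apply/hasPn => s; rewrite (perm_mem pev) mem_filter mF => /andP[sd _].
    by apply: contraNN vd => /andP[_ /eqP <-].
  move=> s; rewrite mem_cat (perm_mem pev) !mem_filter mF mem_rcons inE.
  by rewrite andbC -andb_orl.
move=> z; rewrite mem_rcons inE => /predU1P[->|zd].
  exists (L, F); rewrite ?mem_head //=.
  apply: uniq_perm; rewrite ?filter_uniq //.
    rewrite cat_uniq filter_uniq // uF andbT /=; apply/hasPn => s.
    rewrite mF mL => /andP[sS /eqP av]; rewrite sS /=.
    by have := left_right sS; rewrite -av; apply: contraTneq => ->; rewrite ltxx.
  by move=> s; rewrite mem_cat mL mF mem_filter /= -andb_orr andbC orbC.
have [x xe px] := iev z zd; exists x => //.
by rewrite inE xe orbT.
Qed.

Theorem straight_regions :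
  exists (I : finType) (sd : T -> I * I) (o : I),
    [/\ (size segs < #|I| + size pts)%N,
        forall v phi, ~~ odd (count (predI (separates sd phi) (incident v)) segs)
      & forall phi : I -> bool, (forall s, s \in segs -> ~~ separates sd phi s) ->
          forall i, phi i = phi o].
Proof.
pose ps := sort (fun z v : R * R => z.1 <= v.1) pts.
have pp : perm_eq (ps ++ [::]) pts by rewrite cats0 perm_sort.
have up : uniq ps by rewrite sort_uniq.
have srt : pairwise (fun z v : R * R => z.1 < v.1) (ps ++ [::]).
  rewrite cats0.
  have : pairwise [rel z v : R * R | (z != v) && (z.1 <= v.1)] ps.
    rewrite pairwise_relI; rewrite uniq_pairwise in up; rewrite up /=.
    rewrite -sorted_pairwise; last by move=> z v w; apply: le_trans.
    by apply: sort_sorted => z v; apply: le_total.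
  apply: (sub_in_pairwise (P := [in pts])).
    move=> z v zp vp /andP[zv le]; rewrite lt_neqAle le andbT.
    by apply: contraNneq zv => /(generic zp vp)->.
  by apply/allP => z; rewrite mem_sort.
have [ev [l [[sw sz] _ _ pev iev]]] := sweep_prefix srt pp.
have [I [sd [o [_ cI par con]]]] := sweep_regions sw.
have pall : perm_eq (flatten (map snd ev)) segs.
  apply: perm_trans pev _; rewrite (all_filterP _) //; apply/allP => s sS.
  by rewrite mem_sort; apply/mem_pts; exists s; rewrite // eqxx.
exists I, sd, o; split.
- by rewrite -(perm_size pall) -(size_sort (fun z v : R * R => z.1 <= v.1)) -sz.
- move=> v phi.
  have [vp|vp] := boolP (v \in ps).
    have [x xe /permP px] := iev v vp.
    by have := par x phi xe; rewrite px count_filter.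
  rewrite (eq_in_count (a2 := pred0)) ?count_pred0 // => s sS /=.
  apply/andP => -[_ inc]; case/negP: vp; rewrite mem_sort.
  by apply/mem_pts; exists s; rewrite // [v == _]eq_sym [v == b s]eq_sym.
- by move=> phi sep; apply: con => s; rewrite (perm_mem pall); apply: sep.
Qed.

End StraightDrawing.

(** * Shearing, and polygonal lines *)

Section Shear.
Local Open Scope ring_scope.
Variable R : realType.
Implicit Types (z v : R * R).

Lemma segmentC z v w : segment z v w -> segment v z w.
Proof.
case=> t /andP[t0 t1] ->; exists (1 - t).
  by rewrite subr_ge0 t1 lerBlDr lerDl.
by congr pair; ring.
Qed.

Lemma segment_left z v : segment z v z.
Proof.
exists 0; first by rewrite lexx ler01.
by rewrite subr0 !mul1r !mul0r !addr0; case: z.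
Qed.

Lemma segment_right z v : segment z v v.
Proof. exact/segmentC/segment_left. Qed.

Lemma exists_upper_bound (l : seq R) : exists M, forall x, x \in l -> x < M.
Proof.
elim: l => [|x l [M HM]]; first by exists 0.
exists (Num.max (x + 1) M) => y; rewrite inE lt_max => /predU1P[->|/HM->].
  by rewrite ltrDl ltr01.
by rewrite orbT.
Qed.

Definition shear (c : R) z : R * R := (z.1 + c * z.2, z.2).

Lemma shear_inj c : injective (shear c).
Proof.
by move=> [x y] [x' y'] [] /= e1 e2; move: e1; rewrite e2 => /addIr ->.
Qed.

(** Only finitely many shears put two of the given points on a vertical line. *)
Lemma generic_shear (pts : seq (R * R)) :
  exists c, {in pts &, forall z v, (shear c z).1 = (shear c v).1 -> z = v}.
Proof.
have [M HM] := exists_upper_bound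
  [seq (v.1 - z.1) / (z.2 - v.2) | z <- pts, v <- pts].
exists M => z v zp vp /= e.
have [e2|ne2] := eqVneq z.2 v.2.
  by apply: (@shear_inj M); rewrite /shear e e2.
have : (v.1 - z.1) / (z.2 - v.2) < M by apply: HM; apply: allpairs_f.
suff -> : (v.1 - z.1) / (z.2 - v.2) = M by rewrite ltxx.
have nz : z.2 - v.2 != 0 by rewrite subr_eq0.
by apply: (canLR (mulfK nz)); lra.
Qed.

Variables (T : eqType) (p q : T -> R * R) (segs : seq T).
Hypothesis uniq_segs : uniq segs.
Hypothesis nondegenerate : forall s, s \in segs -> p s != q s.
Hypothesis meet_at_ends : forall s t z, s \in segs -> t \in segs -> s != t ->
  segment (p s) (q s) z -> segment (p t) (q t) z -> (z == p s) || (z == q s).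
Variable pts : seq (R * R).
Hypothesis uniq_pts : uniq pts.
Hypothesis mem_pts :
  forall z, z \in pts <-> exists2 s, s \in segs & (z == p s) || (z == q s).

Theorem segment_regions :
  exists (I : finType) (sd : T -> I * I) (o : I),
    [/\ (size segs < #|I| + size pts)%N,
        forall v phi,
          ~~ odd (count (predI (separates sd phi) (incident p q v)) segs)
      & forall phi : I -> bool, (forall s, s \in segs -> ~~ separates sd phi s) ->
          forall i, phi i = phi o].
Proof.
have [c gen] := generic_shear pts.
pose sh := shear c.
pose fwd s := (sh (p s)).1 < (sh (q s)).1.
pose a s := if fwd s then sh (p s) else sh (q s).
pose b s := if fwd s then sh (q s) else sh (p s).
have pp s : s \in segs -> p s \in pts.
  by move=> sS; apply/mem_pts; exists s; rewrite // eqxx.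
have qp s : s \in segs -> q s \in pts.
  by move=> sS; apply/mem_pts; exists s; rewrite // eqxx orbT.
have ab s : s \in segs -> (a s).1 < (b s).1.
  move=> sS; rewrite /a /b; case: ifP => // /negbT.
  rewrite /fwd -leNgt le_eqVlt => /predU1P[|//] /esym e.
  by have := gen _ _ (pp s sS) (qp s sS) e; move/eqP: (nondegenerate sS).
have seg s z : s \in segs -> on_graph a b s (sh z) -> segment (p s) (q s) z.
  move=> sS [/andP[az zb] hz].
  have d0 : 0 < (b s).1 - (a s).1 by rewrite subr_gt0 ab.
  have dn : (b s).1 - (a s).1 != 0 by rewrite gt_eqF.
  pose t := ((sh z).1 - (a s).1) / ((b s).1 - (a s).1).
  have t01 : 0 <= t <= 1.
    rewrite divr_ge0 ?subr_ge0 ?(ltW (ab s sS)) //=.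
    by rewrite ler_pdivrMr // mul1r lerD2r.
  have comb (u v w : R) : (1 - w) * u + w * v = u + w * (v - u) by ring.
  have e1 : (sh z).1 = (1 - t) * (a s).1 + t * (b s).1.
    by rewrite comb /t divfK // subrKC.
  have e2 : (sh z).2 = (1 - t) * (a s).2 + t * (b s).2.
    by rewrite comb hz /ht /slope mulrA mulrAC.
  have ez u v : sh u = a s -> sh v = b s -> segment u v z.
    move=> ua vb; exists t; first by [].
    move: e1 e2; rewrite -ua -vb /sh /shear /=; move: (t) => w.
    case: (z) => z1 z2 /= e1 e2; congr pair => //.
    by move: e1; rewrite e2 => e1; apply: (addIr (c * ((1 - w) * u.2 + w * v.2)));
       rewrite e1; ring.
  by move: ez; rewrite /a /b; case: (fwd s) => ez; [apply: ez|apply/segmentC/ez].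
have shK z : sh (z.1 - c * z.2, z.2) = z by case: z => x y; rewrite /sh /shear /= subrK.
have sh_eq z v : (sh z == sh v) = (z == v) by rewrite (inj_eq (@shear_inj c)).
have ends s z : (sh z == a s) || (sh z == b s) = (z == p s) || (z == q s).
  by rewrite /a /b; case: (fwd s); rewrite !sh_eq // orbC.
have mends s t z : s \in segs -> t \in segs -> s != t ->
    on_graph a b s z -> on_graph a b t z -> (z == a s) || (z == b s).
  move=> sS tS st; rewrite -(shK z) ends => /(seg _ _ sS) zs /(seg _ _ tS).
  exact: meet_at_ends.
have [|z|z v /mapP[z' z'p ->] /mapP[v' v'p ->] e|I [sd [o [cI par con]]]] :=
  @straight_regions R T a b segs uniq_segs ab mends (map sh pts).
- by rewrite map_inj_uniq //; apply: shear_inj.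
- rewrite -(shK z) mem_map; last exact: shear_inj.
  rewrite mem_pts; split=> -[s sS]; rewrite -?ends => h; exists s => //.
  by rewrite -ends.
- by rewrite (gen z' v').
exists I, sd, o; split=> //; first by rewrite -(size_map sh pts).
move=> v phi; have := par (sh v) phi; congr (~~ odd _); apply: eq_count => s /=.
have := ends s v; rewrite ![sh v == _]eq_sym ![v == _]eq_sym => h.
by congr (_ && _); exact: h.
Qed.

End Shear.

Section Polylines.
Local Open Scope ring_scope.
Variable R : realType.
Implicit Types (z w x : R * R) (l : seq (R * R)).

Definition piece x l (j : nat) : set (R * R) :=
  segment (nth x (x :: l) j) (nth x l j).

Lemma pieceS x y l j : (j < size l)%N -> piece x (y :: l) j.+1 = piece y l j.
Proof.
move=> jl; rewrite /piece /=; congr segment; apply: set_nth_default => //=.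
by rewrite ltnS ltnW.
Qed.

Lemma polyline_piece x l j z : (j < size l)%N -> piece x l j z -> polyline x l z.
Proof.
elim: l x j => //= y l IH x [|j] /= jl; first by left.
by rewrite pieceS // => /(IH y j jl); right.
Qed.

Lemma simple_nondegenerate x l j : (j < size l)%N -> simple_polyline x l ->
  nth x (x :: l) j <> nth x l j.
Proof.
elim: l x j => //= y l IH x [|j] /= jl [xy _ sl] //.
have := IH y j jl sl; congr (_ <> _); apply: set_nth_default => //=.
by rewrite ltnS ltnW.
Qed.

Lemma simple_piece_first x l k : (k < size l)%N -> simple_polyline x l ->
  piece x l k x -> k = 0%N.
Proof.
case: k l => [|k] [|y l] //= kl [xy /seteqP[cap _] sl].
rewrite pieceS // => h.
case: xy; have /cap : (segment x y `&` polyline y l)%classic x; last by [].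
by split; [exact: segment_left | exact: polyline_piece h].
Qed.

(** By simplicity the first piece touches the rest only at its end, and that
    point lies on the second piece, where it is the starting point. *)
Lemma simple_piece_meet x l j k z : (j < k < size l)%N -> simple_polyline x l ->
  piece x l j z -> piece x l k z -> k = j.+1 /\ z = nth x l j.
Proof.
elim: l x j k => [|y l IH] x j [|k] /=; rewrite ?andbF // !ltnS => /andP[jk kl].
case=> xy /seteqP[cap _] sl hj; rewrite pieceS // => hk.
case: j jk hj => [|j] jk hj.
  have zy : z = y.
    have : (segment x y `&` polyline y l)%classic z.
      by split=> //; apply: polyline_piece hk.
    by move/cap.
  by rewrite zy in hk *; rewrite (simple_piece_first kl sl hk).
have jl : (j < size l)%N by apply: leq_ltn_trans kl; apply: ltnW.
rewrite pieceS // in hj.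
have [|-> ->] := IH y j k _ sl hj hk; first by rewrite jk.
by split=> //=; apply: set_nth_default.
Qed.

Lemma simple_piece_last x l k : (k < size l)%N -> simple_polyline x l ->
  piece x l k (last x l) -> k.+1 = size l.
Proof.
move=> kl sl hk; apply/eqP; rewrite eqn_leq kl leqNgt; apply/negP => kl1.
have l0 : (0 < size l)%N by apply: leq_ltn_trans kl.
have lm : ((size l).-1 < size l)%N by rewrite prednK.
have nl : nth x l (size l).-1 = last x l by rewrite nth_last; case: (l) l0.
have hl : piece x l (size l).-1 (last x l).
  by rewrite /piece nl; apply: segment_right.
have [|e1 e2] := simple_piece_meet _ sl hk hl.
  by rewrite lm andbT -ltnS prednK.
by have := simple_nondegenerate lm sl; rewrite nl e2 e1.
Qed.

End Polylines.

(** * The regions of a drawing *)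

Section PlanarRegions.
Variables (R : realType) (G : sgraph) (E : {set {set G}}).
Hypothesis subE : E \subset edges G.
Variables (pos : G -> R * R) (arc : edge G -> set (R * R)).
Hypothesis drawing : plane_drawing pos arc.
Variables (X Y : {set G} -> G) (S : {set G} -> seq (R * R)).
Hypothesis edgeE : forall e, e \in E -> e = [set X e; Y e]%SET.
Hypothesis edge_neq : forall e, e \in E -> X e != Y e.
Hypothesis simpleS : forall e, e \in E -> simple_polyline (pos (X e)) (S e).
Hypothesis lastS : forall e, e \in E -> last (pos (X e)) (S e) = pos (Y e).
Hypothesis arcS : forall e : edge G, val e \in E ->
  arc e = polyline (pos (X (val e))) (S (val e)).

Let T := ({set G} * nat)%type.
Definition piece_start (s : T) := nth (pos (X s.1)) (pos (X s.1) :: S s.1) s.2.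
Definition piece_end (s : T) := nth (pos (X s.1)) (S s.1) s.2.
Definition pieces : seq T := [seq (e, j) | e <- enum E, j <- iota 0 (size (S e))].

Lemma mem_pieces e j : ((e, j) \in pieces) = (e \in E) && (j < size (S e)).
Proof.
apply/allpairsPdep/andP => [[e' [j' [e'E j'S [-> ->]]]]|[eE jS]].
  by move: e'E j'S; rewrite mem_enum mem_iota.
by exists e, j; rewrite mem_enum mem_iota.
Qed.

Lemma uniq_pieces : uniq pieces.
Proof.
apply: allpairs_uniq_dep => [|e _|]; rewrite ?enum_uniq ?iota_uniq //.
by move=> [e j] [f k] _ _ /= [-> ->].
Qed.

Lemma posI : injective pos. Proof. by case: drawing. Qed.

Lemma S_gt0 e : e \in E -> 0 < size (S e).
Proof.
move=> eE; have := edge_neq eE; have := lastS eE; case: (S e) => //= /posI ->.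
by rewrite eqxx.
Qed.

Lemma on_arc e (He : e \in edges G) j z : (e, j) \in pieces ->
  piece (pos (X e)) (S e) j z -> arc (exist _ e He) z.
Proof.
rewrite mem_pieces => /andP[eE jS] h; rewrite arcS //=.
exact: polyline_piece h.
Qed.

Lemma pieces_share_vertex e f j k z : (e, j) \in pieces -> (f, k) \in pieces ->
  e != f -> piece (pos (X e)) (S e) j z -> piece (pos (X f)) (S f) k z ->
  exists2 v, v \in e & z = pos v.
Proof.
move=> ej fk nef he hf.
have eE : e \in E by move: ej; rewrite mem_pieces => /andP[].
have fE : f \in E by move: fk; rewrite mem_pieces => /andP[].
have He := subsetP subE _ eE; have Hf := subsetP subE _ fE.
case: drawing => _ _ _ /(_ (exist _ e He) (exist _ f Hf) z) H.
by apply: H (on_arc He ej he) (on_arc Hf fk hf) => -[] ef; rewrite ef eqxx in nef.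
Qed.

Lemma piece_at_vertex e j v : (e, j) \in pieces -> v \in e ->
  piece (pos (X e)) (S e) j (pos v) ->
  (v = X e /\ j = 0) \/ (v = Y e /\ j.+1 = size (S e)).
Proof.
rewrite mem_pieces => /andP[eE jS].
rewrite {1}(edgeE eE) !inE => /orP[]/eqP-> h; [left|right]; split=> //.
  exact: simple_piece_first jS (simpleS eE) h.
by apply: simple_piece_last jS (simpleS eE) _; rewrite lastS.
Qed.

Lemma pieces_meet_at_ends s t z : s \in pieces -> t \in pieces -> s != t ->
  segment (piece_start s) (piece_end s) z ->
  segment (piece_start t) (piece_end t) z ->
  (z == piece_start s) || (z == piece_end s).
Proof.
case: s t => [e j] [f k] sP tP nst hs ht.
have [eE jS] := andP (etrans (esym (mem_pieces e j)) sP).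
have [fE kS] := andP (etrans (esym (mem_pieces f k)) tP).
have [ef|nef] := eqVneq e f.
  subst f; have {nst} njk : j != k by apply: contraNneq nst => ->.
  case: (ltngtP j k) njk => // jk _.
    have [|_ ->] := simple_piece_meet _ (simpleS eE) hs ht; first by rewrite jk.
    by rewrite eqxx orbT.
  have [|/= e1 ->] := simple_piece_meet _ (simpleS eE) ht hs; first by rewrite jk.
  by rewrite /piece_start /= e1 eqxx.
have [v ve zv] := pieces_share_vertex sP tP nef hs ht.
rewrite zv in hs *.
case: (piece_at_vertex sP ve hs) => -[-> jE].
  by rewrite /piece_start /= jE eqxx.
by rewrite -(lastS eE) (last_nth (pos (X e))) -jE /= /piece_end eqxx orbT.
Qed.

Definition vertex_points := [seq pos v | v <- enum (cover E)].
Definition break_points :=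
  [seq nth (pos (X e)) (S e) j | e <- enum E, j <- iota 0 (size (S e)).-1].
Definition end_points :=
  undup ([seq piece_start s | s <- pieces] ++ [seq piece_end s | s <- pieces]).

Lemma mem_end_points z : z \in end_points <->
  exists2 s, s \in pieces & (z == piece_start s) || (z == piece_end s).
Proof.
rewrite mem_undup mem_cat; split.
  by case/orP=> /mapP[s sP ->]; exists s; rewrite ?eqxx ?orbT.
by case=> s sP /orP[]/eqP->; rewrite map_f ?orbT.
Qed.

(** An edge drawn with [k] pieces has [k - 1] break points, so that
    subdividing changes neither side of the Euler count. *)
Lemma size_end_points :
  size end_points + #|E| <= #|cover E| + size pieces.
Proof.
have : {subset end_points <= vertex_points ++ break_points}.
  have Xc e : e \in E -> pos (X e) \in vertex_points.
    move=> eE; apply/map_f; rewrite mem_enum; apply/bigcupP; exists e => //.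
    by rewrite {2}(edgeE eE) !inE eqxx.
  have Yc e : e \in E -> pos (Y e) \in vertex_points.
    move=> eE; apply/map_f; rewrite mem_enum; apply/bigcupP; exists e => //.
    by rewrite {2}(edgeE eE) !inE eqxx orbT.
  have bc e j : e \in E -> j.+1 < size (S e) ->
      nth (pos (X e)) (S e) j \in break_points.
    move=> eE jS; apply/allpairsPdep; exists e, j; split; rewrite ?mem_enum //.
    by rewrite mem_iota add0n leq0n -ltnS prednK // (leq_ltn_trans _ jS).
  move=> z /mem_end_points[[e j]]; rewrite mem_pieces => /andP[eE jS].
  rewrite mem_cat /piece_start /piece_end /=; case/orP=> /eqP->.
    case: j jS => [|j] jS /=; first by rewrite Xc.
    by rewrite bc ?orbT.
  have [jl|] := boolP (j.+1 < size (S e)); first by rewrite bc ?orbT.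
  rewrite -leqNgt => Sj; have ej : j.+1 = size (S e) by apply/eqP; rewrite eqn_leq jS.
  have -> : nth (pos (X e)) (S e) j = pos (Y e).
    by rewrite -(lastS eE) (last_nth (pos (X e))) -ej.
  by rewrite Yc.
move/(uniq_leq_size (undup_uniq _)); rewrite size_cat size_map -cardE => le.
rewrite -(leq_add2r #|E|) in le; apply: leq_trans le _.
rewrite -addnA leq_add2l !size_allpairs_dep !sumnE !big_map.
rewrite cardE -sum1_size -big_split /= big_seq [leqRHS]big_seq.
by apply: leq_sum => e; rewrite mem_enum !size_iota => /S_gt0 S0; rewrite addn1 prednK.
Qed.

Let inc := incident piece_start piece_end.

Lemma incident_piece s z : inc z s -> segment (piece_start s) (piece_end s) z.
Proof.
by case/orP=> /eqP <-; [apply: segment_left | apply: segment_right].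
Qed.

(** Two pieces meet at a break point, and evenness there forces both to
    separate the same regions: an edge separates the same regions all along
    its polygonal line. *)
Lemma incident_break e j : e \in E -> j.+1 < size (S e) ->
  {in pieces, inc (nth (pos (X e)) (S e) j) =1 pred2 (e, j) (e, j.+1)}.
Proof.
move=> eE jS [f k] fP; set z := nth _ _ j.
have ej : (e, j) \in pieces by rewrite mem_pieces eE ltnW.
have ej1 : (e, j.+1) \in pieces by rewrite mem_pieces eE.
apply/idP/idP => [fz|]; last first.
  by case/orP=> /eqP[-> ->]; rewrite /inc /incident /= /piece_start /piece_end /= eqxx ?orbT.
have hf := incident_piece fz.
have h0 : piece (pos (X e)) (S e) j z by apply: segment_right.
have h1 : piece (pos (X e)) (S e) j.+1 z by apply: segment_left.
have [ef|nef] := eqVneq e f.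
  subst f; rewrite /= !xpair_eqE eqxx /=.
  have kS : k < size (S e) by move: fP; rewrite mem_pieces => /andP[].
  case: (ltngtP k j) => //= [kj|jk].
    have [|/= e1 e2] := simple_piece_meet _ (simpleS eE) hf h0.
      by rewrite kj ltnW.
    by case: (simple_nondegenerate (ltnW jS) (simpleS eE)); rewrite -/z e2 e1.
  have [|/= e1 e2] := simple_piece_meet _ (simpleS eE) h0 hf; first by rewrite jk.
  by rewrite e1 eqxx.
have [v ve zv] := pieces_share_vertex ej fP nef h0 hf.
rewrite zv in h0 h1.
case: (piece_at_vertex ej1 ve h1) => -[e1 e2] //.
case: (piece_at_vertex ej ve h0) => -[e3 e4].
  by have := edge_neq eE; rewrite -e1 -e3 eqxx.
by move: jS; rewrite e4 ltnn.
Qed.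

Definition end_piece (v : G) (e : {set G}) : T :=
  (e, if v == X e then 0 else (size (S e)).-1).

Lemma end_pieceP v e : e \in E -> v \in e ->
  (end_piece v e \in pieces) && inc (pos v) (end_piece v e).
Proof.
move=> eE; rewrite mem_pieces eE /= {1}(edgeE eE) !inE.
rewrite /inc /incident /end_piece /piece_start /piece_end /=.
have S0 := S_gt0 eE.
have [-> _|nvX /= /eqP->] := eqVneq v (X e); first by rewrite S0 /= eqxx.
rewrite prednK // leqnn /=; apply/orP; right.
by rewrite -(lastS eE) nth_last; case: (S e) S0.
Qed.

Lemma incident_vertex v :
  perm_eq (filter (inc (pos v)) pieces) [seq end_piece v e | e in [set e in E | v \in e]%SET].
Proof.
apply: uniq_perm; first by rewrite filter_uniq // uniq_pieces.
  by rewrite map_inj_uniq ?enum_uniq // => e f [].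
move=> [e j]; rewrite mem_filter.
apply/andP/mapP => [[ev eP]|[f]]; last first.
  by rewrite mem_enum inE => /andP[fE vf] ->; apply/andP; rewrite andbC end_pieceP.
have [eE jS] := andP (etrans (esym (mem_pieces e j)) eP).
have He := subsetP subE _ eE.
have h := incident_piece ev.
have ve : v \in e.
  by case: drawing => _ _ /(_ (exist _ e He) v (on_arc He eP h)).
exists e; first by rewrite mem_enum inE eE.
rewrite /end_piece; case: (piece_at_vertex eP ve h) => -[-> jE].
  by rewrite eqxx jE.
by rewrite eq_sym (negbTE (edge_neq eE)) -jE.
Qed.

(** The regions of the subdivided drawing, read off on the first piece of each
    edge. *)
Lemma drawing_regions :
  exists (I : finType) (sd : {set G} -> I * I) (o : I),
    [/\ #|E| < #|I| + #|cover E|,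
        forall v phi, ~~ odd #|[set e in E | (v \in e) && separates sd phi e]%SET|
      & forall phi : I -> bool, (forall e, e \in E -> ~~ separates sd phi e) ->
          forall i, phi i = phi o].
Proof.
have nondeg s : s \in pieces -> piece_start s != piece_end s.
  case: s => e j; rewrite mem_pieces => /andP[eE jS]; apply/eqP.
  exact: simple_nondegenerate (simpleS eE).
have [I [sd [o [cI par con]]]] := segment_regions uniq_pieces nondeg
  pieces_meet_at_ends (undup_uniq _) mem_end_points.
pose sd0 e := sd (e, 0).
have sep0 phi e j : (e, j) \in pieces ->
    separates sd phi (e, j) = separates sd0 phi e.
  rewrite mem_pieces => /andP[eE]; elim: j => [//|j IH] jS.
  rewrite -IH 1?ltnW //; have := par (nth (pos (X e)) (S e) j) phi.
  have ej : (e, j) \in pieces by rewrite mem_pieces eE ltnW.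
  have ej1 : (e, j.+1) \in pieces by rewrite mem_pieces eE.
  rewrite (@eq_in_count _ _ (predU (predI (separates sd phi) (pred1 (e, j)))
      (predI (separates sd phi) (pred1 (e, j.+1))))); last first.
    move=> s sP; apply: etrans (congr1 (andb _) (incident_break eE jS sP)) _.
    by rewrite /= andb_orr.
  have cnt s : s \in pieces -> count (predI (separates sd phi) (pred1 s)) pieces
      = separates sd phi s.
    move=> sP; have := count_uniq_mem s uniq_pieces; rewrite sP => c1.
    case: (boolP (separates sd phi s)) => ss.
      rewrite -[RHS]c1; apply: eq_count => t /=.
      by have [->|] := eqVneq t s; rewrite ?ss ?andbF.
    apply/eqP; rewrite -leqn0 leqNgt -has_count; apply/hasPn => t _ /=.
    by have [->|] := eqVneq t s; rewrite ?(negbTE ss) ?andbF.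
  have := count_predUI (predI (separates sd phi) (pred1 (e, j)))
    (predI (separates sd phi) (pred1 (e, j.+1))) pieces.
  rewrite [X in _ + X = _](_ : _ = 0); last first.
    apply/eqP; rewrite -leqn0 leqNgt -has_count; apply/hasPn => t _ /=.
    have [->|] := eqVneq t (e, j); rewrite ?andbF //= xpair_eqE eqxx /=.
    by rewrite eqn_leq ltnn !andbF.
  rewrite addn0 => ->; rewrite !cnt // oddD !oddb.
  by case: (separates _ _ (e, j)); case: (separates _ _ (e, j.+1)).
exists I, sd0, o; split.
- move: size_end_points cI; rewrite -/end_points.
  by move: (size pieces) (size end_points) #|E| #|cover E| #|I| => *; lia.
- move=> v phi.
  have := par (pos v) phi; rewrite -count_filter.
  have /permP-> := incident_vertex v.
  rewrite count_map; congr (~~ odd _).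
  rewrite cardE -size_filter; apply/perm_size/uniq_perm.
  + by rewrite filter_uniq // enum_uniq.
  + exact: enum_uniq.
  move=> e; rewrite mem_filter !mem_enum !inE /=.
  case eE: (e \in E); rewrite ?andbF //= andbC; case: (boolP (v \in e)) => //= ve.
  by have /andP[eP _] := end_pieceP eE ve; rewrite sep0.
move=> phi sep; apply: con => -[e j] eP.
by rewrite sep0 // sep //; move: eP; rewrite mem_pieces => /andP[].
Qed.

End PlanarRegions.

(** * Even sets of edges and triangles *)

Section EdgeSets.
Variable V : finType.
Implicit Types (E X Y : {set {set V}}) (e t : {set V}) (x y z v : V).

Definition star E v := [set e in E | v \in e].
Definition tedges t := [set e : {set V} | (#|e| == 2) && (e \subset t)].
Definition triangles E := [set t : {set V} | (#|t| == 3) && (tedges t \subset E)].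
Definition linked E : rel V := fun x y => [set x; y] \in E.
Definition two_sets E := forall e, e \in E -> #|e| = 2.
Definition girth15 E := forall s : seq V, ucycle (linked E) s -> 3 < size s -> 14 < size s.

Lemma in_star E e v : (e \in star E v) = (e \in E) && (v \in e).
Proof. by rewrite inE. Qed.

Lemma linkedC E x y : linked E x y = linked E y x.
Proof. by rewrite /linked setUC. Qed.

Lemma linked_neq E x y : two_sets E -> linked E x y -> x != y.
Proof. by move=> E2 /E2; rewrite cards2; case: eqVneq. Qed.

Lemma edge_at E e x : two_sets E -> e \in E -> x \in e ->
  exists y, [/\ x != y, e = [set x; y] & linked E x y].
Proof.
move=> E2 eE xe; have /eqP/cards2P[u [v [nuv eE']]] := E2 e eE.
have : x \in [set u; v] by rewrite -eE'.
rewrite !inE /linked => /orP[]/eqP->.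
  by exists v; rewrite -eE'.
by exists u; rewrite eq_sym nuv setUC -eE'.
Qed.

Lemma sub_two_sets E X : X \subset E -> two_sets E -> two_sets X.
Proof. by move=> /subsetP XE E2 e /XE/E2. Qed.

Lemma sub_girth15 E X : X \subset E -> girth15 E -> girth15 X.
Proof.
move=> /subsetP XE g s /andP[cs us]; apply: g; rewrite /ucycle us andbT.
by apply: sub_cycle cs => x y /XE.
Qed.

Lemma sum_star E : two_sets E -> \sum_v #|star E v| = #|E|.*2.
Proof.
move=> E2; rewrite -muln2 -sum_nat_const.
under eq_bigr => v _ do rewrite -sum1_card big_mkcond /=.
rewrite exchange_big /= [RHS]big_mkcond /=; apply: eq_bigr => e _.
case: ifP => eE; last by rewrite big1 // => v _; rewrite inE eE.
by rewrite -(E2 e eE) -sum1_card [RHS]big_mkcond; apply: eq_bigr => v _; rewrite inE eE.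
Qed.

(** No vertex has exactly one edge, so a path can be prolonged until it meets
    itself. *)
Lemma even_has_cycle X : two_sets X -> (forall v, ~~ odd #|star X v|) ->
  X != set0 -> exists s, ucycle (linked X) s /\ 2 < size s.
Proof.
move=> X2 ev /set0Pn[e0 e0X].
suff H n : (exists s, ucycle (linked X) s /\ 2 < size s) \/
    exists x y p, [/\ path (linked X) x (y :: p), uniq (x :: y :: p) & size p = n].
  have [//|[x [y [p [_ u sp]]]]] := H #|V|.
  by have := max_card (mem (x :: y :: p)); rewrite (card_uniqP u) /= sp => /ltnW; rewrite ltnn.
elim: n => [|n [|[x [y [p [pp u sp]]]]]]; [right | by left |].
  have /eqP/cards2P[x [y [nxy eE]]] := X2 e0 e0X.
  exists x, y, [::]; split=> //=; last by rewrite inE nxy.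
  by rewrite andbT /linked -eE.
have xy : linked X x y by case/andP: pp.
have : 1 < #|star X x|.
  have : 0 < #|star X x| by apply/card_gt0P; exists [set x; y]; rewrite !inE eqxx andbT.
  by have := ev x; case: #|_| => [|[]].
rewrite (cardsD1 [set x; y]) !inE eqxx andbT -[_ \in X]/(linked X x y) xy ltnS.
move=> /card_gt0P[e]; rewrite !inE => /and3P[ne eX xe].
have [z [xz eE lxz]] := edge_at X2 eX xe.
have zy : z != y by apply: contraNneq ne => <-; rewrite eE.
have [zp|zp] := boolP (z \in p); last first.
  right; exists z, x, (y :: p); split; last by rewrite /= sp.
    by rewrite /= linkedC lxz.
  by rewrite cons_uniq u andbT !inE !negb_or [z == x]eq_sym xz zy zp.
left; case/splitPr: zp pp u => p1 p2 pp u.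
exists (x :: y :: rcons p1 z); split; last by rewrite /= size_rcons.
move: pp u; rewrite -cat_rcons -!cat_cons cat_path cat_uniq => /andP[pp _] /and3P[u _ _].
rewrite /ucycle u andbT /= rcons_path.
by move: pp; rewrite /= => /andP[-> ->] /=; rewrite last_rcons linkedC.
Qed.

(** Every vertex of the cycle has degree at least two, so the handshake lemma
    applies. *)
Lemma cycle_leq_card X s : two_sets X -> (forall v, ~~ odd #|star X v|) ->
  ucycle (linked X) s -> size s <= #|X|.
Proof.
move=> X2 ev /andP[cs us]; rewrite -leq_double -sum_star // -muln2.
rewrite -(card_uniqP us) -sum_nat_const big_mkcond leq_sum // => v _.
case: ifP => // vs; have := next_cycle cs vs => l.
have : 0 < #|star X v|.
  by apply/card_gt0P; exists [set v; next s v]; rewrite !inE eqxx andbT.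
by have := ev v; case: #|_| => [|[]].
Qed.

Lemma card_tedges t : #|t| = 3 -> #|tedges t| = 3.
Proof.
move=> t3; rewrite (_ : tedges t = [set e : {set V} | e \subset t & #|e| == 2]).
  by rewrite cards_draws t3.
by apply/setP => e; rewrite !inE andbC.
Qed.

Lemma star_tedges t v : #|t| = 3 -> #|star (tedges t) v| = (v \in t).*2.
Proof.
move=> t3; case vt: (v \in t); last first.
  apply/eqP; rewrite cards_eq0; apply/eqP/setP => e; rewrite !inE.
  by apply/negP => /andP[/andP[_ /subsetP et] /et]; rewrite vt.
have t2 : #|t :\ v| = 2 by move: t3; rewrite (cardsD1 v) vt => -[].
rewrite -[RHS]t2 -(card_in_imset (f := fun x => [set v; x])); last first.
  move=> x y; rewrite !inE => /andP[xv _] /andP[yv _] /setP/(_ x).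
  by rewrite !inE eqxx orbT (negbTE xv) => /esym/eqP.
apply: eq_card => e; rewrite !inE; apply/idP/imsetP.
  case/andP=> /andP[/eqP e2 et] ve.
  have [|y [vy eE _]] := edge_at (E := [set e]) _ (set11 e) ve.
    by move=> f /set1P->.
  exists y; rewrite // !inE eq_sym vy (subsetP et) //.
  by rewrite eE !inE eqxx orbT.
case=> y; rewrite !inE => /andP[yv yt] ->.
by rewrite cards2 [v == y]eq_sym yv subUset !sub1set vt yt !inE eqxx.
Qed.

Lemma tedges_pair t x y : x \in t -> y \in t -> x != y -> [set x; y] \in tedges t.
Proof. by move=> xt yt xy; rewrite inE cards2 xy subUset !sub1set xt yt. Qed.

Lemma triangle_edge_uniq E t t' e : two_sets E -> girth15 E ->
  t \in triangles E -> t' \in triangles E -> e \in tedges t -> e \in tedges t' -> t = t'.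
Proof.
move=> E2 g; rewrite !inE => /andP[/eqP t3 /subsetP tE] /andP[/eqP t'3 /subsetP t'E].
case/andP=> e2 et /andP[_ et'].
have e2' := eqP e2; case/cards2P: e2 => x [y [xy eE]].
have ex (u : {set V}) : #|u| = 3 -> e \subset u -> exists2 z, z \notin e & u = z |: e.
  move=> u3 eu; have : #|u :\: e| = 1 by rewrite cardsD (setIidPr eu) u3 e2'.
  move/eqP/cards1P => [z uz].
  have : z \in u :\: e by rewrite uz inE.
  rewrite inE => /andP[ze zu]; exists z => //.
  by rewrite -uz -{1}(setID u e) setUC (setIidPr eu).
have [z ze tz] := ex t t3 et; have [z' z'e tz'] := ex t' t'3 et'.
have [zz'|nzz'] := eqVneq z z'; first by rewrite tz tz' zz'.
have xe : x \in e by rewrite eE !inE eqxx.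
have ye : y \in e by rewrite eE !inE eqxx orbT.
have zx : z != x by apply: contraNneq ze => ->.
have zy : z != y by apply: contraNneq ze => ->.
have z'x : z' != x by apply: contraNneq z'e => ->.
have z'y : z' != y by apply: contraNneq z'e => ->.
have l1 u : u \in e -> linked E z u.
  move=> ue; apply/tE/tedges_pair; rewrite ?tz ?setU11 ?setU1r //.
  by apply: contraNneq ze => ->.
have l2 u : u \in e -> linked E z' u.
  move=> ue; apply/t'E/tedges_pair; rewrite ?tz' ?setU11 ?setU1r //.
  by apply: contraNneq z'e => ->.
have := g [:: z; x; z'; y].
rewrite /ucycle /= !inE !negb_or zx zy nzz' z'y xy [x == z']eq_sym z'x l1 // l2 //.
by rewrite [linked E x z']linkedC l2 // [linked E y z]linkedC l1 // => /(_ isT isT).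
Qed.

Lemma odd_star_setD X Y v : Y \subset X -> ~~ odd #|star X v| -> ~~ odd #|star Y v| ->
  ~~ odd #|star (X :\: Y) v|.
Proof.
move=> YX.
have -> : star (X :\: Y) v = star X v :\: star Y v.
  apply/setP => e; rewrite !inE; case: (e \in Y); case: (e \in X); case: (v \in e) => //.
have sYX : star Y v \subset star X v.
  by apply/subsetP => e; rewrite !inE => /andP[/(subsetP YX)-> ->].
by rewrite cardsD (setIidPr sYX) oddB ?subset_leq_card // => /negbTE-> /negbTE->.
Qed.

(** An even set of fewer than fifteen edges decomposes into triangles: a
    cycle in it is a triangle, and removing that triangle leaves an even set. *)
Lemma small_even_set E X : two_sets E -> girth15 E -> X \subset E ->
  (forall v, ~~ odd #|star X v|) -> #|X| < 15 ->
  forall e, e \in X -> exists2 t, t \in triangles X & e \in tedges t.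
Proof.
move=> E2 g; have [n] := ubnP #|X|; elim: n X => // n IH X Xn XE ev X15 e eX.
have X2 := sub_two_sets XE E2.
have [|s [cs s2]] := even_has_cycle X2 ev; first by apply/set0Pn; exists e.
have sX := cycle_leq_card X2 ev cs.
have s3 : size s = 3.
  apply/eqP; rewrite eqn_leq s2 andbT leqNgt; apply/negP => /(sub_girth15 XE g cs).
  by move=> s15; have := leq_ltn_trans sX X15; rewrite ltnNge s15.
pose t := [set x in s].
have t3 : #|t| = 3 by rewrite cardsE (card_uniqP _) //; case/andP: cs.
have tX : tedges t \subset X.
  case: s s3 cs {sX s2} @t t3 => [|x [|y [|z []]]] //= _ /andP[/= /and4P[xy yz zx _] _] t3.
  apply/subsetP => f; rewrite inE => /andP[/cards2P[u [v [nuv ->]]]].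
  rewrite subUset !sub1set !inE => /andP[].
  case/or3P => /eqP ? /or3P[] /eqP ?; subst u v; rewrite ?eqxx // in nuv *;
    by rewrite -[_ \in X]/(linked X _ _) // linkedC.
have [et|et] := boolP (e \in tedges t).
  by exists t; rewrite // inE t3 tX.
have [|||||t' t'X et'] := IH (X :\: tedges t) _ _ _ _ e.
- rewrite -ltnS (leq_trans _ Xn) // ltnS cardsD (setIidPr tX) card_tedges //.
  by rewrite ltn_subrL /= (leq_trans _ sX) // s3.
- exact: subset_trans (subsetDl _ _) XE.
- by move=> v; apply: odd_star_setD => //; rewrite star_tedges // odd_double.
- by apply: leq_ltn_trans X15; apply/subset_leq_card/subsetDl.
- by rewrite inE et.
exists t' => //; move: t'X; rewrite !inE => /andP[-> /=] h.
exact: subset_trans h (subsetDl _ _).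
Qed.

End EdgeSets.

(** * Counting regions *)

Section Sparse.
Variables (V : finType) (E : {set {set V}}).
Hypotheses (E2 : two_sets E) (gE : girth15 E) (E0 : E != set0).
Variables (I : finType) (sd : {set V} -> I * I) (o : I).
Hypothesis euler : #|E| < #|I| + #|cover E|.
Hypothesis even : forall v phi, ~~ odd #|[set e in E | (v \in e) && separates sd phi e]|.
Hypothesis conn : forall phi : I -> bool,
  (forall e, e \in E -> ~~ separates sd phi e) -> forall i, phi i = phi o.

Definition boundary r := [set e in E | separates sd (pred1 r) e].

Lemma boundary_sub r : boundary r \subset E.
Proof. by apply/subsetP => e; rewrite inE => /andP[]. Qed.

Lemma boundary_even r v : ~~ odd #|star (boundary r) v|.
Proof.
have := even v (pred1 r); congr (~~ odd _); apply: eq_card => e.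
by rewrite !inE -andbA [X in _ && X]andbC.
Qed.

Lemma boundaryE r e : (e \in boundary r) =
  [&& e \in E, (sd e).1 != (sd e).2 & (r == (sd e).1) || (r == (sd e).2)].
Proof.
rewrite inE /separates /= ![r == _]eq_sym; congr (_ && _).
have [<-|n12] := eqVneq (sd e).1 (sd e).2; first by rewrite addbb.
have [e1|] := eqVneq (sd e).1 r; last by [].
by rewrite -e1 [_ == _]eq_sym (negbTE n12).
Qed.

Lemma sum_boundary : \sum_r #|boundary r| <= #|E|.*2.
Proof.
rewrite -muln2 -sum_nat_const.
under eq_bigr => r _ do rewrite -sum1_card big_mkcond.
rewrite exchange_big [leqRHS]big_mkcond; apply: leq_sum => e _.
rewrite -big_mkcond sum1_card; case: ifP => eE.
  apply: leq_trans (_ : #|[set (sd e).1; (sd e).2]| <= 2); last by rewrite cards2; case: eqP.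
  apply/subset_leq_card/subsetP => r er; have : e \in boundary r := er.
  by rewrite boundaryE => /and3P[_ _]; rewrite !inE.
by rewrite eq_card0 // => r; apply/negP => er; have : e \in boundary r := er; rewrite boundaryE eE.
Qed.

(** Triangles are edge-disjoint. *)
Lemma sum_triangles : 3 * #|triangles E| <= #|E|.
Proof.
rewrite mulnC -sum_nat_const.
have -> : \sum_(t in triangles E) 3 = \sum_(t in triangles E) #|tedges t|.
  by apply: eq_bigr => t; rewrite inE => /andP[/eqP/card_tedges].
under eq_bigr => t _ do rewrite -sum1_card big_mkcond.
rewrite exchange_big -[leqRHS]sum1_card [leqRHS]big_mkcond; apply: leq_sum => e _.
rewrite -big_mkcondr sum1_card; case: ifP => eE; last first.
  rewrite eq_card0 // => t; apply/negP => /andP[tE et].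
  by move: tE; rewrite inE => /andP[_ /subsetP/(_ e et)]; rewrite eE.
apply/card_le1_eqP => t t' /andP[tE et] /andP[t'E et'].
exact: triangle_edge_uniq E2 gE t'E tE et' et.
Qed.

Lemma short_boundary r e : #|boundary r| < 15 -> e \in boundary r ->
  exists2 t, t \in triangles (boundary r) & e \in tedges t.
Proof. move=> r15; exact: (small_even_set E2 gE (boundary_sub r) (boundary_even r) r15). Qed.

Lemma triangle_boundary r t : t \in triangles (boundary r) -> t \in triangles E.
Proof. by rewrite !inE => /andP[-> /subset_trans-> //]; apply: boundary_sub. Qed.

Definition rep (t : {set V}) : {set V} := odflt set0 [pick e in tedges t].

Lemma repP (t : {set V}) : #|t| = 3 -> rep t \in tedges t.
Proof.
by rewrite /rep => /card_tedges; case: pickP => //= h; rewrite eq_card0.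
Qed.

Definition short := [set r | #|boundary r| < 15].

(** An edge on the boundary of a short region lies in a triangle that bounds this
    region. Across the edges of that triangle lies either one and the same short
    region or only long ones, so gluing along any one of its edges, once the long
    regions are glued together, glues along all three. The regions being connected
    across edges, a single class remains. *)
Lemma glued_regions (J : finType) (h : I -> J) :
  (forall t, t \in triangles E -> h (sd (rep t)).1 = h (sd (rep t)).2) ->
  {in ~: short &, forall r r', h r = h r'} ->
  forall i, h i = h o.
Proof.
move=> ht hlong.
suff H e : e \in E -> h (sd e).1 = h (sd e).2.
  move=> i; have := conn (phi := fun i => h i == h o) _ i; rewrite eqxx => /(_ _)/eqP-> //.
  by move=> e /H; rewrite /separates => ->; rewrite addbb.
have key r r' f : f \in boundary r -> f \in boundary r' -> r != r' -> r \in short ->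
    h r = h r'.
  move=> fr fr' nrr'; rewrite inE => rs.
  have [t tr ft] := short_boundary rs fr.
  have tE := triangle_boundary tr.
  have t3 : #|t| = 3 by move: tE; rewrite inE => /andP[/eqP].
  have gr : rep t \in boundary r.
    by move: tr; rewrite inE => /andP[_ /subsetP]; apply; apply: repP.
  have other f' r1 r2 r3 : f' \in boundary r1 -> f' \in boundary r2 ->
      f' \in boundary r3 -> r1 != r2 -> r1 != r3 -> r2 = r3.
    rewrite !boundaryE => /and3P[_ _ /orP[]/eqP->] /and3P[_ _ /orP[]/eqP->];
      move=> /and3P[_ _ /orP[]/eqP->]; by rewrite ?eqxx.
  have [r1 [gr1 nrr1 hr1]] : exists r1, [/\ rep t \in boundary r1, r != r1 & h r = h r1].
    move: (gr) (ht t tE); rewrite boundaryE => /and3P[tgE n12 /orP[]/eqP->] e12.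
      by exists (sd (rep t)).2; rewrite boundaryE tgE n12 eqxx orbT.
    by exists (sd (rep t)).1; split; rewrite ?boundaryE ?tgE ?n12 ?eqxx // eq_sym.
  have [r's|r'l] := boolP (r' \in short).
    have [t' tr' ft'] : exists2 t', t' \in triangles (boundary r') & f \in tedges t'.
      by apply: short_boundary fr'; rewrite inE in r's.
    have tt' := triangle_edge_uniq E2 gE tE (triangle_boundary tr') ft ft'.
    rewrite -tt' in tr'.
    have gr' : rep t \in boundary r'.
      by move: tr'; rewrite inE => /andP[_ /subsetP]; apply; apply: repP.
    by rewrite (other _ _ _ _ gr gr' gr1).
  have [r1s|r1l] := boolP (r1 \in short); last first.
    by rewrite hr1; apply: hlong; rewrite inE.
  have [t' tr1 gt'] : exists2 t', t' \in triangles (boundary r1) & rep t \in tedges t'.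
    by apply: short_boundary gr1; rewrite inE in r1s.
  have tt' := triangle_edge_uniq E2 gE tE (triangle_boundary tr1) (repP t3) gt'.
  rewrite -tt' in tr1.
  have fr1 : f \in boundary r1.
    by move: tr1; rewrite inE => /andP[_ /subsetP]; apply.
  by rewrite (other _ _ _ _ fr fr' fr1).
move=> eE; have [->//|n12] := eqVneq (sd e).1 (sd e).2.
have e1 : e \in boundary (sd e).1 by rewrite boundaryE eE n12 eqxx.
have e2 : e \in boundary (sd e).2 by rewrite boundaryE eE n12 eqxx orbT.
have [s1|l1] := boolP ((sd e).1 \in short); first exact: key e1 e2 n12 s1.
have [s2|l2] := boolP ((sd e).2 \in short).
  by apply/esym/(key _ _ e) => //; rewrite eq_sym.
by apply: hlong; rewrite inE.
Qed.

(** The boundaries have total size at most [2 #|E|]. Each has at least fifteen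
    edges, except that a short one still contains a triangle, and at most
    [#|triangles E|] are short: by [glued_regions] the regions form a single
    class after that many identifications, together with one for each long
    region but the first. If all regions are short the same count bounds their
    number by [#|triangles E| + 1], and the inequality is immediate. *)
Theorem regions_sparse : 13 * #|E| < 15 * #|cover E| + 12 * #|triangles E|.
Proof.
have n0 : 0 < #|cover E|.
  have /set0Pn[e eE] := E0; have e2 : #|e| = 2 by apply: E2.
  have : #|e| <= #|cover E| by apply/subset_leq_card; apply: (bigcup_max e).
  by rewrite e2; apply: ltnW.
have T3 := sum_triangles.
have [I1|I2] := leqP #|I| 1; first by lia.
have bd_gt0 r : 0 < #|boundary r|.
  rewrite lt0n cards_eq0; apply/negP => /eqP b0.
  have c i : (i == r) = (o == r).
    apply: (conn (phi := pred1 r)) => e eE.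
    have : e \notin boundary r by rewrite b0 inE.
    by rewrite inE eE.
  suff : #|I| <= 1 by rewrite leqNgt I2.
  have all_r i : i = r by apply/eqP; rewrite c -(c r).
  by apply/fintype_le1P => i j; rewrite (all_r i) (all_r j).
have bd r : 15 <= #|boundary r| + 12 * (r \in short).
  rewrite inE; case: (leqP 15 #|boundary r|) => b15; first by rewrite addn0.
  have /card_gt0P[e er] := bd_gt0 r.
  have [t tr et] := short_boundary b15 er.
  move: tr; rewrite inE => /andP[/eqP/card_tedges t3 /subset_leq_card].
  by rewrite t3 muln1 -[15]/(3 + 12) leq_add2r.
have bdsum : 15 * #|I| <= #|E|.*2 + 12 * #|short|.
  have : \sum_(r : I) 15 <= \sum_(r : I) (#|boundary r| + 12 * (r \in short)).
    by apply: leq_sum => r _; apply: bd.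
  rewrite sum_nat_const mulnC big_split /= -big_distrr /= => le.
  apply: leq_trans le _; rewrite leq_add ?sum_boundary // leq_mul2l /=.
  by rewrite -sum1_card [leqRHS]big_mkcond /=; apply: leq_sum => r _; case: (_ \in _).
pose W0 := [seq sd (rep t) | t <- enum (triangles E)].
have sW0 : size W0 = #|triangles E| by rewrite size_map -cardE.
have W0P (J : finType) (h : I -> J) : (forall p, p \in W0 -> h p.1 = h p.2) ->
    forall t, t \in triangles E -> h (sd (rep t)).1 = h (sd (rep t)).2.
  by move=> hW t tE; apply: hW; apply/map_f; rewrite mem_enum.
have one (J : finType) (h : I -> J) : (forall j, exists i, h i = j) ->
    (forall i, h i = h o) -> #|J| <= 1.
  move=> hs hc; apply/fintype_le1P => j j'.
  by have [i <-] := hs j; have [i' <-] := hs j'; rewrite !hc.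
have [allshort|/subsetPn[r0 _ r0l]] := boolP ([set: I] \subset short).
  have [J [h [hs hW cI]]] := identify_pairs W0.
  have hl : {in ~: short &, forall r r', h r = h r'}.
    by move=> r r'; rewrite in_setC (subsetP allshort).
  have := one J h hs (glued_regions (W0P J h hW) hl).
  by move: cI; rewrite sW0; lia.
have [J [h [hs hW cI]]] := identify_pairs (W0 ++ [seq (r0, r) | r <- enum (~: short :\ r0)]).
have hl : {in ~: short &, forall r r', h r = h r'}.
  have h0 r : r \in ~: short -> h r = h r0.
    move=> rl; have [->//|rr0] := eqVneq r r0.
    apply/esym/(hW (r0, r)); rewrite mem_cat map_f ?orbT //.
    by rewrite mem_enum in_setD1 rr0.
  by move=> r r' /h0-> /h0->.
have hW' p : p \in W0 -> h p.1 = h p.2.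
  by move=> pW; apply: hW; rewrite mem_cat pW.
have := one J h hs (glued_regions (W0P J h hW') hl).
have := cardsD1 r0 (~: short); rewrite in_setC r0l /=.
move: cI; rewrite size_cat size_map -cardE sW0.
move: bdsum euler T3 n0 (cardsC short); clear.
by move: #|I| #|J| #|E| #|short| #|_ :\ _| #|~: _| #|triangles _| #|cover _|; lia.
Qed.

End Sparse.

(** * Sparsity of planar graphs without cycles of length 4 to 14 *)

Lemma edgesP (G : sgraph) (e : {set G}) :
  reflect (exists x y, adj x y /\ e = [set x; y]%SET) (e \in edges G).
Proof.
apply: (iffP imsetP) => [[[x y]]|[x [y [xy ->]]]]; last by exists (x, y); rewrite ?inE.
by rewrite inE => xy ->; exists x, y.
Qed.

Lemma edges_two_sets (G : sgraph) : two_sets (edges G).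
Proof.
move=> e /edgesP[x [y [xy ->]]]; rewrite cards2.
by have -> : x != y by apply: contraTneq xy => ->; rewrite adj_irrefl.
Qed.

(** For a forest with [m] edges and [n] vertices this only says [13 m < 15 n];
    in general it is the bound of Euler type for faces of length at least
    fifteen, corrected by the triangular faces. *)
Theorem planar_sparse (R : realType) (G : sgraph) (E : {set {set G}}) :
  planar R G -> E \subset edges G -> E != set0 -> girth15 E ->
  13 * #|E| < 15 * #|cover E| + 12 * #|triangles E|.
Proof.
move=> [pos [arc dr]] subE E0 gE.
have E2 := sub_two_sets subE (@edges_two_sets G).
have /set0Pn[e0 e0E] := E0.
have [x0 _] : exists x, x \in e0 by apply/card_gt0P; rewrite E2.
have H e : exists d : G * G * seq (R * R), e \in E ->
    [/\ e = [set d.1.1; d.1.2]%SET, d.1.1 != d.1.2,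
        simple_polyline (pos d.1.1) d.2, last (pos d.1.1) d.2 = pos d.1.2
      & forall He : e \in edges G, arc (exist _ e He) = polyline (pos d.1.1) d.2].
  have [eE|] := boolP (e \in E); last by exists (x0, x0, [::]).
  have He := subsetP subE _ eE.
  have /edgesP[x [y [xy exy]]] := He.
  case: dr => _ /(_ (exist _ e He) x y exy)[s [s1 s2 s3]] _ _.
  exists (x, y, s) => _; split=> //=.
    by apply: contraTneq xy => ->; rewrite adj_irrefl.
  by move=> He'; rewrite (bool_irrelevance He' He).
have [d dP] := choice H.
have [|||||I [sd [o [cI par con]]]] := @drawing_regions R G E subE pos arc dr
  (fun e => (d e).1.1) (fun e => (d e).1.2) (fun e => (d e).2).
- by move=> e /dP[].
- by move=> e /dP[].
- by move=> e /dP[].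
- by move=> e /dP[].
- by move=> [e He] eE; have [_ _ _ _] := dP e eE; apply.
exact: regions_sparse cI par con.
Qed.

(** * Colour conflicts across a bow tie *)

Section Conflicts.
Variables (T : Type) (R : T -> T -> rel 'I_4).
Hypothesis Rsym : forall x y a b, R x y a b = R y x b a.
Hypothesis Rfun : forall x y a b b', R x y a b -> R x y a b' -> b = b'.
Implicit Types (x y : T) (a b c d e f s : 'I_4) (L : {set 'I_4}).

Lemma Rinj x y a a' b : R x y a b -> R x y a' b -> a = a'.
Proof. by rewrite ![R x y _ b]Rsym; apply: Rfun. Qed.

Definition free x (ps : seq (T * 'I_4)) a := all (fun p => ~~ R x p.1 a p.2) ps.

Lemma card_free x L ps : #|L| <= #|[set a in L | free x ps a]| + size ps.
Proof.
elim: ps => [|[y b] ps IH] /=.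
  by rewrite addn0 subset_leq_card //; apply/subsetP => a; rewrite inE andbT.
apply: leq_trans IH _; rewrite addnS -addSn leq_add2r.
have [a0 Ra0|noR] := pickP (fun a => R x y a b); last first.
  by apply/leqW/subset_leq_card/subsetP => a; rewrite !inE /= noR.
rewrite (cardsD1 a0) -[leqRHS]add1n leq_add ?leq_b1 //.
apply/subset_leq_card/subsetP => a; rewrite !inE => /and3P[na -> ->].
by rewrite !andbT; apply: contra na => Ra; apply/eqP/(Rinj Ra Ra0).
Qed.

(** Greedy choice: each coloured neighbour excludes at most one colour. *)
Lemma pick_free x L ps : size ps < #|L| -> exists2 a, a \in L & free x ps a.
Proof.
move=> lt; have : 0 < #|[set a in L | free x ps a]|.
  by rewrite -(ltn_add2r (size ps)) (leq_trans lt) // card_free.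
by case/card_gt0P => a; rewrite inE => /andP[]; exists a.
Qed.

Lemma pick_free_neq x L ps a0 : (size ps).+1 < #|L| ->
  exists a, [/\ a \in L, free x ps a & a != a0].
Proof.
move=> lt; have [|a] := @pick_free x (L :\ a0) ps.
  by have := cardsD1 a0 L; move: lt; case: (_ \in _) => /= lt E; rewrite E in lt; [|exact: ltnW].
by rewrite in_setD1 => /andP[na aL] fa; exists a.
Qed.

Section Half.
Variables (A B C D F : T) (LD LF : {set 'I_4}).
Hypotheses (LD2 : 1 < #|LD|) (LF2 : 1 < #|LF|).

(** The names of the edges: [A] and [C] join the centre of the bow tie to the
    near ear and to the near end, [B] and [D] join it to the far ear and to
    the far end, and [F] joins the far ear to the far end. Only [D] and [F] see
    coloured edges beyond the far end, which leave them the lists [LD] and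
    [LF]. The set [reach c] consists of the colours of [A] that, together with
    [c] on [C], can be extended to the far half. *)
Definition half_ok c a b d f :=
  [&& d \in LD, f \in LF, free D [:: (C, c)] d, free F [:: (D, d)] f,
      free B [:: (C, c); (D, d); (F, f)] b & free A [:: (C, c); (D, d); (B, b)] a].

Definition reach c := [set a | [exists b, exists d, exists f, half_ok c a b d f]].

Lemma reachP c a :
  reflect (exists b d f, half_ok c a b d f) (a \in reach c).
Proof.
rewrite inE; apply: (iffP existsP) => [[b /existsP[d /existsP[f H]]]|[b [d [f H]]]].
  by exists b, d, f.
by exists b; apply/existsP; exists d; apply/existsP; exists f.
Qed.

Lemma reach_neq0 c : exists a, a \in reach c.
Proof.
have [d dL fd] := @pick_free D LD [:: (C, c)] LD2.
have [f fL ff] := @pick_free F LF [:: (D, d)] LF2.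
have [|b _ fb] := @pick_free B setT [:: (C, c); (D, d); (F, f)].
  by rewrite cardsT card_ord.
have [|a _ fa] := @pick_free A setT [:: (C, c); (D, d); (B, b)].
  by rewrite cardsT card_ord.
by exists a; apply/reachP; exists b, d, f; rewrite /half_ok dL fL fd ff fb.
Qed.

(** If [a0] is the only colour in [reach c], then the colours chosen for [C], [D]
    and [B] exclude the three other colours of [A], one each. Comparing the
    choices [d] and [d'] on [D], the colour that [d'] excludes must be the one
    that [b] excludes. *)
Lemma reach_single c d d' f f' b : #|reach c| <= 1 -> d != d' ->
  d \in LD -> d' \in LD -> f \in LF -> f' \in LF ->
  ~~ R C D c d -> ~~ R C D c d' -> ~~ R F D f d -> ~~ R F D f' d' ->
  free B [:: (C, c); (D, d); (F, f)] b ->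
  exists2 a, R A D a d' & R A B a b.
Proof.
move=> r1 nd dL d'L fL f'L cd cd' fd fd' fb.
have [a0 a0r] := reach_neq0 c.
have uni a : a \in reach c -> a = a0 by move=> ar; apply: (card_le1_eqP r1).
have kill1 a : a != a0 -> [|| R A C a c, R A D a d | R A B a b].
  apply: contraNT; rewrite !negb_or => /and3P[n1 n2 n3]; apply/eqP/uni/reachP.
  by exists b, d, f; rewrite /half_ok fb dL fL /= n1 n2 n3 [R D C _ _]Rsym cd fd.
have [|b' _ fb'] := @pick_free B setT [:: (C, c); (D, d'); (F, f')].
  by rewrite cardsT card_ord.
have [|a [_ /= /and3P[ac ab' _] aa0]] := @pick_free_neq A setT [:: (C, c); (B, b')] a0.
  by rewrite cardsT card_ord.
have ad' : R A D a d'.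
  apply: contraNT aa0 => n; apply/eqP/uni/reachP.
  by exists b', d', f'; rewrite /half_ok fb' d'L f'L /= ac ab' n [R D C _ _]Rsym cd' fd'.
exists a => //; case/or3P: (kill1 a aa0) => // h; first by rewrite h in ac.
by case/eqP: nd; apply: Rfun h ad'.
Qed.

(** The decisive gain. Take two colours [d], [d'] for [D] and two colours [c],
    [c'] of [C] that conflict with neither. If each of [c] and [c'] left one
    colour for [A], then by [reach_single] the colour of [B] would be
    determined by [d], [d'] and the colour of [F] alone; a second colour of
    [B] compatible with those of [D] and [F] would conflict with both [c] and
    [c'], although it excludes only one colour of [C]. *)
Lemma reach_two : exists c, 1 < #|reach c|.
Proof.
have [/existsP[c]|] := boolP [exists c, 1 < #|reach c|]; first by exists c.
rewrite negb_exists => /forallP small.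
have r1 c : #|reach c| <= 1 by rewrite leqNgt small.
have /card_gt1P[d [d' [dL d'L nd]]] := LD2.
have [f fL /andP[fd _]] := @pick_free F LF [:: (D, d)] LF2.
have [f' f'L /andP[f'd' _]] := @pick_free F LF [:: (D, d')] LF2.
have [|c _ /and3P[cd cd' _]] := @pick_free C setT [:: (D, d); (D, d')].
  by rewrite cardsT card_ord.
have [|c' [_ /and3P[c'd c'd' _] nc]] := @pick_free_neq C setT [:: (D, d); (D, d')] c.
  by rewrite cardsT card_ord.
have [|b _ fb] := @pick_free B setT [:: (C, c); (D, d); (F, f)].
  by rewrite cardsT card_ord.
have [|b0 [_ fb0 nb0]] := @pick_free_neq B setT [:: (D, d); (F, f)] b.
  by rewrite cardsT card_ord.
have [a ad' ab] := reach_single (r1 c) nd dL d'L fL f'L cd cd' fd f'd' fb.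
have only c1 b1 : ~~ R C D c1 d -> ~~ R C D c1 d' ->
    free B [:: (C, c1); (D, d); (F, f)] b1 -> b1 = b.
  move=> h h' fb1.
  have [a1 a1d' a1b1] := reach_single (r1 c1) nd dL d'L fL f'L h h' fd f'd' fb1.
  by rewrite (Rinj a1d' ad') in a1b1; apply: Rfun a1b1 ab.
have kb c1 : ~~ R C D c1 d -> ~~ R C D c1 d' -> R B C b0 c1.
  move=> h h'; apply: contraNT nb0 => n; apply/eqP/(only c1) => //.
  by move: fb0; rewrite /free /= n.
by case/eqP: nc; apply: Rfun (kb c' c'd c'd') (kb c cd cd').
Qed.

Section Bowtie.
Variables (E U W : T).

(** Now [E] joins the near ear to the near end, and [U], [W] are the other two
    edges at the near end, coloured [s] and [t]. *)
Definition bowtie_ok s t c e a :=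
  [&& free C [:: (U, s); (W, t)] c, free E [:: (U, s); (W, t); (C, c)] e,
      ~~ R A E a e & a \in reach c].
Definition bad s t := ~~ [exists c, exists e, exists a, bowtie_ok s t c e a].

Lemma badP s t c e a : bad s t -> free C [:: (U, s); (W, t)] c ->
  free E [:: (U, s); (W, t); (C, c)] e -> a \in reach c -> R A E a e.
Proof.
move=> bd fc fe ar; apply: contraNT bd => n.
apply/existsP; exists c; apply/existsP; exists e; apply/existsP; exists a.
by rewrite /bowtie_ok fc fe n.
Qed.

Lemma not_bad s t : ~~ bad s t -> exists c e a, bowtie_ok s t c e a.
Proof. by rewrite negbK => /existsP[c /existsP[e /existsP[a]]]; exists c, e, a. Qed.

Definition list_at x s t := [set c | free x [:: (U, s); (W, t)] c].

Lemma card_list_at x s t : 1 < #|list_at x s t|.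
Proof.
have := card_free x setT [:: (U, s); (W, t)]; rewrite cardsT card_ord /= -[4]/(2 + 2) leq_add2r.
by move/leq_trans; apply; apply/subset_leq_card/subsetP => c; rewrite !inE.
Qed.

(** In a bad state the two colours left for [C] and the two left for [E]
    conflict crosswise, so one colour of [C] determines the other. *)
Lemma bad_list s t c a : bad s t -> c \in list_at C s t -> a \in reach c ->
  exists e c', [/\ R A E a e, R E C e c', c' != c & list_at C s t = [set c; c']].
Proof.
move=> bd cL ar; have fc : free C [:: (U, s); (W, t)] c by rewrite inE in cL.
have [a' [e1 [e2 [e1L e2L ne]]]] : exists (_ : 'I_4) e1 e2,
    [/\ e1 \in list_at E s t, e2 \in list_at E s t & e1 != e2].
  by exists a; apply/card_gt1P/card_list_at.
have uniq_ok c1 e e' : c1 \in list_at C s t ->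
    e \in list_at E s t -> e' \in list_at E s t ->
    ~~ R E C e c1 -> ~~ R E C e' c1 -> e = e'.
  rewrite !inE => f1 fe fe' n n'; have [a1 a1r] := reach_neq0 c1.
  have h e0 : free E [:: (U, s); (W, t)] e0 -> ~~ R E C e0 c1 -> R A E a1 e0.
    move=> /and3P[? ? _] ?; apply: (badP bd f1 _ a1r).
    by rewrite /free /=; apply/and4P.
  exact: Rfun (h e fe n) (h e' fe' n').
wlog [k1 k2] : e1 e2 e1L e2L ne / R E C e1 c /\ ~~ R E C e2 c.
  move=> H; case k1: (R E C e1 c); case k2: (R E C e2 c).
  - by case/eqP: ne; apply: Rinj k1 k2.
  - by apply: (H e1 e2) => //; rewrite k1 k2.
  - by apply: (H e2 e1); rewrite 1?eq_sym // k1 k2.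
  - by case/eqP: ne; apply: (uniq_ok c); rewrite ?k1 ?k2.
have ae2 : R A E a e2.
  apply: (badP bd fc _ ar); move: e2L; rewrite inE => /and3P[? ? _].
  by rewrite /free /=; apply/and4P.
have match2 c1 : c1 \in list_at C s t -> c1 != c -> R E C e2 c1.
  move=> c1L nc; apply/negPn/negP => n; case/eqP: ne.
  apply: (uniq_ok c1) => //; apply/negP => k; case/eqP: nc.
  exact: Rfun k k1.
have [c' c'L nc'] : exists2 c', c' \in list_at C s t & c' != c.
  have := card_list_at C s t; rewrite (cardsD1 c) cL => /card_gt0P[c'].
  by rewrite in_setD1 => /andP[? ?]; exists c'.
exists e2, c'; split=> //; first exact: match2.
apply/setP => c1; rewrite [RHS]inE !in_set1; apply/idP/orP => [c1L|[]/eqP-> //].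
have [->|nc1] := eqVneq c1 c; first by left.
by right; apply/eqP/(Rfun (match2 c1 c1L nc1)); apply: match2.
Qed.

(** The list of a bad state avoids the colour provided by [reach_two], so two
    such lists, having two elements each, share a colour. By [bad_list] a
    common colour determines the whole list. *)
Lemma bad_list_uniq s t s' t' : bad s t -> bad s' t' ->
  list_at C s t = list_at C s' t'.
Proof.
move=> bd bd'; have [c0 c02] := reach_two.
have c0L s1 t1 : bad s1 t1 -> c0 \notin list_at C s1 t1.
  move=> b1; apply/negP => c0l; have /card_gt1P[a [a' [ar a'r na]]] := c02.
  have fc : free C [:: (U, s1); (W, t1)] c0 by rewrite inE in c0l.
  have [|e _ fe] := @pick_free E setT [:: (U, s1); (W, t1); (C, c0)].
    by rewrite cardsT card_ord.
  by case/eqP: na; apply: Rinj (badP b1 fc fe ar) (badP b1 fc fe a'r).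
have [c /andP[cL cL']] : exists c, (c \in list_at C s t) && (c \in list_at C s' t').
  suff /card_gt0P[c] : 0 < #|list_at C s t :&: list_at C s' t'|.
    by rewrite inE; exists c.
  have sub : list_at C s t :|: list_at C s' t' \subset [set~ c0].
    apply/subsetP => c; rewrite in_setU in_setC1.
    by case/orP; apply: contraTneq => ->; apply: c0L.
  have := subset_leq_card sub; rewrite cardsC1 card_ord /= => u3.
  have := leq_add (card_list_at C s t) (card_list_at C s' t').
  by rewrite -cardsUI => /leq_trans/(_ (leq_add u3 (leqnn _))); rewrite -[2 + 2]/(3 + 1) leq_add2l.
have [a ar] := reach_neq0 c.
have [e [c1 [ae ec1 _ ->]]] := bad_list bd cL ar.
have [e' [c1' [ae' ec1' _ ->]]] := bad_list bd' cL' ar.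
by rewrite (Rfun ae' ae) in ec1'; rewrite (Rfun ec1' ec1).
Qed.

Lemma killed_at c s t : c \notin list_at C s t = R C U c s || R C W c t.
Proof. by rewrite inE /free /= andbT -negb_or negbK. Qed.

Lemma card_killed s t : bad s t -> #|~: list_at C s t| = 2.
Proof.
move=> bd; have /card_gt1P[c [_ [cL _ _]]] := card_list_at C s t.
have [a ar] := reach_neq0 c.
have [e [c' [_ _ nc E1]]] := bad_list bd cL ar.
by rewrite cardsCs setCK card_ord E1 cards2 eq_sym nc.
Qed.

(** In a bad state the colours of [U] and [W] exclude exactly the two colours
    outside the common list; given that of [W], the colour of [U] must exclude
    the remaining one. *)
Lemma bad_uniq s s' t : bad s t -> bad s' t -> s = s'.
Proof.
move=> bd bd'; have k2 := card_killed bd; have e := bad_list_uniq bd bd'.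
have [|c cL /andP[ct _]] := @pick_free C (~: list_at C s t) [:: (W, t)].
  by rewrite k2.
have cL' : c \in ~: list_at C s' t by rewrite -e.
move: cL cL'; rewrite !in_setC !killed_at (negbTE ct) !orbF.
exact: Rfun.
Qed.

(** The colour of [W] must exclude one of the two colours outside the common
    list. *)
Lemma card_bad : #|[set t | [exists s, bad s t]]| <= 2.
Proof.
set X := [set t | _]; have [->|[t0]] := set_0Vmem X; first by rewrite cards0.
rewrite inE => /existsP[s0 bd0].
pose h t := odflt ord0 [pick c in ~: list_at C s0 t0 | R C W c t].
have hP t : t \in X -> (h t \in ~: list_at C s0 t0) && R C W (h t) t.
  rewrite inE => /existsP[s bd]; rewrite /h; case: pickP => // nk.
  have k2 := card_killed bd0; have E0 := bad_list_uniq bd bd0.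
  have [|c cL /andP[cs _]] := @pick_free C (~: list_at C s0 t0) [:: (U, s)].
    by rewrite k2.
  have := nk c; rewrite cL /= => nR; move: cL.
  by rewrite -E0 in_setC killed_at (negbTE cs) nR.
rewrite -[leqRHS](card_killed bd0) -(card_in_imset (f := h) (D := X)).
  by apply/subset_leq_card/subsetP => c /imsetP[t /hP/andP[? _] ->].
by move=> t t' /hP/andP[_ k] /hP/andP[_ k'] e; rewrite e in k; apply: Rfun k k'.
Qed.

End Bowtie.
End Half.
End Conflicts.

(** * Minimal uncolourable sets of edges *)

Section Colourings.
Variable V : finType.
Variable R : {set V} -> {set V} -> rel 'I_4.
Hypothesis Rsym : forall x y a b, R x y a b = R y x b a.
Hypothesis Rfun : forall x y a b b', R x y a b -> R x y a b' -> b = b'.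
Implicit Types (A E S : {set {set V}}) (e f g : {set V}) (col : {set V} -> 'I_4).
Implicit Types (k l : 'I_4) (u v w x y z p q : V).

Definition meets e f := (e != f) && (e :&: f != set0).

Lemma meetsC e f : meets e f = meets f e.
Proof. by rewrite /meets eq_sym setIC. Qed.

Lemma meetsP e f : reflect (e != f /\ exists2 v, v \in e & v \in f) (meets e f).
Proof.
apply: (iffP andP) => [[ne /set0Pn[v]]|[ne [v ve vf]]].
  by rewrite inE => /andP[ve vf]; split=> //; exists v.
by split=> //; apply/set0Pn; exists v; rewrite inE ve.
Qed.

Lemma meets_pair u v x y :
  meets [set u; v] [set x; y] -> [|| u == x, u == y, v == x | v == y].
Proof.
case/meetsP=> _ [z]; rewrite !inE => /orP[]/eqP-> /orP[]->; by rewrite ?orbT.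
Qed.

Definition proper A col :=
  forall e f, e \in A -> f \in A -> meets e f -> ~~ R e f (col e) (col f).

Definition colourable A := exists col, proper A col.

Definition ok A col e k := [forall f in A, meets e f ==> ~~ R e f k (col f)].

Lemma okP A col e k :
  reflect (forall f, f \in A -> meets e f -> ~~ R e f k (col f)) (ok A col e k).
Proof.
apply: (iffP forall_inP) => [h f fA ef|h f fA]; first exact: (implyP (h f fA)).
by apply/implyP; apply: h.
Qed.

Definition recolour col e k := fun f => if f == e then k else col f.

Lemma proper_add A col e k : proper A col -> ok A col e k ->
  proper (e |: A) (recolour col e k).
Proof.
move=> pA /okP oe f g; rewrite !in_setU1 /recolour.
have [->|nf] := eqVneq f e; have [->|ng] := eqVneq g e => //=.
- by rewrite /meets eqxx.
- by move=> _; apply: oe.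
- by move=> fA _; rewrite meetsC Rsym; apply: oe.
- exact: pA.
Qed.

Lemma ok_add A col e f k l : ok A col e k -> ~~ (meets e f && R e f k l) ->
  ok (f |: A) (recolour col f l) e k.
Proof.
move=> /okP oe n; apply/okP => g; rewrite in_setU1 /recolour.
have [->|ng] /= := eqVneq g f; last exact: oe.
by move=> _ m; move: n; rewrite m.
Qed.

Definition assign (s : seq ({set V} * 'I_4)) col :=
  foldr (fun (a : {set V} * 'I_4) c => recolour c a.1 a.2) col s.

(** Assigning colours to a sequence of edges at once keeps the colouring proper
    when each colour is compatible with the old ones and with the others. *)
Definition compatible (a b : {set V} * 'I_4) := ~~ (meets a.1 b.1 && R a.1 b.1 a.2 b.2).

Lemma proper_assign A col s : proper A col ->
  all (fun a : {set V} * 'I_4 => ok A col a.1 a.2) s -> pairwise compatible s ->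
  proper ([set e in unzip1 s] :|: A) (assign s col).
Proof.
move=> pA; suff H : all (fun a : {set V} * 'I_4 => ok A col a.1 a.2) s -> pairwise compatible s ->
    proper ([set e in unzip1 s] :|: A) (assign s col) /\
    forall e k, ok A col e k -> all (compatible (e, k)) s ->
      ok ([set e in unzip1 s] :|: A) (assign s col) e k.
  by move=> a b; case: (H a b).
elim: s => [|[f l] s IH] /=.
  have -> : [set e in [::]] :|: A = A by apply/setP => e; rewrite !inE.
  by split.
case/andP=> ofl os /andP[cf cs]; have [ps oks] := IH os cs.
have -> : [set e in f :: unzip1 s] :|: A = f |: ([set e in unzip1 s] :|: A).
  by apply/setP => e; rewrite !inE orbA.
split; first by apply: proper_add => //; apply: oks.
by move=> e k oe /andP[ce ces]; apply: ok_add => //; apply: oks.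
Qed.

Lemma assign_notin s col e : e \notin unzip1 s -> assign s col e = col e.
Proof.
elim: s => //= -[f l] s IH; rewrite inE negb_or => /andP[ne /IH <-].
by rewrite /recolour (negbTE ne).
Qed.

Definition avail A col e := [set k | ok A col e k].

Lemma card_avail A col e n : #|[set f in A | meets e f]| <= n ->
  4 - n <= #|avail A col e|.
Proof.
move=> le; pose ps := [seq (f, col f) | f <- enum [set f in A | meets e f]].
have sp : size ps = #|[set f in A | meets e f]| by rewrite size_map -cardE.
have := card_free Rsym Rfun e setT ps; rewrite cardsT card_ord sp => c4.
rewrite leq_subLR; apply: leq_trans c4 _; rewrite addnC leq_add //.
apply/subset_leq_card/subsetP => k; rewrite !inE /free /ps all_map => /allP h.
by apply/okP => f fA m; apply: h; rewrite mem_enum inE fA.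
Qed.

Lemma meets_star A u v n : [set u; v] \in A ->
  #|star A u| + #|star A v| <= n.+2 ->
  #|[set f in A :\ [set u; v] | meets [set u; v] f]| <= n.
Proof.
move=> eA le; set e := [set u; v].
have ue : u \in e by rewrite !inE eqxx.
have ve : v \in e by rewrite !inE eqxx orbT.
have su : #|star A u| = #|star A u :\ e|.+1 by rewrite (cardsD1 e) !inE eA eqxx.
have sv : #|star A v| = #|star A v :\ e|.+1 by rewrite (cardsD1 e) !inE eA eqxx orbT.
have sub : [set f in A :\ e | meets e f] \subset (star A u :\ e) :|: (star A v :\ e).
  apply/subsetP => f; rewrite !inE => /andP[/andP[nf fA] /meetsP[_ [z]]].
  by rewrite !inE nf fA => /orP[]/eqP->->; rewrite ?orbT.
apply: leq_trans (subset_leq_card sub) _.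
apply: leq_trans (leq_card_setU _ _) _.
by rewrite su sv addSn addnS !ltnS in le.
Qed.

Lemma colourable_sub A E : A \subset E -> colourable E -> colourable A.
Proof. by move=> /subsetP AE [col pE]; exists col => e f /AE eE /AE fE; apply: pE. Qed.

Section Critical.
Variable S : {set {set V}}.
Hypotheses (S2 : two_sets S) (gS : girth15 S).
Hypothesis notcol : ~ colourable S.
Hypothesis minimal : forall e, e \in S -> colourable (S :\ e).
Hypothesis deg4 : forall v, #|star S v| <= 4.

Notation deg v := #|star S v|.

Lemma smaller_colourable A e : e \in S -> e \in A -> colourable (S :\: A).
Proof.
move=> eS eA; apply: colourable_sub (minimal eS).
by apply/subsetP => f; rewrite !inE => /andP[nA ->]; rewrite andbT; apply: contraNneq nA => ->.
Qed.

(** Otherwise the edge has at most three neighbours, and a colouring of the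
    remaining edges extends to it. *)
Lemma deg_sum u v : linked S u v -> 6 <= deg u + deg v.
Proof.
move=> uv; rewrite leqNgt; apply/negP => lt; apply: notcol.
have [col pc] := minimal uv.
have le3 : #|[set f in S :\ [set u; v] | meets [set u; v] f]| <= 3.
  by apply: meets_star => //.
have : 0 < #|avail (S :\ [set u; v]) col [set u; v]|.
  by apply: leq_trans (card_avail _ le3).
case/card_gt0P=> k; rewrite inE => okk; have := proper_add pc okk.
by rewrite setD1K // => p; eexists; exact: p.
Qed.

Lemma no_four_cycle (a b c d : V) : linked S a b -> linked S b c -> linked S c d ->
  linked S d a -> a != c -> b != d -> False.
Proof.
move=> ab bc cd da ac bd.
have := gS (s := [:: a; b; c; d]); rewrite /ucycle /= ab bc cd da !inE !negb_or.
rewrite ac bd (linked_neq S2 ab) (linked_neq S2 bc) (linked_neq S2 cd).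
by rewrite eq_sym (linked_neq S2 da) => /(_ isT isT).
Qed.

Lemma no_five_cycle (a b c d e : V) : linked S a b -> linked S b c -> linked S c d ->
  linked S d e -> linked S e a -> a != c -> a != d -> b != d -> b != e -> c != e -> False.
Proof.
move=> ab bc cd de ea ac ad bd be ce.
have := gS (s := [:: a; b; c; d; e]); rewrite /ucycle /= ab bc cd de ea !inE !negb_or.
rewrite ac ad bd be ce (linked_neq S2 ab) (linked_neq S2 bc) (linked_neq S2 cd) (linked_neq S2 de).
by rewrite [a == e]eq_sym (linked_neq S2 ea) => /(_ isT isT).
Qed.

(** Two triangles [w x y] and [q x p], where [w] and [q] have degree two. The
    stars are recorded rather than the degrees, because they list the edges
    that have to be recoloured. *)
Definition bowtie y w x q p :=
  [/\ uniq [:: y; w; x; q; p],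
      star S x = [set [set x; y]; [set x; w]; [set x; q]; [set x; p]],
      star S w = [set [set w; x]; [set w; y]]
    & star S q = [set [set q; x]; [set q; p]]].

Definition bowtie_edges y w x q p := 
  [set [set x; y]; [set x; w]; [set x; q]; [set x; p]; [set w; y]; [set q; p]].

Lemma bowtieC y w x q p : bowtie y w x q p -> bowtie p q x w y.
Proof.
case=> u sx sw sq; split=> //; first by rewrite -(rev_uniq [:: p; q; x; w; y]).
rewrite sx; apply/setP => e; rewrite !inE.
by do 4!case: (e == _).
Qed.

Lemma star_linked x y : linked S x y = ([set x; y] \in star S x).
Proof. by rewrite !inE eqxx andbT. Qed.

Lemma bowtie_linked y w x q p : bowtie y w x q p ->
  [/\ linked S x y, linked S x w, linked S w y & linked S x q /\ linked S x p /\ linked S q p].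
Proof.
by case=> _ sx sw sq; rewrite !star_linked sx sw sq !inE !eqxx ?orbT.
Qed.

Lemma pair_eq u v x : u != v -> [set u; v] = [set u; x] -> v = x.
Proof.
move=> nuv /setP/(_ v); rewrite !inE eqxx orbT => /esym/orP[]/eqP // vu.
by rewrite vu eqxx in nuv.
Qed.

Lemma bowtie_nbr y w x q p z : bowtie y w x q p -> linked S x z -> z \in [:: y; w; q; p].
Proof.
case=> _ sx _ _ xz; have nxz := linked_neq S2 xz.
move: xz; rewrite star_linked sx !inE -!orbA.
by case/or4P => /eqP/(pair_eq nxz)->; rewrite eqxx ?orbT.
Qed.

Lemma bowtie_nbr_w y w x q p z : bowtie y w x q p -> linked S w z -> z \in [:: x; y].
Proof.
case=> _ _ sw _ xz; have nxz := linked_neq S2 xz.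
move: xz; rewrite star_linked sw !inE.
by case/orP => /eqP/(pair_eq nxz)->; rewrite eqxx ?orbT.
Qed.

Lemma bowtie_nbr_q y w x q p z : bowtie y w x q p -> linked S q z -> z \in [:: x; p].
Proof. by move/bowtieC/bowtie_nbr_w; apply. Qed.

Lemma bowtie_deg y w x q p : bowtie y w x q p -> deg w = 2 /\ deg q = 2.
Proof.
case=> u sx sw sq; rewrite sw sq !cards2.
move: u; rewrite /= !inE !negb_or => /and5P[/and4P[yw yx yq yp] /and3P[wx wq wp] /andP[xq xp] qp _].
split; apply/eqP; rewrite eqSS eqb1; apply/eqP.
  by move/pair_eq=> /(_ wx) xy; rewrite xy eqxx in yx.
by rewrite eq_sym in xq; move/pair_eq=> /(_ xq) xp'; rewrite xp' eqxx in xp.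
Qed.

Lemma mem_bowtie_edges y w x q p e : bowtie y w x q p -> e \in S ->
  (e \in bowtie_edges y w x q p) = [|| x \in e, w \in e | q \in e].
Proof.
case=> u sx sw sq eS.
have cx : (x \in e) = (e \in star S x) by rewrite !inE eS.
have cw : (w \in e) = (e \in star S w) by rewrite !inE eS.
have cq : (q \in e) = (e \in star S q) by rewrite !inE eS.
rewrite cx cw cq sx sw sq !inE [ [set w; x] ]setUC [ [set q; x] ]setUC.
by do 6!case: (e == _).
Qed.

(** The edge [e] has coloured neighbours only at its end [v], and two of the at
    most four edges at [v] are uncoloured. *)
Lemma card_avail_at A col e v e1 e2 : A \subset S ->
  (forall f, f \in A -> meets e f -> v \in f) ->
  e1 \in star S v -> e2 \in star S v -> e1 != e2 -> e1 \notin A -> e2 \notin A ->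
  1 < #|avail A col e|.
Proof.
move=> AS ev e1v e2v n12 e1A e2A; apply: (@card_avail A col e 2).
have sub : [set f in A | meets e f] \subset (star S v :\ e1) :\ e2.
  apply/subsetP => f; rewrite !inE => /andP[fA /(ev f fA) ->].
  rewrite (subsetP AS) // !andbT.
  by apply/andP; split; [apply: contraNneq e2A => <- | apply: contraNneq e1A => <-].
apply: leq_trans (subset_leq_card sub) _.
have := deg4 v; rewrite (cardsD1 e1) e1v (cardsD1 e2) in_setD1 eq_sym n12 e2v.
by rewrite !add1n !ltnS.
Qed.

Lemma ok_none A col e k : (forall f v, f \in A -> v \in e -> v \notin f) -> ok A col e k.
Proof.
by move=> h; apply/okP => f fA /meetsP[_ [v ve vf]]; case/negP: (h f v fA ve).
Qed.

End Critical.
End Colourings.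

Ltac absurd_vertices :=
  match goal with
  | K : ?a = ?b, H : is_true (?a != ?b) |- _ => by case/eqP: H
  | K : ?b = ?a, H : is_true (?a != ?b) |- _ => by case/eqP: H
  end.

(** Closes [compatible] goals: either the two pairs have no common vertex, or
    the colours are known not to conflict. *)
Ltac compatible_pair Rsym :=
  let m := fresh "m" in let r := fresh "r" in
  apply/negP => /andP[/= m r];
  first
    [ by match goal with
      | H : is_true (~~ _) |- _ => by rewrite r in H
      | H : is_true (~~ _) |- _ => by rewrite Rsym r in H
      end
    | by move/meets_pair: m; case/or4P => /eqP ?; absurd_vertices ].

Section Reducible.
Variable V : finType.
Variable R : {set V} -> {set V} -> rel 'I_4.
Hypothesis Rsym : forall x y a b, R x y a b = R y x b a.
Hypothesis Rfun : forall x y a b b', R x y a b -> R x y a b' -> b = b'.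
Variable S : {set {set V}}.
Hypotheses (S2 : two_sets S) (gS : girth15 S).
Hypothesis notcol : ~ colourable R S.
Hypothesis minimal : forall e, e \in S -> colourable R (S :\ e).
Hypothesis deg4 : forall v, #|star S v| <= 4.

(** Uncolour all nine edges. By [reach_two] some colour of the edge between the
    two centres leaves two colours on the right; one colour on the left exists
    anyway and conflicts with at most one of these two. *)
Lemma no_adjacent_bowties y w x q x' r p' :
  bowtie S y w x q x' -> bowtie S x q x' r p' -> False.
Proof.
move=> b1 b2.
have [u1 sx sw sq] := b1; have [u2 sx' _ sr] := b2.
have [xy xw wy [xq [xx' qx']]] := bowtie_linked b1.
have [_ _ _ [x'r [x'p' rp']]] := bowtie_linked b2.
move: u1 u2; rewrite /= !inE !negb_or.
case/and5P=> /and4P[yw yx yq yx'] /and3P[wx wq wx'] /andP[nxq nxx'] qx'n _.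
case/and5P=> /and4P[_ _ xr xp'] /and3P[_ qr qp'] /andP[x'rn x'p'n] rp'n _.
have wN : ~~ linked S w x'.
  apply/negP => /(bowtie_nbr_w S2 b1); rewrite !inE [x' == x]eq_sym [x' == y]eq_sym.
  by rewrite (negbTE nxx') (negbTE yx').
have yp' : y != p'.
  apply/eqP => yp; apply: (@no_four_cycle V S S2 gS w y x' x) => //.
  - by rewrite linkedC yp.
  - by rewrite linkedC.
have wr : w != r by apply: contraNneq wN => ->; rewrite linkedC.
have wp' : w != p' by apply: contraNneq wN => ->; rewrite linkedC.
have yr : y != r.
  apply/eqP => yr; have := bowtie_nbr_w S2 (bowtieC b2) (z := x).
  rewrite -yr linkedC xy => /(_ isT); rewrite !inE.
  by rewrite (negbTE nxx') (negbTE xp').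
pose C0 := [set x; y]; pose E0 := [set w; y]; pose Aw := [set x; w].
pose N := [set x; q]; pose M := [set x; x']; pose O := [set x'; q].
pose Br := [set x'; r]; pose D' := [set x'; p']; pose F' := [set r; p'].
pose A0 := S :\: (bowtie_edges y w x q x' :|: bowtie_edges x q x' r p').
have AS : A0 \subset S by apply: subsetDl.
have A0P f : f \in A0 -> [/\ x \notin f, w \notin f, q \notin f, x' \notin f & r \notin f].
  rewrite in_setD in_setU => /andP[+ fS]; rewrite !(mem_bowtie_edges _ fS) //.
  by rewrite !negb_or => /andP[/and3P[-> -> ->] /and3P[-> _ ->]].
have [col pc] : colourable R A0.
  by apply: (smaller_colourable minimal xy); rewrite !inE eqxx.
have atv e a v : e = [set a; v] -> (forall f, f \in A0 -> a \notin f) ->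
    forall f, f \in A0 -> meets e f -> v \in f.
  move=> -> na f fA /meetsP[_ [z]]; rewrite !inE => /orP[]/eqP-> //.
  by rewrite (negbTE (na f fA)).
have nxA f : f \in A0 -> x \notin f by case/A0P.
have nwA f : f \in A0 -> w \notin f by case/A0P.
have nqA f : f \in A0 -> q \notin f by case/A0P.
have nx'A f : f \in A0 -> x' \notin f by case/A0P.
have nrA f : f \in A0 -> r \notin f by case/A0P.
have inA (e : {set V}) z : z \in e -> (forall f, f \in A0 -> z \notin f) -> e \notin A0.
  by move=> ze h; apply/negP => /h; rewrite ze.
have iC0 : C0 \in star S y by rewrite !inE -[_ \in S]/(linked S x y) xy eqxx orbT.
have iE0 : E0 \in star S y by rewrite !inE -[_ \in S]/(linked S w y) wy eqxx orbT.
have iD' : D' \in star S p' by rewrite !inE -[_ \in S]/(linked S x' p') x'p' eqxx orbT.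
have iF' : F' \in star S p' by rewrite !inE -[_ \in S]/(linked S r p') rp' eqxx orbT.
have nCE : C0 != E0.
  apply/eqP; rewrite /C0 /E0 ![ [set _; y] ]setUC => /(pair_eq yx) xw'.
  by rewrite xw' eqxx in wx.
have nDF : D' != F'.
  apply/eqP; rewrite /D' /F' ![ [set _; p'] ]setUC => /pair_eq h.
  by move: x'rn; rewrite h ?eqxx // eq_sym.
have C0A : C0 \notin A0 by apply: (inA _ x); rewrite // !inE eqxx.
have E0A : E0 \notin A0 by apply: (inA _ w); rewrite // !inE eqxx.
have D'A : D' \notin A0 by apply: (inA _ x'); rewrite // !inE eqxx.
have F'A : F' \notin A0 by apply: (inA _ r); rewrite // !inE eqxx.
have avC := card_avail_at Rsym Rfun deg4 col AS (atv C0 x y erefl nxA) iC0 iE0 nCE C0A E0A.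
have avE := card_avail_at Rsym Rfun deg4 col AS (atv E0 w y erefl nwA) iC0 iE0 nCE C0A E0A.
have avD := card_avail_at Rsym Rfun deg4 col AS (atv D' x' p' erefl nx'A) iD' iF' nDF D'A F'A.
have avF := card_avail_at Rsym Rfun deg4 col AS (atv F' r p' erefl nrA) iD' iF' nDF D'A F'A.
(* The colour [m] of the edge [x x'] leaves two colours on the right. *)
have [m m2] := reach_two Rsym Rfun O Br M D' F' avD avF.
have [n /reachP[b [d [f ok1]]]] := reach_neq0 Rsym Rfun N Aw M C0 E0 avC avE m.
have [o /reachP[b' [d' [f' ok2]]] /andP[/= on _]] := @pick_free _ R Rsym Rfun O _ [:: (N, n)] m2.
pose s := [:: (C0, d); (E0, f); (Aw, b); (N, n); (M, m); (O, o); (Br, b'); (D', d'); (F', f')].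
have none u v k : (forall f, f \in A0 -> u \notin f) -> (forall f, f \in A0 -> v \notin f) ->
    ok R A0 col [set u; v] k.
  by move=> nu nv; apply: ok_none => g z gA; rewrite !inE => /orP[]/eqP->; [apply: nu|apply: nv].
case/and5P: ok1; rewrite /free /= !andbT => dL fL md df /andP[/and3P[bm bd bf] /and3P[nm nd nb]].
case/and5P: ok2; rewrite /free /= !andbT => dL' fL' md' df' /andP[/and3P[bm' bd' bf'] /and3P[om od ob]].
apply: notcol; apply: (colourable_sub (E := [set e in unzip1 s] :|: A0)).
  apply/subsetP => e eS; rewrite in_setU in_setD eS andbT.
  rewrite in_setU /bowtie_edges !inE [ [set q; x'] ]setUC [ [set x'; x] ]setUC [ [set q; x] ]setUC.
  by do 9!case: (e == _).
exists (assign s col); apply: proper_assign => //.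
  rewrite inE in dL; rewrite inE in fL; rewrite inE in dL'; rewrite inE in fL'.
  by rewrite /= dL fL dL' fL' !none.
rewrite /= !andbT.
repeat (apply/andP; split); compatible_pair Rsym.
Qed.
End Reducible.

Section TriangleWithBowties.
Variable V : finType.
Variable R : {set V} -> {set V} -> rel 'I_4.
Hypothesis Rsym : forall x y a b, R x y a b = R y x b a.
Hypothesis Rfun : forall x y a b b', R x y a b -> R x y a b' -> b = b'.
Variable S : {set {set V}}.
Hypotheses (S2 : two_sets S) (gS : girth15 S).
Hypothesis notcol : ~ colourable R S.
Hypothesis minimal : forall e, e \in S -> colourable R (S :\ e).
Hypothesis deg4 : forall v, #|star S v| <= 4.
Implicit Types (A : {set {set V}}) (e f t : {set V}) (col : {set V} -> 'I_4).
Implicit Types (w x y p q : V).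

Definition bowtie_bad A col y w x q p t1 t2 :=
  bad R [set x; w] [set x; q] [set x; y] [set x; p] [set q; p]
    (avail R A col [set x; p]) (avail R A col [set q; p]) [set w; y] t1 t2.

(** The colouring [col0] fixes the far end, and thereby the bad states;
    [col1] extends it elsewhere and may only add, near the bow tie, the colours
    of [t1] and [t2]. *)
Lemma bowtie_extend y w x q p A0 A1 col0 col1 t1 t2 :
  bowtie S y w x q p -> A1 \subset S :\: bowtie_edges y w x q p ->
  star A1 y \subset [set t1; t2] -> star A1 p \subset star A0 p ->
  {in star A1 p, col1 =1 col0} -> proper R A1 col1 ->
  ~~ bowtie_bad A0 col0 y w x q p t1 t2 (col1 t1) (col1 t2) ->
  exists2 col2, proper R (bowtie_edges y w x q p :|: A1) col2 & {in A1, col2 =1 col1}.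
Proof.
move=> b1 A1S sy sp colp pc nb; have [c [e [a /and4P[fc fe ae ar]]]] := not_bad nb.
have [u1 _ _ _] := b1; move: u1; rewrite /= !inE !negb_or.
case/and5P=> /and4P[yw yx yq yp] /and3P[wx wq wp] /andP[xq xp] qp _.
have A1P f : f \in A1 -> [/\ x \notin f, w \notin f & q \notin f].
  move/(subsetP A1S); rewrite in_setD => /andP[+ fS]; rewrite (mem_bowtie_edges b1 fS) //.
  by rewrite !negb_or => /and3P.
have nx f : f \in A1 -> x \notin f by case/A1P.
have nw f : f \in A1 -> w \notin f by case/A1P.
have nq f : f \in A1 -> q \notin f by case/A1P.
have none u v k : (forall f, f \in A1 -> u \notin f) -> (forall f, f \in A1 -> v \notin f) ->
    ok R A1 col1 [set u; v] k.
  by move=> nu nv; apply: ok_none => g z gA; rewrite !inE => /orP[]/eqP->; [apply: nu|apply: nv].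
have okp u k : (forall f, f \in A1 -> u \notin f) -> ok R A0 col0 [set u; p] k ->
    ok R A1 col1 [set u; p] k.
  move=> nu /okP o; apply/okP => f fA m.
  have pf : p \in f.
    case/meetsP: m => _ [z]; rewrite !inE => /orP[]/eqP-> //.
    by rewrite (negbTE (nu f fA)).
  have fp : f \in star A1 p by rewrite inE fA.
  rewrite colp //; apply: o m.
  by have := subsetP sp f fp; rewrite inE => /andP[].
have oky u k : (forall f, f \in A1 -> u \notin f) ->
    free R [set u; y] [:: (t1, col1 t1); (t2, col1 t2)] k -> ok R A1 col1 [set u; y] k.
  move=> nu /and3P[n1 n2 _]; apply/okP => f fA m.
  have yf : y \in f.
    case/meetsP: m => _ [z]; rewrite !inE => /orP[]/eqP-> //.
    by rewrite (negbTE (nu f fA)).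
  by have := subsetP sy f; rewrite inE fA yf !inE => /(_ isT)/orP[]/eqP->.
case/reachP: ar => b [d [f /and5P[dL fL]]]; rewrite /free /= !andbT.
move=> cd df /andP[/and3P[bc bd bf] /and3P[ac ad ab]].
have fE : free R [set w; y] [:: (t1, col1 t1); (t2, col1 t2)] e.
  by move: fe; rewrite /free /= => /and4P[-> -> _ _].
have ec : ~~ R [set w; y] [set x; y] e c by move: fe; rewrite /free /= => /and4P[].
pose s := [:: ([set x; y], c); ([set x; w], a); ([set x; q], b); ([set x; p], d);
              ([set w; y], e); ([set q; p], f)].
have us : [set g in unzip1 s] = bowtie_edges y w x q p.
  by apply/setP => g; rewrite !inE /=; do 6!case: (g == _).
exists (assign s col1).
  rewrite -us; apply: proper_assign => //.
    rewrite inE in dL; rewrite inE in fL.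
    by rewrite /= !oky // !okp // !none.
  rewrite /= !andbT.
  repeat (apply/andP; split); compatible_pair Rsym.
move=> g gA; apply: assign_notin; apply/negP => gs.
have : g \in [set g in unzip1 s] by rewrite inE.
by rewrite us; have := subsetP A1S g gA; rewrite in_setD => /andP[/negbTE->].
Qed.

Lemma bowtie_deg_p y w x q p : bowtie S y w x q p -> 4 <= #|star S p|.
Proof.
move=> b1; have [_ q2] := bowtie_deg b1; have [_ _ _ [_ [_ qp]]] := bowtie_linked b1.
by have := deg_sum Rsym Rfun notcol minimal qp; rewrite q2 !addSn add0n !ltnS.
Qed.

Lemma bowtie_deg_x y w x q p : bowtie S y w x q p -> 4 <= #|star S x|.
Proof.
move=> b1; have [_ q2] := bowtie_deg b1; have [_ _ _ [xq _]] := bowtie_linked b1.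
by have := deg_sum Rsym Rfun notcol minimal xq; rewrite q2 addn2 !ltnS.
Qed.

Lemma bowtie_avail y w x q p A col : bowtie S y w x q p ->
  A \subset S :\: bowtie_edges y w x q p ->
  1 < #|avail R A col [set x; p]| /\ 1 < #|avail R A col [set q; p]|.
Proof.
move=> b1 AS; have [_ _ _ [xq [xp qp]]] := bowtie_linked b1.
have AP f : f \in A -> (x \notin f) /\ (q \notin f).
  move/(subsetP AS); rewrite in_setD => /andP[+ fS]; rewrite (mem_bowtie_edges b1 fS) //.
  by rewrite !negb_or => /and3P[].
have at_p e a f : e = [set a; p] -> (forall f, f \in A -> a \notin f) ->
    f \in A -> meets e f -> p \in f.
  move=> -> na fA /meetsP[_ [z]]; rewrite !inE => /orP[]/eqP-> //.
  by rewrite (negbTE (na f fA)).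
have nx f : f \in A -> x \notin f by case/AP.
have nq f : f \in A -> q \notin f by case/AP.
have iD : [set x; p] \in star S p by rewrite inE -[_ \in S]/(linked S x p) xp !inE eqxx orbT.
have iF : [set q; p] \in star S p by rewrite inE -[_ \in S]/(linked S q p) qp !inE eqxx orbT.
have nDF : [set x; p] != [set q; p].
  apply/eqP; rewrite ![ [set _; p] ]setUC => /pair_eq h.
  have npx : p != x by rewrite eq_sym (linked_neq S2).
  by have := linked_neq S2 xq; rewrite (h npx) eqxx.
have DA : [set x; p] \notin A by apply/negP => /nx; rewrite !inE eqxx.
have FA : [set q; p] \notin A by apply/negP => /nq; rewrite !inE eqxx.
have AS' : A \subset S by apply: subset_trans AS (subsetDl _ _).
split; apply: (card_avail_at Rsym Rfun deg4 col AS' _ iD iF nDF DA FA) => f.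
  exact: at_p.
exact: at_p.
Qed.

(** Adjacent centres share an ear, so that [no_adjacent_bowties] applies. The
    reflections of the two bow ties reduce the case distinction to one case. *)
Lemma bowties_not_adjacent y w x q p y' w' x' q' p' :
  bowtie S y w x q p -> bowtie S y' w' x' q' p' -> linked S x x' -> False.
Proof.
wlog xp : y w q p / x' = p => [H|] b1 b2 xx'.
  have := bowtie_nbr S2 b1 xx'; rewrite !inE => /or4P[]/eqP e.
  - exact: (H p q w y e (bowtieC b1) b2 xx').
  - by have := bowtie_deg_x b2; have [w2 _] := bowtie_deg b1; rewrite e w2.
  - by have := bowtie_deg_x b2; have [_ q2] := bowtie_deg b1; rewrite e q2.
  - exact: (H y w q p e b1 b2 xx').
wlog xp' : y' w' q' p' b2 / x = p' => [H|].
  have := bowtie_nbr S2 b2 (z := x); rewrite linkedC xx' => /(_ isT); rewrite !inE => /or4P[]/eqP e.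
  - exact: (H p' q' w' y' (bowtieC b2) e).
  - by have := bowtie_deg_x b1; have [w2 _] := bowtie_deg b2; rewrite e w2.
  - by have := bowtie_deg_x b1; have [_ q2] := bowtie_deg b2; rewrite e q2.
  - exact: (H y' w' q' p' b2 e).
subst p p'.
have [_ _ _ [x'q' [_ q'x]]] := bowtie_linked b2.
have qq' : q' = q.
  have := bowtie_nbr S2 b1 (z := q'); rewrite linkedC q'x => /(_ isT).
  have [_ q'2] := bowtie_deg b2.
  rewrite !inE => /or4P[]/eqP // e.
  - have [_ _ wy _] := bowtie_linked b1; have [w2 _] := bowtie_deg b1.
    by have := deg_sum Rsym Rfun notcol minimal wy; rewrite -e w2 q'2.
  - have := bowtie_nbr_w S2 b1 (z := x'); rewrite -e linkedC x'q' => /(_ isT).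
    rewrite !inE eq_sym (negbTE (linked_neq S2 xx')) /= => /eqP x'y.
    by have [+ _ _ _] := b1; rewrite x'y /= !inE eqxx !orbT.
  - by have := linked_neq S2 x'q'; rewrite e eqxx.
subst q'.
exact: (no_adjacent_bowties Rsym Rfun S2 gS notcol minimal deg4 b2 (bowtieC b1)).
Qed.

(** If [z] were the far end [p], the cycle [w y p x] would have length four. *)
Lemma triangle_bowtie_neq y w x q p z : bowtie S y w x q p ->
  linked S y z -> z != x -> z != w ->
  [/\ z != y, z != q & z != p].
Proof.
move=> b1 yz zx zw; have [xy xw wy [xq [xp qp]]] := bowtie_linked b1.
have [u _ _ _] := b1; move: u; rewrite /= !inE !negb_or.
case/and5P=> /and4P[nyw nyx nyq nyp] /and3P[nwx nwq nwp] /andP[nxq nxp] nqp _.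
split=> //; first by rewrite eq_sym (linked_neq S2 yz).
  apply: contraTneq yz => ->; apply/negP; rewrite linkedC => /(bowtie_nbr_q S2 b1).
  by rewrite !inE (negbTE nyx) (negbTE nyp).
apply/eqP => zp; apply: (@no_four_cycle V S S2 gS w y p x) => //.
- by rewrite -zp.
- by rewrite linkedC.
Qed.

End TriangleWithBowties.

(** * A triangle with two bow ties *)

Lemma card_setC4 (X : {set 'I_4}) n : #|X| <= n -> 4 - n <= #|~: X|.
Proof. by have := cardsC X; rewrite card_ord; lia. Qed.

Lemma cover_all (T : finType) (S B B' Th : {set T}) (a b c e : T) : e \in S ->
  e \in B' :|: (B :|: (a |: ([set b; c] :|: Th :|:
    (S :\: (B :|: B' :|: [set a; b; c] :|: Th))))).
Proof.
move=> eS; rewrite !inE eS andbT; case: (e \in B); case: (e \in B'); case: (e \in Th);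
by case: (e == a); case: (e == b); case: (e == c).
Qed.

Section TwoBowties.
Variable V : finType.
Variable R : {set V} -> {set V} -> rel 'I_4.
Hypothesis Rsym : forall x y a b, R x y a b = R y x b a.
Hypothesis Rfun : forall x y a b b', R x y a b -> R x y a b' -> b = b'.
Variable S : {set {set V}}.
Hypotheses (S2 : two_sets S) (gS : girth15 S).
Hypothesis notcol : ~ colourable R S.
Hypothesis minimal : forall e, e \in S -> colourable R (S :\ e).
Hypothesis deg4 : forall v, #|star S v| <= 4.
Lemma star4 z e1 e2 e3 e4 : uniq [:: e1; e2; e3; e4] ->
  {subset [:: e1; e2; e3; e4] <= star S z} -> forall f, f \in star S z -> f \in [:: e1; e2; e3; e4].
Proof.
move=> u sub f; suff <- : [set e in [:: e1; e2; e3; e4]] = star S z by rewrite in_set.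
have c4 : #|[set e in [:: e1; e2; e3; e4]]| = 4 by rewrite cardsE; exact/card_uniqP.
apply/eqP; rewrite eqEcard c4 deg4 andbT.
by apply/subsetP => e; rewrite inE => /sub.
Qed.

Lemma bowtie_star_y y w x q p z z' f : bowtie S y w x q p -> linked S y z -> linked S y z' ->
  z != z' -> z != x -> z != w -> z' != x -> z' != w ->
  f \in star S y -> f \in [:: [set x; y]; [set w; y]; [set y; z]; [set y; z']].
Proof.
move=> b1 yz yz' nzz' zx zw z'x z'w.
have [xy xw wy _] := bowtie_linked b1.
have nyx : y != x by rewrite eq_sym (linked_neq S2).
have nyw : y != w by rewrite eq_sym (linked_neq S2).
have nyz := linked_neq S2 yz; have nyz' := linked_neq S2 yz'.
have nxw := linked_neq S2 xw.
apply: star4; last first.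
  move=> e; rewrite !in_cons in_nil orbF => /or4P[]/eqP->; rewrite inE.
  - by rewrite -[_ \in S]/(linked S x y) xy !inE eqxx orbT.
  - by rewrite -[_ \in S]/(linked S w y) wy !inE eqxx orbT.
  - by rewrite -[_ \in S]/(linked S y z) yz !inE eqxx.
  - by rewrite -[_ \in S]/(linked S y z') yz' !inE eqxx.
rewrite [ [set x; y] ]setUC [ [set w; y] ]setUC /= !inE !negb_or andbT.
have ne a b : y != a -> a != b -> [set y; a] != [set y; b].
  by move=> ya ab; apply/eqP => /(pair_eq ya) e; rewrite e eqxx in ab.
by rewrite !ne // eq_sym.
Qed.

Variables y w x q p y' w' x' q' p' : V.
Hypotheses (b1 : bowtie S y w x q p) (b2 : bowtie S y' w' x' q' p').
Hypotheses (yy' : linked S y y') (y'x : y' != x) (y'w : y' != w) (yx' : y != x') (yw' : y != w').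

(** Every coincidence would produce an adjacency that the known neighbourhoods
    exclude, a pair of adjacent centres, or a cycle of length four or five. *)
Lemma bowties_apart v : v \in [:: y; w; x; q; p] -> v \notin [:: w'; x'; q'; p'].
Proof.
have [xy xw wy [xq [xp qp]]] := bowtie_linked b1.
have [x'y' x'w' w'y' [x'q' [x'p' q'p']]] := bowtie_linked b2.
have y'y : linked S y' y by rewrite linkedC.
have [y'ny y'q y'p] := triangle_bowtie_neq S2 gS b1 yy' y'x y'w.
have [yny' yq' yp'] := triangle_bowtie_neq S2 gS b2 y'y yx' yw'.
have [u _ _ _] := b1; move: u; rewrite /= !inE !negb_or.
case/and5P=> /and4P[nyw nyx nyq nyp] /and3P[nwx nwq nwp] /andP[nxq nxp] nqp _.
have Nwy : ~~ linked S w y'.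
  by apply/negP => /(bowtie_nbr_w S2 b1); rewrite !inE (negbTE y'x) (negbTE y'ny).
have Nxy : ~~ linked S x y'.
  apply/negP => /(bowtie_nbr S2 b1).
  by rewrite !inE (negbTE y'ny) (negbTE y'w) (negbTE y'q) (negbTE y'p).
have Nqy : ~~ linked S q y'.
  by apply/negP => /(bowtie_nbr_q S2 b1); rewrite !inE (negbTE y'x) (negbTE y'p).
have Npy : ~~ linked S p y'.
  apply/negP => py'; apply: (@no_four_cycle V S S2 gS y x p y') => //.
  - by rewrite linkedC.
  - by rewrite eq_sym.
have Nxx : ~~ linked S x x'.
  by apply/negP => xx'; apply: (bowties_not_adjacent Rsym Rfun S2 gS notcol minimal deg4 b1 b2).
have nxx' : x' != x by apply: contraNneq Nxy => <-.
have Nwx : ~~ linked S w x'.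
  apply/negP => /(bowtie_nbr_w S2 b1).
  by rewrite !inE (negbTE nxx') [x' == y]eq_sym (negbTE yx').
have Nqx : ~~ linked S q x'.
  apply/negP => /(bowtie_nbr_q S2 b1).
  rewrite !inE (negbTE nxx') /= => /eqP x'p; case/negP: Nxx.
  by rewrite x'p.
have p'x' : linked S p' x' by rewrite linkedC.
have q'x' : linked S q' x' by rewrite linkedC.
have pq' : p != q'.
  apply/eqP => pq; have := bowtie_deg_p Rsym Rfun notcol minimal b1.
  by have [_ q2] := bowtie_deg b2; rewrite pq q2.
have pp' : p != p'.
  apply/eqP => pp; apply: (@no_five_cycle V S S2 gS y x p x' y') => //.
  - by rewrite linkedC.
  - by rewrite pp.
  - by rewrite eq_sym.
  - by rewrite eq_sym.
  - by rewrite eq_sym.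
case/or4P=> [||| /orP[]] /eqP->.
- by rewrite yw' yx' yq' yp'.
- apply/and4P; split; [apply: contraNneq Nwy|apply: contraNneq Nwy|
    apply: contraNneq Nwx|apply: contraNneq Nwx]; by move=> ->.
- apply/and4P; split; [apply: contraNneq Nxy|apply: contraNneq Nxy|
    apply: contraNneq Nxx|apply: contraNneq Nxx]; by move=> ->.
- apply/and4P; split; [apply: contraNneq Nqy|apply: contraNneq Nqy|
    apply: contraNneq Nqx|apply: contraNneq Nqx]; by move=> ->.
- by rewrite pq' pp' /= !andbT; apply/andP; split; [apply: contraNneq Npy|apply: contraNneq Npy]; move=> ->.
Qed.

Variables (y'' : V) (Th : {set {set V}}).
Hypotheses (yy'' : linked S y y'') (y'y'' : linked S y' y'').
Hypotheses (y''x : y'' != x) (y''w : y'' != w) (y''x' : y'' != x') (y''w' : y'' != w').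
Hypothesis ThS : Th \subset S.
Hypothesis Th_apart : forall e v, e \in Th ->
  v \in [:: y; w; x; q; p; y'; w'; x'; q'; p'] -> v \notin e.

Notation t1 := [set y; y'].
Notation t2 := [set y; y''].
Notation t3 := [set y'; y''].
Notation B := (bowtie_edges y w x q p).
Notation B' := (bowtie_edges y' w' x' q' p').
(** What stays coloured. The set [Th] consists of the additional edges uncoloured
    at the third corner of the triangle, and [extend_third] says that they
    can be coloured again with a choice of at least two colours on [t2]. *)
Definition far_part := S :\: (B :|: B' :|: [set t1; t2; t3] :|: Th).

Hypothesis extend_third : forall col (L : {set 'I_4}), proper R far_part col -> 1 < #|L| ->
  exists col1, [/\ proper R ([set t2; t3] :|: Th :|: far_part) col1,
                   {in far_part, col1 =1 col} & col1 t2 \in L].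

(** Colour [t2] avoiding the at most two colours that occur in bad states of
    the first bow tie; then this bow tie extends whatever the colour of [t1].
    After [t3] is coloured, [t1] has to avoid the colours of [t2] and [t3] and
    one further colour, the bad one for the second bow tie. So a fourth colour
    remains. *)
Theorem two_bowties_reducible : False.
Proof.
have [xy xw wy [xq [xp qp]]] := bowtie_linked b1.
have y'y : linked S y' y by rewrite linkedC.
have [_ y'q y'p] := triangle_bowtie_neq S2 gS b1 yy' y'x y'w.
have [_ yq' yp'] := triangle_bowtie_neq S2 gS b2 y'y yx' yw'.
have [_ y''q y''p] := triangle_bowtie_neq S2 gS b1 yy'' y''x y''w.
have [_ y''q' y''p'] := triangle_bowtie_neq S2 gS b2 y'y'' y''x' y''w'.
have n'' := linked_neq S2 y'y''; have nyy' := linked_neq S2 yy'; have nyy'' := linked_neq S2 yy''.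
have [u _ _ _] := b1; move: u; rewrite /= !inE !negb_or.
case/and5P=> /and4P[nyw nyx nyq nyp] /and3P[nwx nwq nwp] /andP[nxq nxp] nqp _.
have [u' _ _ _] := b2; move: u'; rewrite /= !inE !negb_or.
case/and5P=> /and4P[nyw' nyx' nyq' nyp'] /and3P[nwx' nwq' nwp'] /andP[nxq' nxp'] nqp' _.
have sy f : f \in star S y -> f \in [:: [set x; y]; [set w; y]; t1; t2].
  exact: (bowtie_star_y b1 yy' yy'').
have sy' f : f \in star S y' -> f \in [:: [set x'; y']; [set w'; y']; t1; t3].
  by rewrite [t1]setUC; apply: (bowtie_star_y b2).
pose A0 := far_part.
have A0S : A0 \subset S by apply: subsetDl.
have A0P f : f \in A0 -> [/\ f \in S, f \notin B, f \notin B', f \notin [set t1; t2; t3] & f \notin Th].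
  rewrite /A0 /far_part in_setD => /andP[+ fS].
  rewrite in_setU negb_or => /andP[+ nT]; rewrite in_setU negb_or => /andP[+ nt].
  by rewrite in_setU negb_or => /andP[nB nB'].
have [col pc] : colourable R A0.
  by apply: (smaller_colourable minimal yy'); rewrite !inE eqxx !orbT.
have A0B : A0 \subset S :\: B by apply/subsetP => f /A0P[fS fB _ _ _]; rewrite in_setD fB.
have A0B' : A0 \subset S :\: B' by apply/subsetP => f /A0P[fS _ fB _ _]; rewrite in_setD fB.
have [avD avF] := bowtie_avail Rsym Rfun S2 deg4 col b1 A0B.
have [avD' avF'] := bowtie_avail Rsym Rfun S2 deg4 col b2 A0B'.
pose bad1 := bowtie_bad R A0 col y w x q p t1 t2.
pose bad2 := bowtie_bad R A0 col y' w' x' q' p' t1 t3.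
have L2 : 1 < #|~: [set k | [exists k1, bad1 k1 k]]|.
  have := @card_bad _ R Rsym Rfun [set x; w] [set x; q] [set x; y]
    [set x; p] [set q; p] _ _ avD avF [set w; y] t1 t2.
  by move=> c2; have := card_setC4 c2.
have [col1 [pc1 col1A0]] := extend_third pc L2.
rewrite in_setC inE negb_exists => /forallP ok1.
have L3 : 2 < #|[set k | ~~ bad2 k (col1 t3)]|.
  have le1 : #|[set k | bad2 k (col1 t3)]| <= 1.
    apply/card_le1_eqP => k k'; rewrite !inE => bk bk'.
    exact: (bad_uniq Rsym Rfun avD' avF' bk' bk).
  have -> : [set k | ~~ bad2 k (col1 t3)] = ~: [set k | bad2 k (col1 t3)].
    by apply/setP => k; rewrite !inE.
  by have := card_setC4 le1.
(* Three colours avoid the bad one, and [t1] sees only [t2] and [t3]. *)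
have [k1 k1L /and3P[k12 k13 _]] :=
  @pick_free _ R Rsym Rfun t1 _ [:: (t2, col1 t2); (t3, col1 t3)] L3.
rewrite inE in k1L.
have nt12 : t1 != t2 by apply/eqP => /(pair_eq nyy') e; rewrite e eqxx in n''.
have nt13 : t1 != t3.
  rewrite [t1]setUC; apply/eqP => /pair_eq e.
  by rewrite eq_sym in nyy'; rewrite (e nyy') eqxx in nyy''.
pose A1 := t1 |: ([set t2; t3] :|: Th :|: A0).
pose col1' := recolour col1 t1 k1.
have inTh f v : f \in Th -> v \in [:: y; w; x; q; p; y'; w'; x'; q'; p'] -> v \in f -> False.
  by move=> fT h vf; case/negP: (Th_apart fT h).
have okt1 : ok R ([set t2; t3] :|: Th :|: A0) col1 t1 k1.
  apply/okP => f; rewrite !in_setU !in_set1 -orbA => /orP[/orP[]/eqP-> //|].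
  case/orP=> [fT|fA] /meetsP[_ [v]]; rewrite !inE => /orP[]/eqP-> vf.
  - by case: (inTh f y fT _ vf); rewrite !inE eqxx.
  - by case: (inTh f y' fT _ vf); rewrite !inE eqxx !orbT.
  - have [fS fB _ ft _] := A0P f fA.
    have := sy f; rewrite in_star fS vf !in_cons in_nil orbF => /(_ isT).
    case/or4P=> /eqP fe; [case/negP: fB|case/negP: fB|case/negP: ft|case/negP: ft];
      by rewrite fe /bowtie_edges !inE eqxx ?orbT.
  - have [fS _ fB ft _] := A0P f fA.
    have := sy' f; rewrite in_star fS vf !in_cons in_nil orbF => /(_ isT).
    case/or4P=> /eqP fe; [case/negP: fB|case/negP: fB|case/negP: ft|case/negP: ft];
      by rewrite fe /bowtie_edges !inE eqxx ?orbT.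
have pA1 : proper R A1 col1' by apply: proper_add.
have A1case f : f \in A1 -> [\/ f \in [set t1; t2; t3], f \in Th | f \in A0].
  case/setU1P=> [->|/setUP[/setUP[/set2P[]->|fT]|fA]].
  - by apply: Or31; rewrite !inE eqxx.
  - by apply: Or31; rewrite !inE eqxx ?orbT.
  - by apply: Or31; rewrite !inE eqxx ?orbT.
  - exact: Or32.
  - exact: Or33.
have tS f : f \in [set t1; t2; t3] -> f \in S.
  by rewrite !inE -orbA => /or3P[]/eqP->.
have tv f v : f \in [set t1; t2; t3] -> v \in f -> [\/ v = y, v = y' | v = y''].
  by rewrite !inE -orbA => /or3P[]/eqP->; rewrite !inE => /orP[]/eqP->;
     do ?[by apply: Or31|by apply: Or32|by apply: Or33].
have A1S : A1 \subset S.
  by apply/subsetP => f /A1case[/tS//|/(subsetP ThS)//|/A0P[]].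
have A1B : A1 \subset S :\: B.
  apply/subsetP => f fA1; have fS := subsetP A1S f fA1.
  rewrite in_setD fS andbT; case: (A1case f fA1) => [ft|fT|/A0P[]//].
    rewrite (mem_bowtie_edges b1 fS) !negb_or; apply/and3P.
    by split; apply/negP => /(tv f _ ft)[] e; absurd_vertices.
  rewrite (mem_bowtie_edges b1 fS) !negb_or; apply/and3P.
  by split; apply/negP => vf; case: (inTh f _ fT _ vf); rewrite !inE eqxx !orbT.
have A1B' : A1 \subset S :\: B'.
  apply/subsetP => f fA1; have fS := subsetP A1S f fA1.
  rewrite in_setD fS andbT; case: (A1case f fA1) => [ft|fT|/A0P[]//].
    rewrite (mem_bowtie_edges b2 fS) !negb_or; apply/and3P.
    by split; apply/negP => /(tv f _ ft)[] e; absurd_vertices.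
  rewrite (mem_bowtie_edges b2 fS) !negb_or; apply/and3P.
  by split; apply/negP => vf; case: (inTh f _ fT _ vf); rewrite !inE eqxx !orbT.
have col1'A0 f : f \in A0 -> col1' f = col f.
  move=> fA; rewrite /col1' /recolour ifN ?col1A0 //.
  by have [_ _ _ + _] := A0P f fA; apply: contraNneq => ->; rewrite !inE eqxx.
have e1 : col1' t1 = k1 by rewrite /col1' /recolour eqxx.
have e2 : col1' t2 = col1 t2 by rewrite /col1' /recolour ifN // eq_sym.
have e3 : col1' t3 = col1 t3 by rewrite /col1' /recolour ifN // eq_sym.
have sA1p v : v \in [:: p; p'] -> star A1 v \subset star A0 v.
  move=> vp; apply/subsetP => f; rewrite !in_star => /andP[fA1 vf]; rewrite vf andbT.
  case: (A1case f fA1) => // [ft|fT].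
    by move: vp; rewrite !inE; case: (tv f v ft vf) => -> /orP[]/eqP e; absurd_vertices.
  case: (inTh f v fT _ vf); move: vp; rewrite !inE.
  by case/orP=> ->; rewrite ?orbT.
have sA1y : star A1 y \subset [set t1; t2].
  apply/subsetP => f; rewrite in_star => /andP[fA1 yf].
  have := subsetP A1B f fA1; rewrite in_setD => /andP[fB fS].
  have := sy f; rewrite in_star fS yf !in_cons in_nil orbF => /(_ isT).
  case/or4P=> /eqP fe; [case/negP: fB|case/negP: fB| |];
    by rewrite fe /bowtie_edges !inE eqxx ?orbT.
have [|||col2 pc2 col2A1] := bowtie_extend Rsym b1 A1B sA1y (sA1p p _) _ pA1 (_ : ~~ bad1 _ _).
- by rewrite !inE eqxx.
- by move=> f /(subsetP (sA1p p _)); rewrite in_star mem_head => /(_ isT)/andP[/col1'A0].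
- by rewrite e1 e2; apply: ok1.
have apart v : v \in [:: y; w; x; q; p] -> [/\ v != w', v != x', v != q' & v != p'].
  by move=> /bowties_apart; rewrite !inE !negb_or => /and4P.
have Bv f v : f \in B -> v \in f -> v \in [:: y; w; x; q; p].
  rewrite /bowtie_edges !in_setU !in_set1 -!orbA.
  by case/or4P=> [|||/or3P[]] /eqP->; rewrite !inE => /orP[]/eqP->; rewrite eqxx ?orbT.
have BS : B \subset S.
  apply/subsetP => f; rewrite /bowtie_edges !in_setU !in_set1 -!orbA.
  by case/or4P=> [|||/or3P[]] /eqP->.
have A2B' : B :|: A1 \subset S :\: B'.
  rewrite subUset A1B' andbT; apply/subsetP => f fB; have fS := subsetP BS f fB.
  rewrite in_setD fS andbT (mem_bowtie_edges b2 fS) !negb_or; apply/and3P.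
  by split; apply/negP => /(Bv f _ fB)/apart[]; rewrite eqxx.
have A2S : B :|: A1 \subset S by apply: subset_trans A2B' (subsetDl _ _).
have sA2p : star (B :|: A1) p' \subset star A0 p'.
  apply/subsetP => f; rewrite in_star in_setU => /andP[/orP[fB|fA] pf].
    by case/(Bv f _ fB)/apart: pf; rewrite eqxx.
  by apply: (subsetP (sA1p p' _)); rewrite ?in_star ?fA // !inE eqxx orbT.
have sA2y : star (B :|: A1) y' \subset [set t1; t3].
  apply/subsetP => f; rewrite in_star => /andP[fA2 yf].
  have := subsetP A2B' f fA2; rewrite in_setD => /andP[fB fS].
  have := sy' f; rewrite in_star fS yf !in_cons in_nil orbF => /(_ isT).
  case/or4P=> /eqP fe; [case/negP: fB|case/negP: fB| |];
    by rewrite fe /bowtie_edges !inE eqxx ?orbT.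
have t1A1 : t1 \in A1 by rewrite !inE eqxx.
have t3A1 : t3 \in A1 by rewrite !inE eqxx ?orbT.
have A0A1 f : f \in A0 -> f \in A1 by rewrite in_setU1 in_setU => ->; rewrite !orbT.
have [||col3 pc3 _] := bowtie_extend Rsym b2 A2B' sA2y sA2p _ pc2 (_ : ~~ bad2 _ _).
- move=> f /(subsetP sA2p); rewrite in_star => /andP[fA _].
  by rewrite col2A1 ?A0A1 ?col1'A0.
- by rewrite (col2A1 t1 t1A1) (col2A1 t3 t3A1) e1 e3; exact: k1L.
have cover_S e : e \in S -> e \in B' :|: (B :|: A1) by apply: cover_all.
by apply: notcol; exists col3 => e f /cover_S eS /cover_S fS; apply: pc3.
Qed.

End TwoBowties.

Lemma overlap4 (X Y : {set 'I_4}) : 4 < #|X| + #|Y| -> exists2 k, k \in X & k \in Y.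
Proof.
rewrite -cardsUI => lt; have /card_gt0P[k] : 0 < #|X :&: Y|.
  have := max_card (mem (X :|: Y)); rewrite card_ord.
  by move: (#|_ :|: _|) (#|_ :&: _|) lt => a b; lia.
by rewrite in_setI => /andP[? ?]; exists k.
Qed.

Section ThirdVertex.
Variable V : finType.
Variable R : {set V} -> {set V} -> rel 'I_4.
Hypothesis Rsym : forall x y a b, R x y a b = R y x b a.
Hypothesis Rfun : forall x y a b b', R x y a b -> R x y a b' -> b = b'.
Variable S : {set {set V}}.
Hypotheses (S2 : two_sets S) (gS : girth15 S).
Hypothesis notcol : ~ colourable R S.
Hypothesis minimal : forall e, e \in S -> colourable R (S :\ e).
Hypothesis deg4 : forall v, #|star S v| <= 4.

(** As for two bow ties, coincidences would create forbidden adjacencies or a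
    cycle of length four. *)
Lemma third_apart y w x q p y'' w'' p'' : bowtie S y w x q p ->
  linked S y y'' -> y'' != x -> y'' != w -> linked S y'' p'' ->
  (forall z, linked S w'' z -> z \in [:: y''; p'']) ->
  y != w'' -> y != p'' ->
  forall v, v \in [:: y; w; x; q; p] -> [/\ v != y'', v != w'' & v != p''].
Proof.
move=> b1 yy'' y''x y''w y''p'' sw'' nyw'' nyp''.
have [xy xw wy [xq [xp qp]]] := bowtie_linked b1.
have [y''y y''q y''p] := triangle_bowtie_neq S2 gS b1 yy'' y''x y''w.
have [u _ _ _] := b1; move: u; rewrite /= !inE !negb_or.
case/and5P=> /and4P[nyw nyx nyq nyp] /and3P[nwx nwq nwp] /andP[nxq nxp] nqp _.
have Nwy : ~~ linked S w y''.
  by apply/negP => /(bowtie_nbr_w S2 b1); rewrite !inE (negbTE y''x) (negbTE y''y).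
have Nxy : ~~ linked S x y''.
  apply/negP => /(bowtie_nbr S2 b1).
  by rewrite !inE (negbTE y''y) (negbTE y''w) (negbTE y''q) (negbTE y''p).
have Nqy : ~~ linked S q y''.
  by apply/negP => /(bowtie_nbr_q S2 b1); rewrite !inE (negbTE y''x) (negbTE y''p).
have Npy : ~~ linked S p y''.
  apply/negP => py''; apply: (@no_four_cycle V S S2 gS y x p y'') => //.
  - by rewrite linkedC.
  - by rewrite linkedC.
  - by rewrite eq_sym.
have Nw''y : ~~ linked S w'' y.
  by apply/negP => /sw''; rewrite !inE eq_sym (negbTE y''y) (negbTE nyp'').
have Nw''x : ~~ linked S w'' x.
  apply/negP => /sw''; rewrite !inE eq_sym (negbTE y''x) /= => /eqP xp''.
  by case/negP: Nxy; rewrite linkedC xp''.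
have p''y'' : linked S p'' y'' by rewrite linkedC.
move=> v vB; split.
- by move: v vB => v; rewrite !inE => /or4P[||| /orP[]] /eqP->; rewrite eq_sym.
- move: vB; rewrite !inE => /or4P[||| /orP[]] /eqP->.
  + exact: nyw''.
  + by apply: contraNneq Nw''y => <-.
  + by apply: contraNneq Nw''y => <-.
  + by apply: contraNneq Nw''x => <-; rewrite linkedC.
  + by apply: contraNneq Nw''x => <-; rewrite linkedC.
- move: vB; rewrite !inE => /or4P[||| /orP[]] /eqP->.
  + exact: nyp''.
  + by apply: contraNneq Nwy => ->.
  + by apply: contraNneq Nxy => ->.
  + by apply: contraNneq Nqy => ->.
  + by apply: contraNneq Npy => ->.
Qed.

Variables y w x q p y' w' x' q' p' y'' : V.
Hypotheses (b1 : bowtie S y w x q p) (b2 : bowtie S y' w' x' q' p').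
Hypotheses (yy' : linked S y y') (y'x : y' != x) (y'w : y' != w) (yx' : y != x') (yw' : y != w').
Hypotheses (yy'' : linked S y y'') (y'y'' : linked S y' y'').
Hypotheses (y''x : y'' != x) (y''w : y'' != w) (y''x' : y'' != x') (y''w' : y'' != w').

Notation t1 := [set y; y'].
Notation t2 := [set y; y''].
Notation t3 := [set y'; y''].
Notation far := (far_part S y w x q p y' w' x' q' p' y'').

Lemma far_avoids Th f : f \in far Th ->
  [/\ f \in S, f \notin [set t2; t3], f \notin Th, y \notin f & y' \notin f].
Proof.
have n'' := linked_neq S2 y'y''.
rewrite /far_part in_setD => /andP[+ fS].
rewrite in_setU negb_or => /andP[+ nT]; rewrite in_setU negb_or => /andP[+ nt].
rewrite in_setU negb_or => /andP[nB nB'].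
split=> //.
- by apply: contra nt; rewrite !inE => /orP[]->; rewrite ?orbT.
- apply/negP => yf; have := bowtie_star_y S2 deg4 (f := f) b1 yy' yy'' n'' y'x y'w y''x y''w.
  rewrite in_star fS yf !in_cons in_nil orbF => /(_ isT).
  case/or4P=> /eqP fe; [case/negP: nB|case/negP: nB|case/negP: nt|case/negP: nt];
    by rewrite fe /bowtie_edges !inE eqxx ?orbT.
- apply/negP => yf.
  have y'y : linked S y' y by rewrite linkedC.
  have nyy'' := linked_neq S2 yy''.
  have := bowtie_star_y S2 deg4 (f := f) b2 y'y y'y'' nyy'' yx' yw' y''x' y''w'.
  rewrite in_star fS yf !in_cons in_nil orbF [ [set y'; y] ]setUC => /(_ isT).
  case/or4P=> /eqP fe; [case/negP: nB'|case/negP: nB'|case/negP: nt|case/negP: nt];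
    by rewrite fe /bowtie_edges !inE eqxx ?orbT.
Qed.

(** The third vertex of the triangle has degree three: its two triangle edges
    keep three colours each. *)
Lemma small_third_reducible : #|star S y''| <= 3 -> False.
Proof.
move=> deg3; have nyy' := linked_neq S2 yy'.
have nyy'' := linked_neq S2 yy''; have ny'y'' := linked_neq S2 y'y''.
have i2 : t2 \in star S y'' by rewrite in_star -[_ \in S]/(linked S y y'') yy'' !inE eqxx orbT.
have i3 : t3 \in star S y'' by rewrite in_star -[_ \in S]/(linked S y' y'') y'y'' !inE eqxx orbT.
have n23 : t2 != t3.
  apply/eqP; rewrite ![ [set _; y''] ]setUC => /pair_eq e.
  by rewrite e ?eqxx // eq_sym in nyy'.
apply: (two_bowties_reducible Rsym Rfun S2 gS notcol minimal deg4 b1 b2 yy' y'x y'w yx' yw'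
  yy'' y'y'' y''x y''w y''x' y''w' (Th := set0)) => [|e v|col L pc L2].
- exact: sub0set.
- by rewrite inE.
set A0 := far_part _ _ _ _ _ _ _ _ _ _ _ _ _ in pc *.
have av e z : e = [set z; y''] -> z \in [:: y; y'] -> 2 < #|avail R A0 col e|.
  move=> eE zy.
  suff le1 : #|[set f in A0 | meets e f]| <= 1 by have := card_avail Rsym Rfun col le1.
  have sub : [set f in A0 | meets e f] \subset (star S y'' :\ t2) :\ t3.
    apply/subsetP => f; rewrite in_set => /andP[fA /meetsP[_ [v]]].
    have [fS ft _ yf y'f] := far_avoids fA.
    move: ft; rewrite !in_setD1 in_star fS !inE negb_or => /andP[-> ->].
    rewrite eE !inE => /orP[]/eqP-> //.
    by move: zy; rewrite !inE => /orP[]/eqP->; rewrite ?(negbTE yf) ?(negbTE y'f).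
  apply: leq_trans (subset_leq_card sub) _.
  move: deg3; rewrite (cardsD1 t2) i2 (cardsD1 t3 (_ :\ _)) in_setD1 eq_sym n23 i3.
  by rewrite !add1n !ltnS.
have av2 := av t2 y erefl (mem_head _ _).
have av3 : 2 < #|avail R A0 col t3| by apply: (av t3 y'); rewrite // !inE eqxx orbT.
have [k2 k2L k2ok] : exists2 k, k \in L & k \in avail R A0 col t2.
  have [|k kL ka] := @overlap4 L (avail R A0 col t2); last by exists k.
  by rewrite (leq_add L2 av2).
have [k3 k3ok /andP[k32 _]] := @pick_free _ R Rsym Rfun t3 _ [:: (t2, k2)] (ltnW av3).
exists (assign [:: (t2, k2); (t3, k3)] col); split.
- have -> : [set t2; t3] :|: set0 :|: A0 = [set e in unzip1 [:: (t2, k2); (t3, k3)]] :|: A0.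
    by apply/setP => e; rewrite in_setU [RHS]in_setU !inE orbF.
  apply: proper_assign => //=; first by rewrite inE in k2ok; rewrite inE in k3ok; rewrite k2ok k3ok.
  by rewrite !andbT; compatible_pair Rsym.
- move=> f fA; apply: assign_notin; rewrite !inE.
  by have [_ + _ _ _] := far_avoids fA; rewrite !inE.
- by rewrite /= /recolour eqxx.
Qed.

(** The third vertex lies in a triangle with an ear. Uncolouring that triangle
    as well frees [t2] and [t3] completely, and after [t2] the remaining edges
    can be coloured greedily, the two edges at the ear's other neighbour first. *)
Lemma ear_third_reducible w'' p'' : linked S y'' w'' -> linked S y'' p'' ->
  linked S w'' p'' -> (forall z, linked S w'' z -> z \in [:: y''; p'']) ->
  y != w'' -> y' != w'' -> y != p'' -> y' != p'' -> False.
Proof.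
move=> y''w'' y''p'' w''p'' sw'' nyw'' ny'w'' nyp'' ny'p''.
have nyy' := linked_neq S2 yy'.
have nyy'' := linked_neq S2 yy''; have ny'y'' := linked_neq S2 y'y''.
have ny''w'' := linked_neq S2 y''w''; have ny''p'' := linked_neq S2 y''p''.
have nw''p'' := linked_neq S2 w''p''.
pose E3 := [set y''; w'']; pose C3 := [set y''; p'']; pose F3 := [set w''; p''].
pose Th := [set E3; C3; F3].
have apart1 := third_apart b1 yy'' y''x y''w y''p'' sw'' nyw'' nyp''.
have apart2 := third_apart b2 y'y'' y''x' y''w' y''p'' sw'' ny'w'' ny'p''.
have ThS : Th \subset S.
  by apply/subsetP => e; rewrite !inE -orbA => /or3P[]/eqP->.
have Tv e v : e \in Th -> v \in e -> [\/ v = y'', v = w'' | v = p''].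
  by rewrite !inE -orbA => /or3P[]/eqP->; rewrite !inE => /orP[]/eqP->;
     do ?[by apply: Or31|by apply: Or32|by apply: Or33].
apply: (two_bowties_reducible Rsym Rfun S2 gS notcol minimal deg4 b1 b2 yy' y'x y'w yx' yw'
  yy'' y'y'' y''x y''w y''x' y''w' (Th := Th)) => // [e v eT v10|col L pc L2].
  apply/negP => /(Tv e v eT) ve.
  have [n1 n2 n3] : [/\ v != y'', v != w'' & v != p''].
    have : (v \in [:: y; w; x; q; p]) || (v \in [:: y'; w'; x'; q'; p']).
      by rewrite -mem_cat.
    by case/orP=> [/apart1|/apart2].
  by case: ve => e'; absurd_vertices.
have fP f := @far_avoids Th f.
set A0 := far_part _ _ _ _ _ _ _ _ _ _ _ _ _ in pc fP *.
have star'' f : f \in star S y'' -> f \in [:: t2; t3; E3; C3].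
  have ne a b : y'' != a -> a != b -> [set y''; a] != [set y''; b].
    by move=> ya ab; apply/eqP => /(pair_eq ya) e; rewrite e eqxx in ab.
  apply: star4 => //.
    rewrite /E3 /C3 ![ [set _; y''] ]setUC /= !inE !negb_or andbT.
    by rewrite !ne // eq_sym.
  move=> e; rewrite !in_cons in_nil orbF => /or4P[]/eqP->; rewrite in_star.
  - by rewrite -[_ \in S]/(linked S y y'') yy'' !inE eqxx orbT.
  - by rewrite -[_ \in S]/(linked S y' y'') y'y'' !inE eqxx orbT.
  - by rewrite -[_ \in S]/(linked S y'' w'') y''w'' !inE eqxx.
  - by rewrite -[_ \in S]/(linked S y'' p'') y''p'' !inE eqxx.
have ny'' f : f \in A0 -> y'' \notin f.
  move=> fA; have [fS ft fT _ _] := fP f fA; apply/negP => yf.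
  have := star'' f; rewrite in_star fS yf !in_cons in_nil orbF => /(_ isT).
  case/or4P=> /eqP fe; [case/negP: ft|case/negP: ft|case/negP: fT|case/negP: fT];
    by rewrite fe !inE eqxx ?orbT.
have nw'' f : f \in A0 -> w'' \notin f.
  move=> fA; have [fS ft fT _ _] := fP f fA; apply/negP => wf.
  have [z [wz fe lz]] := edge_at S2 fS wf.
  have := sw'' z lz; rewrite !inE => /orP[]/eqP ze; case/negP: fT.
    by rewrite fe ze setUC !inE eqxx.
  by rewrite fe ze !inE eqxx ?orbT.
have ny f : f \in A0 -> y \notin f by case/fP.
have ny' f : f \in A0 -> y' \notin f by case/fP.
have none u v k : (forall f, f \in A0 -> u \notin f) -> (forall f, f \in A0 -> v \notin f) ->
    ok R A0 col [set u; v] k.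
  by move=> nu nv; apply: ok_none => g z gA; rewrite !inE => /orP[]/eqP->; [apply: nu|apply: nv].
have A0S : A0 \subset S by apply/subsetP => f /fP[].
have at_p u f : (forall f, f \in A0 -> u \notin f) -> f \in A0 -> meets [set u; p''] f -> p'' \in f.
  move=> nu fA /meetsP[_ [z]]; rewrite !inE => /orP[]/eqP-> //.
  by rewrite (negbTE (nu f fA)).
have iC : C3 \in star S p'' by rewrite in_star -[_ \in S]/(linked S y'' p'') y''p'' !inE eqxx orbT.
have iF : F3 \in star S p'' by rewrite in_star -[_ \in S]/(linked S w'' p'') w''p'' !inE eqxx orbT.
have nCF : C3 != F3.
  apply/eqP; rewrite /C3 /F3 ![ [set _; p''] ]setUC => /pair_eq h.
  by rewrite h ?eqxx // eq_sym in ny''w''.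
have CA : C3 \notin A0 by apply/negP => /fP[_ _ + _ _]; rewrite !inE eqxx ?orbT.
have FA : F3 \notin A0 by apply/negP => /fP[_ _ + _ _]; rewrite !inE eqxx ?orbT.
have avC : 1 < #|avail R A0 col C3|.
  by apply: (card_avail_at Rsym Rfun deg4 col A0S _ iC iF nCF CA FA) => f; apply: at_p.
have avF : 1 < #|avail R A0 col F3|.
  by apply: (card_avail_at Rsym Rfun deg4 col A0S _ iC iF nCF CA FA) => f; apply: at_p.
have /card_gt0P[k2 k2L] : 0 < #|L| by apply: ltnW.
have [c cL /andP[c2 _]] := @pick_free _ R Rsym Rfun C3 _ [:: (t2, k2)] avC.
have [f fL /andP[fc _]] := @pick_free _ R Rsym Rfun F3 _ [:: (C3, c)] avF.
have c4 : #|[set: 'I_4]| = 4 by rewrite cardsT card_ord.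
have [|e _ /and4P[e2 ec ef _]] := @pick_free _ R Rsym Rfun E3 setT [:: (t2, k2); (C3, c); (F3, f)].
  by rewrite c4.
have [|k3 _ /and4P[k32 k3c k3e _]] := @pick_free _ R Rsym Rfun t3 setT [:: (t2, k2); (C3, c); (E3, e)].
  by rewrite c4.
rewrite /= in c2 fc e2 ec ef k32 k3c k3e.
pose s := [:: (t2, k2); (t3, k3); (E3, e); (C3, c); (F3, f)].
exists (assign s col); split.
- have -> : [set t2; t3] :|: Th :|: A0 = [set e in unzip1 s] :|: A0.
    rewrite /Th; clearbody A0; apply/setP => g; rewrite in_setU [RHS]in_setU; congr (_ || _).
    by rewrite !inE -!orbA.
  apply: proper_assign => //.
    rewrite inE in cL; rewrite inE in fL.
    by rewrite /= cL fL !none.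
  rewrite /= !andbT.
  repeat (apply/andP; split); compatible_pair Rsym.
- move=> g gA; apply: assign_notin; have [_ gt gT _ _] := fP g gA.
  by move: gt gT; rewrite !inE !negb_or -!andbA => /andP[-> ->].
- by rewrite /= /recolour eqxx.
Qed.

End ThirdVertex.

(** * Discharging *)

Section Neighbours.
Variable V : finType.
Implicit Types (E : {set {set V}}) (t : {set V}) (u v w : V).

Definition nbrs E v := [set u | linked E v u].

Lemma in_nbrs E v u : (u \in nbrs E v) = linked E v u.
Proof. by rewrite inE. Qed.

Lemma card_nbrs E v : two_sets E -> #|nbrs E v| = #|star E v|.
Proof.
move=> E2; have <- : [set [set v; u] | u in nbrs E v] = star E v.
  apply/setP => e; rewrite in_star; apply/imsetP/andP => [[u]|[eE ve]].
    by rewrite in_nbrs => vu ->; rewrite -[_ \in E]/(linked E v u) vu !inE eqxx.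
  by have [u [_ -> vu]] := edge_at E2 eE ve; exists u; rewrite ?in_nbrs.
rewrite card_in_imset // => u u'; rewrite !in_nbrs => vu _.
exact/pair_eq/(linked_neq E2).
Qed.

Lemma triangle_linked E t u v : t \in triangles E -> u \in t -> v \in t -> u != v ->
  linked E u v.
Proof.
rewrite inE => /andP[_ /subsetP tE] ut vt uv; apply: tE; exact: tedges_pair.
Qed.

Lemma triangle3 E t v : t \in triangles E -> v \in t -> #|t :\ v| = 2.
Proof. by rewrite inE => /andP[/eqP t3 _] vt; move: t3; rewrite (cardsD1 v) vt => -[]. Qed.

Lemma triangle_pair_uniq E t t' u v : two_sets E -> girth15 E ->
  t \in triangles E -> t' \in triangles E -> u != v ->
  u \in t -> v \in t -> u \in t' -> v \in t' -> t = t'.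
Proof.
move=> E2 gE tE t'E uv ut vt ut' vt'.
by apply: (triangle_edge_uniq E2 gE tE t'E (e := [set u; v])); apply: tedges_pair.
Qed.

Lemma set3_triangle E u v w : linked E u v -> linked E u w -> linked E v w ->
  two_sets E -> [set u; v; w] \in triangles E.
Proof.
move=> uv uw vw E2; have nuv := linked_neq E2 uv; have nuw := linked_neq E2 uw.
have nvw := linked_neq E2 vw.
rewrite inE -setUA cardsU1 cards2 nvw !inE negb_or nuv nuw /=.
apply/subsetP => e; rewrite inE => /andP[/cards2P[a [b [nab ->]]]].
rewrite subUset !sub1set !inE => /andP[].
case/or3P => /eqP ? /or3P[] /eqP ?; subst a b; rewrite ?eqxx // in nab *;
  by rewrite -[_ \in E]/(linked E _ _) // linkedC.
Qed.

End Neighbours.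

Section Discharging.
Variable V : finType.
Variable R : {set V} -> {set V} -> rel 'I_4.
Hypothesis Rsym : forall x y a b, R x y a b = R y x b a.
Hypothesis Rfun : forall x y a b b', R x y a b -> R x y a b' -> b = b'.
Variable S : {set {set V}}.
Hypotheses (S2 : two_sets S) (gS : girth15 S).
Hypothesis notcol : ~ colourable R S.
Hypothesis minimal : forall e, e \in S -> colourable R (S :\ e).
Hypothesis deg4 : forall v, #|star S v| <= 4.
Hypothesis sparse : forall E : {set {set V}}, E \subset S -> E != set0 ->
  13 * #|E| < 15 * #|cover E| + 12 * #|triangles E|.
Implicit Types (t : {set V}) (u v w x y z : V).

Notation N := (nbrs S).
Notation deg v := #|N v|.

Lemma deg_le4 v : deg v <= 4. Proof. by rewrite card_nbrs. Qed.

Lemma deg_sumN u v : linked S u v -> 6 <= deg u + deg v.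
Proof. by rewrite !card_nbrs //; apply: (deg_sum Rsym Rfun notcol minimal). Qed.

Definition ears := [set w | (deg w == 2) && [exists t in triangles S, w \in t]].
(** These vertices of degree two are in no triangle. *)
Definition lone := [set z | (deg z == 2) && (z \notin ears)].
Definition ear_nbrs v := N v :&: ears.
(** These are the centres of bow ties, see [centre_bowtie]. *)
Definition centres := [set x | (deg x == 4) && (#|ear_nbrs x| == 2)].
Definition core := [set v | (v \notin ears) && (0 < deg v)].
Definition ordinary := [set v in core | (v \notin lone) && (v \notin centres)].
Definition kernel := [set e in S | [disjoint e & ears]].

Lemma nbr_of_two u v : linked S u v -> deg v = 2 -> deg u = 4.
Proof.
move=> /deg_sumN + d2; rewrite d2 => le; apply/eqP.
by rewrite eqn_leq deg_le4 -(leq_add2r 2).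
Qed.

Lemma deg_ge2 v : 0 < deg v -> 1 < deg v.
Proof.
case/card_gt0P=> u; rewrite in_nbrs => /deg_sumN.
by have := deg_le4 u; lia.
Qed.

Lemma ears_deg w : w \in ears -> deg w = 2.
Proof. by rewrite inE => /andP[/eqP]. Qed.

Lemma ear_triangle w : w \in ears -> exists t, [/\ t \in triangles S, w \in t & t :\ w = N w].
Proof.
rewrite inE => /andP[/eqP d2 /existsP[t /andP[tS wt]]]; exists t; split=> //.
apply/eqP; rewrite eqEcard (triangle3 tS wt) d2 leqnn andbT.
apply/subsetP => u; rewrite in_setD1 in_nbrs => /andP[uw ut].
by apply: triangle_linked tS wt ut _; rewrite eq_sym.
Qed.

Lemma ear_nbr_deg v w : w \in ears -> linked S v w -> deg v = 4.
Proof. by move=> /ears_deg wd /nbr_of_two; apply. Qed.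

Lemma ear_nbr_notin v w : w \in ears -> linked S v w -> v \notin ears.
Proof. by move=> we vw; apply/negP => /ears_deg; rewrite (ear_nbr_deg we vw). Qed.

Lemma ear_third v w : w \in ears -> linked S v w ->
  exists y, [/\ linked S v y, linked S w y, v != y & N w = [set v; y]].
Proof.
move=> we vw; have [t [tS wt tN]] := ear_triangle we.
have vN : v \in N w by rewrite in_nbrs linkedC.
have := ears_deg we; rewrite (cardsD1 v) vN => -[]/eqP/cards1P[y yE].
have yN : y \in N w :\ v by rewrite yE set11.
move: (yN); rewrite in_setD1 in_nbrs => /andP[yv wy].
exists y; split=> //.
- have vt : v \in t by move: vN; rewrite -tN in_setD1 => /andP[].
  have yt : y \in t by move: yN; rewrite -tN !in_setD1 => /and3P[].
  by apply: triangle_linked tS vt yt _; rewrite eq_sym.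
- by rewrite eq_sym.
- by rewrite -(setD1K vN) yE.
Qed.

Definition triangles_at v := [set t in triangles S | v \in t].
Definition kernel_triangles_at v := [set t in triangles kernel | v \in t].

Lemma in_triangles_at t v : (t \in triangles_at v) = (t \in triangles S) && (v \in t).
Proof. by rewrite in_set. Qed.

Lemma in_kernel_triangles_at t v :
  (t \in kernel_triangles_at v) = (t \in triangles kernel) && (v \in t).
Proof. by rewrite in_set. Qed.

Lemma kernel_sub : kernel \subset S.
Proof. by apply/subsetP => e; rewrite inE => /andP[]. Qed.

Lemma kernel_triangle t : t \in triangles kernel -> t \in triangles S.
Proof. by rewrite !inE => /andP[-> h]; apply: subset_trans h kernel_sub. Qed.

Lemma kernel_linked u v : linked kernel u v = [&& linked S u v, u \notin ears & v \notin ears].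
Proof.
rewrite /linked [_ \in kernel]inE; congr (_ && _); rewrite disjoints_subset subUset !sub1set.
by rewrite !in_setC.
Qed.

Lemma kernel_triangle_ears t v : t \in triangles kernel -> v \in t -> v \notin ears.
Proof.
move=> tk vt; have := triangle3 tk vt => t2.
have /card_gt0P[u] : 0 < #|t :\ v| by rewrite t2.
rewrite in_setD1 => /andP[uv ut]; rewrite eq_sym in uv.
by have := triangle_linked tk vt ut uv; rewrite kernel_linked => /and3P[].
Qed.

Lemma triangle_deg t v : t \in triangles S -> v \in t -> 0 < deg v.
Proof.
move=> tS vt; have /card_gt0P[u] : 0 < #|t :\ v| by rewrite (triangle3 tS vt).
rewrite in_setD1 => /andP[uv ut]; apply/card_gt0P; exists u.
by rewrite in_nbrs (triangle_linked tS vt ut) // eq_sym.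
Qed.

Lemma lone_no_triangle t z : z \in lone -> t \in triangles S -> z \notin t.
Proof.
rewrite inE => /andP[d2 zn] tS; apply: contraNN zn => zt.
by rewrite inE d2; apply/existsP; exists t; rewrite tS.
Qed.

(** Triangles are edge-disjoint, so around [v] each one uses two neighbours
    of its own, none of which is a lone vertex of degree two. *)
Lemma triangles_at_bound v : #|N v :&: lone| + 2 * #|triangles_at v| <= deg v.
Proof.
have -> : 2 * #|triangles_at v| = \sum_(t in triangles_at v) \sum_(u in N v) (u \in t).
  rewrite mulnC -sum_nat_const; apply: eq_bigr => t; rewrite inE => /andP[tS vt].
  rewrite -(triangle3 tS vt) -sum1_card big_mkcond [RHS]big_mkcond; apply: eq_bigr => u _.
  rewrite in_setD1 in_nbrs; have [->|uv] := eqVneq u v.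
    by case: ifP => // /(linked_neq S2); rewrite eqxx.
  case: (boolP (u \in t)) => ut; last by case: ifP.
  by rewrite (triangle_linked tS vt ut) // eq_sym.
rewrite exchange_big -!sum1_card.
have -> : \sum_(u in N v :&: lone) 1 = \sum_(u in N v) (u \in lone).
  rewrite big_mkcond [RHS]big_mkcond; apply: eq_bigr => u _; rewrite in_setI.
  by case: (u \in N v); case: (u \in lone).
rewrite -big_split; apply: leq_sum => u; rewrite in_nbrs => vu /=.
have [ul|ul] := boolP (u \in lone).
  rewrite big1 // => t; rewrite inE => /andP[tS _].
  by rewrite (negbTE (lone_no_triangle ul tS)).
rewrite add0n -big_mkcondr sum1_card; apply/card_le1_eqP => t t' /andP[tv ut] /andP[t'v ut'].
move: tv t'v; rewrite !in_triangles_at => /andP[tS vt] /andP[t'S vt'].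
by apply: (triangle_pair_uniq S2 gS t'S tS (linked_neq S2 vu)).
Qed.

(** A triangle with an ear is not in the kernel, and it has only one ear since
    two adjacent vertices of degree two would violate [deg_sum]. *)
Lemma ear_triangles_bound v :
  #|kernel_triangles_at v| + #|ear_nbrs v| <= #|triangles_at v|.
Proof.
have -> : #|kernel_triangles_at v| = \sum_(t in triangles_at v) (t \in triangles kernel).
  rewrite -sum1_card big_mkcond [RHS]big_mkcond; apply: eq_bigr => t _.
  rewrite in_kernel_triangles_at in_triangles_at.
  case: (boolP (t \in triangles kernel)) => [/kernel_triangle->//|_].
  by case: ifP.
have le : #|ear_nbrs v| <= \sum_(t in triangles_at v) \sum_(w in ear_nbrs v) (w \in t).
  rewrite exchange_big -sum1_card; apply: leq_sum => w.
  rewrite in_setI in_nbrs => /andP[vw we].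
  have [t [tS wt tN]] := ear_triangle we.
  have vt : v \in t.
    have : v \in t :\ w by rewrite tN in_nbrs linkedC.
    by rewrite in_setD1 => /andP[].
  by rewrite (bigD1 t) ?in_triangles_at ?tS //= wt.
apply: leq_trans (leq_add (leqnn _) le) _; rewrite -big_split -sum1_card.
apply: leq_sum => t; rewrite in_triangles_at => /andP[tS vt] /=.
have [tk|tk] := boolP (t \in triangles kernel).
  rewrite big1 // => w; rewrite in_setI => /andP[_ we].
  by case: (boolP (w \in t)) => // /(kernel_triangle_ears tk); rewrite we.
rewrite add0n -big_mkcondr sum1_card; apply/card_le1_eqP => w w' /andP[+ wt] /andP[+ w't].
rewrite !in_setI => /andP[_ we] /andP[_ w'e]; apply/eqP/negPn/negP => nww'.
have := deg_sumN (triangle_linked tS w't wt nww').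
by rewrite !ears_deg.
Qed.

Lemma local_bound v : #|N v :&: lone| + 2 * (#|kernel_triangles_at v| + #|ear_nbrs v|) <= deg v.
Proof.
apply: leq_trans (triangles_at_bound v); rewrite leq_add2l leq_mul2l /=.
exact: ear_triangles_bound.
Qed.

(** The two ears of a centre lie in two different triangles, since a shared
    third vertex would close a cycle of length four. *)
Lemma centre_bowtie x : x \in centres -> exists y w q p, bowtie S y w x q p.
Proof.
rewrite inE => /andP[/eqP d4 /eqP/eqP/cards2P[w [q [nwq wqE]]]].
have : w \in ear_nbrs x by rewrite wqE !inE eqxx.
have : q \in ear_nbrs x by rewrite wqE !inE eqxx orbT.
rewrite !in_setI !in_nbrs => /andP[xq qe] /andP[xw we].
have [y [xy wy nxy Nw]] := ear_third we xw.
have [p [xp qp nxp Nq]] := ear_third qe xq.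
have dw := ears_deg we; have dq := ears_deg qe.
have yd : deg y = 4 by apply: (ear_nbr_deg we); rewrite linkedC.
have pd : deg p = 4 by apply: (ear_nbr_deg qe); rewrite linkedC.
have nyw := linked_neq S2 wy; have nqp := linked_neq S2 qp.
have nxw := linked_neq S2 xw; have nxq := linked_neq S2 xq.
have nyp : y != p.
  apply/eqP => yp; apply: (@no_four_cycle V S S2 gS x w y q) => //.
  - by rewrite yp linkedC.
  - by rewrite linkedC.
have nyq : y != q by apply/eqP => yq; move: dq; rewrite -yq yd.
have nwp : w != p by apply/eqP => wp; move: dw; rewrite wp pd.
have star2 u a b : u != a -> u != b -> a != b -> N u = [set a; b] ->
    star S u = [set [set u; a]; [set u; b]].
  move=> ua ub ab Nu; apply/eqP; rewrite eq_sym eqEcard -card_nbrs // Nu !cards2 ab.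
  apply/andP; split; last first.
    by have -> : [set u; a] != [set u; b]; [apply/eqP => /(pair_eq ua) e; rewrite e eqxx in ab|].
  have ua' : linked S u a by rewrite -in_nbrs Nu !inE eqxx.
  have ub' : linked S u b by rewrite -in_nbrs Nu !inE eqxx orbT.
  apply/subsetP => e; rewrite !inE => /orP[]/eqP->; rewrite !inE eqxx andbT //.
exists y, w, q, p; split.
- by rewrite /= !inE !negb_or [y == w]eq_sym nyw [y == x]eq_sym nxy nyq nyp [w == x]eq_sym nxw nwq nwp nxq nxp nqp.
- apply/setP => e; apply/idP/idP.
    have ne a b : x != a -> a != b -> [set x; a] != [set x; b].
      by move=> ya ab; apply/eqP => /(pair_eq ya) h; rewrite h eqxx in ab.
    move=> ex; have := star4 deg4 (z := x) (e1 := [set x; y]) (e2 := [set x; w])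
      (e3 := [set x; q]) (e4 := [set x; p]) _ _ ex.
    rewrite !in_cons in_nil orbF => h; rewrite !inE -!orbA; apply: h.
      by rewrite /= !inE !negb_or !ne // eq_sym.
    move=> f; rewrite !in_cons in_nil orbF => /or4P[]/eqP->; rewrite in_star !inE eqxx andbT.
    + exact: xy. + exact: xw. + exact: xq. + exact: xp.
  rewrite !inE -!orbA => /or4P[]/eqP->; rewrite !inE eqxx andbT.
  + exact: xy. + exact: xw. + exact: xq. + exact: xp.
- by apply: star2 => //; rewrite eq_sym.
- by apply: star2 => //; rewrite eq_sym.
Qed.

Lemma bowtie_ears y w x q p : bowtie S y w x q p -> w \in ears /\ q \in ears.
Proof.
move=> b1; have [w2 q2] := bowtie_deg b1.
have [xy xw wy [xq [xp qp]]] := bowtie_linked b1.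
have ear v t : deg v = 2 -> t \in triangles S -> v \in t -> v \in ears.
  by move=> d2 tS vt; rewrite inE d2; apply/existsP; exists t; rewrite tS.
split.
  apply: (ear w [set x; w; y]); rewrite ?card_nbrs //; last by rewrite !inE eqxx orbT.
  exact: set3_triangle.
apply: (ear q [set x; q; p]); rewrite ?card_nbrs //; last by rewrite !inE eqxx orbT.
exact: set3_triangle.
Qed.

(** The ears are excluded, so [v] is one of the two ends; reflect the bow tie if
    it is the far one. *)
Lemma centre_across v x : x \in centres -> linked S v x -> v \notin ears ->
  exists w q p, bowtie S v w x q p.
Proof.
move=> /centre_bowtie[y [w [q [p b1]]]] vx ve; have [we qe] := bowtie_ears b1.
have := bowtie_nbr S2 b1 (z := v); rewrite linkedC vx => /(_ isT).
rewrite !inE => /or4P[]/eqP e; last by subst v; exists q, w, y; apply: bowtieC.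
- by subst v; exists w, q, p.
- by rewrite e we in ve.
- by rewrite e qe in ve.
Qed.

(** Each centre next to [v] determines the ear of its triangle with [v], and
    that ear determines the centre as its second neighbour. *)
Lemma centres_bound v : v \notin ears -> #|N v :&: centres| <= #|ear_nbrs v|.
Proof.
move=> ve; pose f x := odflt v [pick w in ear_nbrs v | linked S x w].
have fP x : x \in N v :&: centres -> (f x \in ear_nbrs v) && linked S x (f x).
  rewrite in_setI in_nbrs => /andP[vx xc]; rewrite /f; case: pickP => // none.
  have [w [q [p b1]]] := centre_across xc vx ve; have [we _] := bowtie_ears b1.
  have [_ xw wv _] := bowtie_linked b1.
  by have := none w; rewrite in_setI in_nbrs linkedC wv we xw.
rewrite -(card_in_imset (f := f)).
  by apply/subset_leq_card/subsetP => w /imsetP[x /fP/andP[? _] ->].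
move=> x x' xN x'N e; have /andP[fx xf] := fP x xN; have /andP[_ x'f] := fP x' x'N.
rewrite -e in x'f; move: fx; rewrite in_setI in_nbrs => /andP[vf fe].
have [y [_ _ _ Nf]] := ear_third fe vf.
have z z0 : z0 \in N v :&: centres -> linked S z0 (f x) -> z0 = y.
  rewrite in_setI in_nbrs => /andP[vz _] zf.
  have : z0 \in N (f x) by rewrite in_nbrs linkedC.
  rewrite Nf !inE => /orP[]/eqP // zv.
  by have := linked_neq S2 vz; rewrite zv eqxx.
by rewrite (z x) // (z x').
Qed.

Definition kdeg v := #|N v :\: ears|.
Definition ktri v := #|kernel_triangles_at v|.
(** An ordinary vertex of kernel degree three that serves a centre. If it lies
    in a kernel triangle, it is left with charge -1. *)
Definition demanding v := (kdeg v == 3) && (0 < #|N v :&: centres|).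
(** What an ordinary vertex can contribute to each kernel triangle at it. *)
Definition wealth v := if kdeg v == 4 then 3 else (~~ demanding v : nat).

Lemma kdegE v : kdeg v + #|ear_nbrs v| = deg v.
Proof. by rewrite addnC cardsID. Qed.

(** The charge [13 kdeg v - 8 ktri v - 30] of a lone vertex or a centre is -4.
    An ordinary vertex gives 2 to each neighbour of these kinds. What it
    keeps is at least [wealth v] per triangle, or -1 per triangle when [v] is
    demanding. The cases are those of the degree and of the number of ears next
    to [v], with [local_bound] limiting triangles and lone neighbours. *)
Lemma vertex_charge v : v \in core ->
  30 + 8 * ktri v + (if v \in ordinary then 2 * #|N v :&: lone| + 2 * #|N v :&: centres| else 0)
    + ktri v * wealth v
  <= 13 * kdeg v + 4 * (v \in lone) + 4 * (v \in centres) + ktri v * demanding v.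
Proof.
move=> vc; have := local_bound v; rewrite -/(ktri v).
move: (vc); rewrite inE => /andP[ve dv]; have cb := centres_bound ve.
have kd := kdegE v; have d1 := deg_ge2 dv; have d4 := deg_le4 v.
have small : deg v < 4 -> #|ear_nbrs v| = 0 /\ #|N v :&: lone| = 0.
  move=> lt; split; apply/eqP; rewrite cards_eq0 -subset0; apply/subsetP => u.
    rewrite in_setI in_nbrs => /andP[vu ue].
    by move: lt; rewrite (ear_nbr_deg ue vu).
  rewrite in_setI in_nbrs inE => /andP[vu /andP[/eqP d2 _]].
  by move: lt; rewrite (nbr_of_two vu d2).
have lE : (v \in lone) = (deg v == 2) by rewrite inE ve andbT.
have cE : (v \in centres) = (deg v == 4) && (#|ear_nbrs v| == 2) by rewrite inE.
have oE : (v \in ordinary) = (v \notin lone) && (v \notin centres) by rewrite inE vc.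
have tl : deg v = 2 -> ktri v = 0.
  move=> d2; apply/eqP; rewrite cards_eq0 -subset0; apply/subsetP => t.
  rewrite in_kernel_triangles_at => /andP[/kernel_triangle tS vt].
  have vl : v \in lone by rewrite lE d2.
  by have := lone_no_triangle vl tS; rewrite vt.
rewrite oE lE cE /wealth /demanding.
move: (kdeg v) (ktri v) #|ear_nbrs v| #|N v :&: lone| #|N v :&: centres| (deg v) small tl kd d1 d4 cb.
clear => k t e l c d small tl kd d1 d4 cb lb.
have [d2|[d3|d4']] : d = 2 \/ (d = 3 \/ d = 4) by lia.
- have [|e0 l0] := small; first by rewrite d2.
  have t0 := tl d2. have c0 : c = 0 by lia. have k2 : k = 2 by lia.
  by subst.
- have [|e0 l0] := small; first by rewrite d3.
  have c0 : c = 0 by lia. have k3 : k = 3 by lia.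
  by subst; rewrite /=; lia.
- have [e2|[e1|e0]] : e = 2 \/ (e = 1 \/ e = 0) by lia.
  + have t0 : t = 0 by lia. have k2 : k = 2 by lia.
    by subst.
  + have k3 : k = 3 by lia.
    by subst; rewrite /=; case: c cb => [|[]] //=; lia.
  + have k4 : k = 4 by lia. have c0 : c = 0 by lia.
    by subst; rewrite /=; lia.
Qed.

Lemma centre_no_triangle x t : x \in centres -> t \in triangles kernel -> x \notin t.
Proof.
rewrite inE => /andP[/eqP d4 /eqP e2] tk; apply/negP => xt.
have : 0 < #|kernel_triangles_at x|.
  by apply/card_gt0P; exists t; rewrite in_kernel_triangles_at tk.
by have := local_bound x; rewrite d4 e2; lia.
Qed.

Lemma demanding_bowtie y t : demanding y -> t \in triangles kernel -> y \in t ->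
  exists w x q p, [/\ bowtie S y w x q p, x \notin t & w \notin t].
Proof.
case/andP=> _ /card_gt0P[x]; rewrite in_setI in_nbrs => /andP[yx xc] tk yt.
have [w [q [p b1]]] := centre_across xc yx (kernel_triangle_ears tk yt).
exists w, x, q, p; split=> //; first exact: centre_no_triangle tk.
by have [we _] := bowtie_ears b1; apply: contraL we; apply: kernel_triangle_ears.
Qed.

(** A corner of kernel degree four is wealthy enough for two demanding ones.
    If all corners have kernel degree three then, by reducibility, at most one
    is demanding, and the other two have wealth one. *)
Lemma triangle_balance t : t \in triangles kernel ->
  \sum_(v in t) demanding v <= \sum_(v in t) wealth v.
Proof.
move=> tk; have tS := kernel_triangle tk.
have /eqP t3 : #|t| == 3 by move: tk; rewrite inE => /andP[].
have [/existsP[v /andP[vt /eqP k4]]|] := boolP [exists v in t, kdeg v == 4].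
  rewrite (bigD1 v) //= [leqRHS](bigD1 v) //= /demanding /wealth k4 /= add0n.
  apply: leq_trans (_ : 2 <= _); last by apply: leq_trans (leq_addr _ _).
  rewrite -(triangle3 tk vt) -sum1_card big_mkcond [leqRHS]big_mkcond; apply: leq_sum => u _.
  by rewrite in_setD1 andbC; case: ifP => // _; case: (_ && _).
rewrite negb_exists_in => /forall_inP no4.
have wE v : v \in t -> wealth v = ~~ demanding v by move=> /no4/negbTE; rewrite /wealth => ->.
rewrite [leqRHS](eq_bigr _ wE).
suff le1 : \sum_(v in t) demanding v <= 1.
  have : \sum_(v in t) demanding v + \sum_(v in t) ~~ demanding v = 3.
    rewrite -big_split -[RHS]t3 -sum1_card; apply: eq_bigr => v _.
    by case: (demanding v).
  by move: le1; lia.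
rewrite -big_mkcondr sum1_card; apply/card_le1_eqP => y y' /andP[yt dy] /andP[y't dy'].
apply/eqP/negPn/negP => nyy'; rewrite eq_sym in nyy'.
have lS u v : u \in t -> v \in t -> u != v -> linked S u v by apply: triangle_linked.
have neq u v : u \in t -> v \notin t -> u != v by move=> ut; apply: contraNneq => <-.
have [w [x [q [p [b1 xt wt]]]]] := demanding_bowtie dy tk yt.
have [w' [x' [q' [p' [b2 x't w't]]]]] := demanding_bowtie dy' tk y't.
have /card_gt0P[y''] : 0 < #|(t :\ y) :\ y'|.
  have := triangle3 tk yt; rewrite (cardsD1 y') in_setD1 y't andbT.
  by rewrite [y' == y]eq_sym nyy' add1n => -[->].
rewrite !in_setD1 => /and3P[n'' n' y''t].
rewrite eq_sym in n''; rewrite eq_sym in n'.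
have yy' := lS y y' yt y't nyy'; have yy'' := lS y y'' yt y''t n'.
have y'y'' := lS y' y'' y't y''t n''.
have y''e := kernel_triangle_ears tk y''t.
have [d3|] := leqP #|star S y''| 3.
  exact: (small_third_reducible Rsym Rfun S2 gS notcol minimal deg4 b1 b2 yy'
    (neq _ _ y't xt) (neq _ _ y't wt) (neq _ _ yt x't) (neq _ _ yt w't) yy'' y'y''
    (neq _ _ y''t xt) (neq _ _ y''t wt) (neq _ _ y''t x't) (neq _ _ y''t w't) d3).
rewrite -card_nbrs // => d4.
have /card_gt0P[w''] : 0 < #|ear_nbrs y''|.
  rewrite lt0n; apply: contra (no4 y'' y''t) => /eqP e0.
  by have := kdegE y''; rewrite e0 addn0 => ->; rewrite eqn_leq deg_le4.
rewrite in_setI in_nbrs => /andP[y''w'' w''e].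
have [p'' [y''p'' w''p'' ny''p'' Nw'']] := ear_third w''e y''w''.
have np u : u \in t -> u != y'' -> u != p''.
  move=> ut nu; apply/eqP => up; subst p''.
  have t2 := set3_triangle y''w'' y''p'' w''p'' S2.
  have w''t : w'' \in t.
    have -> : t = [set y''; w''; u].
      by apply: (triangle_pair_uniq S2 gS tS t2 ny''p'') => //; rewrite !inE eqxx ?orbT.
    by rewrite !inE eqxx orbT.
  by have := kernel_triangle_ears tk w''t; rewrite w''e.
have nw u : u \in t -> u != w''.
  by move=> ut; apply: contraTneq w''e => <-; apply: kernel_triangle_ears tk ut.
apply: (ear_third_reducible Rsym Rfun S2 gS notcol minimal deg4 b1 b2 yy'
    (neq _ _ y't xt) (neq _ _ y't wt) (neq _ _ yt x't) (neq _ _ yt w't) yy'' y'y''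
    (neq _ _ y''t xt) (neq _ _ y''t wt) (neq _ _ y''t x't) (neq _ _ y''t w't)
    y''w'' y''p'' w''p'').
- by move=> z; rewrite -in_nbrs Nw'' !inE.
- exact: nw. - exact: nw. - exact: np. - exact: np.
Qed.

(** Counting pairs: the vertices of [Z] receive 2 from each ordinary
    neighbour, at least 4 in total. *)
Lemma double_count (Z : {set V}) : (forall z, z \in Z -> 2 <= #|N z :&: ordinary|) ->
  2 * #|Z| <= \sum_(v in ordinary) #|N v :&: Z|.
Proof.
move=> h; rewrite mulnC -sum_nat_const.
have cI (A B : {set V}) : #|A :&: B| = \sum_(v in A) (v \in B).
  by rewrite -sum1_card big_mkcond [RHS]big_mkcond; apply: eq_bigr => v _;
     rewrite in_setI; case: (v \in A); case: (v \in B).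
under [leqRHS]eq_bigr => v _ do rewrite setIC cI.
rewrite exchange_big /=; apply: leq_sum => z zZ; apply: leq_trans (h z zZ) _.
by rewrite setIC cI; apply: leq_sum => v _; rewrite !in_nbrs linkedC.
Qed.

Lemma bowtie_ordinary y w x q p : bowtie S y w x q p -> y \in ordinary.
Proof.
move=> b1; have [we _] := bowtie_ears b1; have [xy _ wy _] := bowtie_linked b1.
have yw : linked S y w by rewrite linkedC.
have d4 := ear_nbr_deg we yw; have yne := ear_nbr_notin we yw.
have yc : y \in core by rewrite inE yne d4.
rewrite inE yc inE yne andbT d4 /=; apply/negP => yce.
have [y1 [w1 [q1 [p1 b2]]]] := centre_bowtie yce.
exact: (bowties_not_adjacent Rsym Rfun S2 gS notcol minimal deg4 b1 b2 xy).
Qed.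

Lemma two_in (A : {set V}) u v : u \in A -> v \in A -> u != v -> 2 <= #|A|.
Proof. by move=> uA vA uv; apply/card_gt1P; exists u, v. Qed.

Lemma centre_ordinary x : x \in centres -> 2 <= #|N x :&: ordinary|.
Proof.
move=> /centre_bowtie[y [w [q [p b1]]]].
have [xy _ _ [_ [xp _]]] := bowtie_linked b1.
apply: (two_in (u := y) (v := p)); rewrite ?in_setI ?in_nbrs ?xy ?xp /=.
- exact: bowtie_ordinary b1.
- exact: bowtie_ordinary (bowtieC b1).
by have [+ _ _ _] := b1; rewrite /= !inE !negb_or => /and5P[/and4P[]].
Qed.

Lemma lone_ordinary z : z \in lone -> 2 <= #|N z :&: ordinary|.
Proof.
rewrite inE => /andP[/eqP d2 ze]; rewrite -d2; apply/subset_leq_card/subsetP => v.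
rewrite in_nbrs in_setI in_nbrs => zv; rewrite zv /=.
have vz : linked S v z by rewrite linkedC.
have d4 := nbr_of_two vz d2.
have vne : v \notin ears by apply/negP => /ears_deg; rewrite d4.
have vc : v \in core by rewrite inE vne d4.
rewrite inE vc inE vne andbT d4 /=; apply/negP => vce.
have [w [q [p b1]]] := centre_across vce zv ze.
have [we _] := bowtie_ears b1; have [_ _ wz _] := bowtie_linked b1.
by move: d2; rewrite (ear_nbr_deg we) // linkedC.
Qed.

Lemma kernel_neq0 : kernel != set0.
Proof.
have edge u v : linked S u v -> u \notin ears -> v \notin ears -> kernel != set0.
  move=> uv ue ve; apply/set0Pn; exists [set u; v].
  by rewrite -[_ \in _]/(linked kernel u v) kernel_linked uv ue.
have ear w v : w \in ears -> linked S v w -> kernel != set0.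
  move=> we vw; have [y [vy wy _ _]] := ear_third we vw.
  apply: (edge v y vy); first exact: ear_nbr_notin vw.
  by apply: (ear_nbr_notin we); rewrite linkedC.
have [S0|/set0Pn[e eS]] := eqVneq S set0.
  by case: notcol; exists (fun=> ord0) => e f; rewrite S0 inE.
have /eqP/cards2P[u [v [nuv eE]]] := S2 eS.
have uv : linked S u v by rewrite /linked -eE.
have [ue|ue] := boolP (u \in ears); first by apply: (ear u v); rewrite // linkedC.
have [ve|ve] := boolP (v \in ears); first exact: (ear v u).
exact: edge uv ue ve.
Qed.

Lemma sum_kdeg : \sum_(v in core) kdeg v = #|kernel|.*2.
Proof.
rewrite -(sum_star (sub_two_sets kernel_sub S2)) [LHS]big_mkcond; apply: eq_bigr => v _.
rewrite -(card_nbrs v (sub_two_sets kernel_sub S2)) inE.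
case: (boolP (v \in ears)) => ve /=.
  apply/esym/eqP; rewrite cards_eq0 -subset0; apply/subsetP => u.
  by rewrite in_nbrs kernel_linked ve /= andbF.
have -> : nbrs kernel v = N v :\: ears.
  by apply/setP => u; rewrite in_nbrs kernel_linked ve in_setD in_nbrs andbC.
case: (posnP (deg v)) => // /eqP; rewrite cards_eq0 => /eqP ->.
by rewrite set0D cards0.
Qed.

Lemma sum_ktri f : \sum_(v in core) ktri v * f v =
  \sum_(t in triangles kernel) \sum_(v in t) f v.
Proof.
under [RHS]eq_bigr => t _ do rewrite big_mkcond.
rewrite exchange_big /= big_mkcond /=; apply: eq_bigr => v _.
rewrite -big_mkcondr sum_nat_const.
have -> : ktri v = #|[pred t | (t \in triangles kernel) && (v \in t)]|.
  by apply: eq_card => t; exact: in_kernel_triangles_at.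
case: ifP => // /negbT vc; rewrite eq_card0 // => t.
rewrite [LHS](_ : _ = (t \in triangles kernel) && (v \in t)) //.
apply: contraNF vc => /andP[tk vt]; rewrite inE (kernel_triangle_ears tk vt).
exact: triangle_deg (kernel_triangle tk) vt.
Qed.

Lemma cover_kernel : cover kernel \subset core.
Proof.
apply/bigcupsP => e ek; apply/subsetP => v ve.
have [u [_ _ vu]] := edge_at (sub_two_sets kernel_sub S2) ek ve.
move: vu; rewrite kernel_linked => /and3P[vu vn _]; rewrite inE vn.
by apply/card_gt0P; exists u; rewrite in_nbrs.
Qed.

Theorem no_critical : False.
Proof.
have sp := sparse kernel_sub kernel_neq0.
have cov := subset_leq_card cover_kernel.
pose served v := if v \in ordinary then 2 * #|N v :&: lone| + 2 * #|N v :&: centres| else 0.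
have ch : 30 * #|core| + 8 * (\sum_(v in core) ktri v) + \sum_(v in core) served v
      + \sum_(v in core) ktri v * wealth v
    <= 13 * (\sum_(v in core) kdeg v) + 4 * (\sum_(v in core) (v \in lone))
      + 4 * (\sum_(v in core) (v \in centres)) + \sum_(v in core) ktri v * demanding v.
  rewrite [30 * _]mulnC -sum_nat_const !big_distrr -!big_split.
  by apply: leq_sum => v; apply: vertex_charge.
have bal : \sum_(v in core) ktri v * demanding v <= \sum_(v in core) ktri v * wealth v.
  by rewrite !sum_ktri; apply: leq_sum => t; apply: triangle_balance.
have dl := double_count lone_ordinary; have dc := double_count centre_ordinary.
have T3 : \sum_(v in core) ktri v = 3 * #|triangles kernel|.
  under eq_bigr => v _ do rewrite -[ktri v]muln1.
  rewrite (sum_ktri (fun=> 1)) mulnC -sum_nat_const; apply: eq_bigr => t.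
  by rewrite inE sum1_card => /andP[/eqP].
have sv : \sum_(v in core) served v =
    2 * \sum_(v in ordinary) #|N v :&: lone| + 2 * \sum_(v in ordinary) #|N v :&: centres|.
  rewrite !big_distrr -big_split -big_mkcondr; apply: eq_bigl => v.
  by rewrite [X in _ && X]in_set [RHS]in_set; case: (v \in core).
move: ch; rewrite sv sum_kdeg T3.
have cardI (A : {set V}) : \sum_(v in core) (v \in A) <= #|A|.
  rewrite -sum1_card big_mkcond [leqRHS]big_mkcond; apply: leq_sum => v _.
  by case: (v \in core); case: (v \in A).
have cl := cardI lone; have cc := cardI centres.
move: sp cov bal dl dc cl cc; clear.
move: #|kernel| #|cover kernel| #|triangles kernel| #|core| #|lone| #|centres|.
move: (\sum_(v in core) ktri v * demanding v) (\sum_(v in core) ktri v * wealth v).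
move: (\sum_(v in ordinary) #|N v :&: lone|) (\sum_(v in ordinary) #|N v :&: centres|).
move: (\sum_(v in core) (v \in lone)) (\sum_(v in core) (v \in centres)); lia.
Qed.

End Discharging.

(** * Line graphs and group colourings *)

Lemma linked_edges (G : sgraph) (x y : G) : linked (edges G) x y = adj x y.
Proof.
apply/idP/idP => [/edgesP[u [v [uv]]]|xy]; last by apply/edgesP; exists x, y.
have nuv : u != v by apply: contraTneq uv => ->; rewrite adj_irrefl.
move=> e; have : u \in [set x; y]%SET by rewrite e !inE eqxx.
have : v \in [set x; y]%SET by rewrite e !inE eqxx orbT.
rewrite !inE => /orP[]/eqP ? /orP[]/eqP ?; subst u v; rewrite ?eqxx // in nuv *.
by rewrite adj_sym.
Qed.

Section Upper.
Variables (K : realType) (G : sgraph).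
Hypotheses (planarG : planar K G) (deltaG : max_degree G = 4).
Hypothesis no_cycles : forall i : nat, 4 <= i <= 14 -> ~ has_cycle_of_length G i.

Lemma edges_girth15 : girth15 (edges G).
Proof.
move=> s /andP[cs us] s3; rewrite ltnNge; apply/negP => s14.
case: (no_cycles (i := size s)); first by rewrite s3.
exists s; split=> //; rewrite /ucycle us andbT.
by rewrite -(eq_cycle (e := linked (edges G))) // => x y; rewrite linked_edges.
Qed.

Lemma star_edges_le4 (E : {set {set G}}) v : E \subset edges G -> #|star E v| <= 4.
Proof.
move=> subE; rewrite -deltaG; apply: leq_trans (_ : degree v <= _); last first.
  exact: (leq_bigmax v).
have -> : degree v = #|star (edges G) v|.
  rewrite -card_nbrs; last exact: edges_two_sets.
  by apply: eq_card => u; rewrite !inE linked_edges.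
apply/subset_leq_card/subsetP => e; rewrite !in_star => /andP[eE ->].
by rewrite (subsetP subE).
Qed.

(** A smallest uncolourable subset of the edges would be critical, and all the
    assumptions pass to subsets. *)
Theorem edges_colourable (R : {set G} -> {set G} -> rel 'I_4) :
  (forall x y a b, R x y a b = R y x b a) ->
  (forall x y a b b', R x y a b -> R x y a b' -> b = b') ->
  colourable R (edges G).
Proof.
move=> Rsym Rfun.
suff H n (E : {set {set G}}) : #|E| < n -> E \subset edges G -> colourable R E.
  exact: (H #|edges G|.+1).
elim: n E => // n IH E En subE.
apply: contrapT => nc.
have E2 := sub_two_sets subE (@edges_two_sets G).
have gE := sub_girth15 subE edges_girth15.
apply: (no_critical Rsym Rfun E2 gE nc).
- move=> e eE; apply: IH; last exact: subset_trans (subsetDl _ _) subE.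
  by move: En; rewrite (cardsD1 e) eE.
- by move=> v; apply: star_edges_le4.
- move=> F FE F0; have subF := subset_trans FE subE.
  exact: planar_sparse planarG subF F0 (sub_girth15 FE gE).
Qed.

(** Numbering each list by ['I_4] turns the forbidden differences into a
    conflict relation; it is functional because a difference and one of its
    terms determine the other term. *)
Theorem line_graph_choosable : group_choosable (line_graph G) 4.
Proof.
move=> A L _ hL f; set H := line_graph G.
have enumL (e : edge G) : exists l : 'I_4 -> A, injective l /\ forall i, L e (l i).
  have /card_set_bijP[g [gfun ginj gsur]] := hL e.
  have pre (i : 'I_4) : exists a, L e a /\ g a = i.
    by have [a La ga] := gsur i (ltn_ord i); exists a.
  have [l lP] := choice pre.
  exists l; split=> [i j lij|i]; last by case: (lP i).
  by apply: val_inj; rewrite /= -(lP i).2 -(lP j).2 lij.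
have [lam lamP] := choice enumL.
pose D : rel H := @std_orientation H.
pose clash (u v : edge G) (a b : 'I_4) := exists2 e : edge H, val e = [set (u : H); v]%SET &
  (D u v /\ (lam u a - lam v b = f e)%R) \/ (D v u /\ (lam v b - lam u a = f e)%R).
pose R (x y : {set G}) (a b : 'I_4) :=
  `[< exists u v : edge G, [/\ val u = x, val v = y & clash u v a b] >].
have clashC u v a b : clash u v a b -> clash v u b a.
  by case=> e ve h; exists e; [rewrite ve finset.setUC | case: h; [right|left]].
have Rsym x y a b : R x y a b = R y x b a.
  by apply/asboolP/asboolP => -[u [v [ux vy /clashC c]]]; exists v, u.
have Dasym (u v : H) : D u v -> D v u -> False.
  by move=> /andP[_ l1] /andP[_ l2]; have := ltn_trans l1 l2; rewrite ltnn.
have Rfun x y a b b' : R x y a b -> R x y a b' -> b = b'.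
  move=> /asboolP[u [v [ux vy [e ve h]]]] /asboolP[u' [v' [u'x v'y [e' ve' h']]]].
  have uu : u' = u by apply: val_inj; rewrite u'x.
  have vv : v' = v by apply: val_inj; rewrite v'y.
  subst u' v'; have ee : e' = e by apply: val_inj; rewrite ve ve'.
  subst e'; apply: (lamP v).1.
  case: h h' => -[d1 h1] [] [d2 h2]; try by case: (Dasym _ _ d1 d2).
    by have := etrans h1 (esym h2); move/addrI/oppr_inj.
  by have := etrans h1 (esym h2); move/addIr.
have [col pc] := edges_colourable Rsym Rfun.
exists (fun v : H => lam v (col (val (v : edge G)))); split=> [v|e x y exy Dxy clsh].
  exact: (lamP v).2.
have adjxy : line_adj x y by case/andP: Dxy.
have := pc (val (x : edge G)) (val (y : edge G)) (valP (x : edge G)) (valP (y : edge G)).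
case/andP: adjxy => nxy mxy; rewrite /meets.
rewrite (inj_eq val_inj) nxy mxy => /(_ isT)/asboolP; apply.
by exists x, y; split=> //; exists e => //; left.
Qed.

End Upper.

(** With constant lists [0, ..., j - 1] and zero shifts the edges at [x] get
    different colours. *)
Theorem choosable_ge_max_degree (G : sgraph) (x : G) j :
  group_choosable (line_graph G) j -> degree x <= j.
Proof.
pose H := line_graph G.
move=> ch; pose L (v : H) : set int := (Posz @` `I_j)%classic.
have cI : ((Posz @` `I_j)%classic #= `I_j)%card by apply: inj_card_eq => a b _ _ [].
have large : (`I_j #<= [set: int])%card by rewrite -(card_le_eql cI); exact: card_leT.
have [c [cLv cne]] := ch int L large (fun=> cI) (fun=> 0%R).
(* [h] is only used at neighbours of [x], where [insub] succeeds. *)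
pose h y := if insub [set x; y]%SET is Some e then `|c (e : edge G)|%N else 0%N.
have cH (e : edge G) : exists2 k, k < j & c e = Posz k.
  by have [k kj <-] := cLv e; exists k.
have he y : adj x y -> exists2 e : edge G, val e = [set x; y]%SET & h y = `|c e|%N.
  move=> xy; have exy : [set x; y]%SET \in edges G by apply/edgesP; exists x, y.
  by rewrite /h; case: insubP => [e _ ve|/negP[] //]; exists e.
have hinj : {in [set y | adj x y]%SET &, injective h}.
  move=> y y'; rewrite !inE => xy xy'.
  have [e ey ->] := he y xy; have [e' ey' ->] := he y' xy'.
  have [k _ ck] := cH e; have [k' _ ck'] := cH e'; rewrite ck ck' /= => kk'.
  apply/eqP/negPn/negP => nyy'.
  have nee' : e != e'.
    apply: contraNneq nyy' => ee'; apply/eqP.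
    have nxy : x != y by apply: contraTneq xy => ->; rewrite adj_irrefl.
    by apply: (pair_eq nxy); rewrite -ey -ey' ee'.
  have la : adj (s := H) e e'.
    rewrite /= /line_adj nee' /=; apply/set0Pn; exists x.
    by rewrite inE ey ey' !inE eqxx.
  have eH : [set (e : H); e']%SET \in edges H by apply/edgesP; exists e, e'.
  have eH' : [set (e' : H); e]%SET \in edges H by rewrite finset.setUC.
  have [xo _] := @std_orientationP H e e'.
  move: xo; rewrite la; case d: (std_orientation _ _) => /= d'.
    case: (cne (exist (fun s : {set H} => s \in edges H) _ eH) e e' erefl d).
    by rewrite ck ck' kk' subrr.
  case: (cne (exist (fun s : {set H} => s \in edges H) _ eH') e' e erefl _).
    by rewrite -d'.
  by rewrite ck ck' kk' subrr.
have sub : {subset [seq h y | y in [set y | adj x y]%SET] <= iota 0 j}.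
  move=> k /mapP[y]; rewrite mem_enum inE => xy ->; rewrite mem_iota add0n /=.
  by have [e _ ->] := he y xy; have [k' k'j ->] := cH e.
have u : uniq [seq h y | y in [set y | adj x y]%SET].
  rewrite map_inj_in_uniq ?enum_uniq // => y y'; rewrite !mem_enum; exact: hinj.
by have := uniq_leq_size u sub; rewrite size_map -cardE size_iota.
Qed.

Theorem theorem3p6 (R : realType) (G : sgraph) :
  planar R G ->
  max_degree G = 4 ->
  (forall i : nat, 4 <= i <= 14 -> ~ has_cycle_of_length G i) ->
  chi'_gl G = max_degree G.
Proof.
move=> planarG deltaG no_cycles; rewrite deltaG.
have ch4 := line_graph_choosable planarG deltaG no_cycles.
have ge4 j : group_choosable (line_graph G) j -> 4 <= j.
  move=> /choosable_ge_max_degree chj; rewrite -deltaG.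
  by apply/bigmax_leqP => x _; apply: chj.
apply: xget_unique; first by split.
by move=> j [chj minj]; apply/eqP; rewrite eqn_leq ge4 // minj.
Qed.
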